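(* TREE-COMPLETION is $\mathbb{NP}$-hard, even when the input tree is a spider.
   Context: A connected graph $H$ has a $(k,1)$-cover if every edge of $H$ is contained in at least one clique of order $k$. For a connected graph $G=(V,E)$, a set $E'\subseteq (V\times V)\setminus E$ of non-edges is a $k$-completion set of $G$ if $G\cup E'$ has a $(k,1)$-cover. TREE-COMPLETION: given a tree $T=(V,E)$ and two integers $k\le |V|$ and $t\ge 0$ (both part of the input), decide whether $T$ has a $k$-completion set of size $t$. A spider is a tree with exactly one vertex of degree at least $3$ (its center); the tree is the union of paths (legs) meeting at the center. *)

(* Defs.v *)
From mathcomp Require Import all_boot.
Set Implicit Arguments. Unset Strict Implicit. Unset Printing Implicit Defensive.

Definition eadj (n : nat) (E : seq (nat * nat)) : rel 'I_n :=
  fun x y => (x != y) && (((val x, val y) \in E) || ((val y, val x) \in E)).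

Definition wf_edges (n : nat) (E : seq (nat * nat)) : bool :=
  all (fun e => [&& e.1 < n, e.2 < n & e.1 != e.2]) E.

(* edges as unordered pairs, represented by ordered pairs x < y *)
Definition edge_set (n : nat) (adj : rel 'I_n) : {set 'I_n * 'I_n} :=
  [set p | (val p.1 < val p.2) && adj p.1 p.2].

Definition connected_graph (n : nat) (adj : rel 'I_n) : Prop :=
  forall x y : 'I_n, connect adj x y.

Definition is_tree (n : nat) (adj : rel 'I_n) : Prop :=
  0 < n /\ connected_graph adj /\ #|edge_set adj| = n.-1.

Definition degree (n : nat) (adj : rel 'I_n) (x : 'I_n) : nat :=
  #|[set y | adj x y]|.

Definition is_spider (n : nat) (adj : rel 'I_n) : Prop :=
  is_tree adj /\ #|[set x | 3 <= degree adj x]| = 1.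

Definition is_clique (n : nat) (adj : rel 'I_n) (K : {set 'I_n}) : Prop :=
  forall a b, a \in K -> b \in K -> a != b -> adj a b.

Definition has_k1_cover (n : nat) (adj : rel 'I_n) (k : nat) : Prop :=
  forall x y, adj x y ->
    exists K : {set 'I_n}, [/\ #|K| = k, x \in K, y \in K & is_clique adj K].

Definition add_edges (n : nat) (adj : rel 'I_n) (F : {set 'I_n * 'I_n}) : rel 'I_n :=
  fun x y => [|| adj x y, (x, y) \in F | (y, x) \in F].

Definition has_completion_set (n : nat) (adj : rel 'I_n) (k t : nat) : Prop :=
  exists F : {set 'I_n * 'I_n},
    [/\ (forall p, p \in F -> (val p.1 < val p.2) && ~~ adj p.1 p.2),
        #|F| = t
      & has_k1_cover (add_edges adj F) k].

Fixpoint bits_aux (fuel m : nat) : seq bool :=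
  if fuel is fuel'.+1 then
    (if m is 0 then [::] else odd m :: bits_aux fuel' m./2)
  else [::].
Definition bits (m : nat) : seq bool := bits_aux m m.

(* self-delimiting binary code of a natural number *)
Definition enc_nat (m : nat) : seq bool :=
  flatten [seq [:: true; b] | b <- bits m] ++ [:: false; false].

Definition enc_nats (s : seq nat) : seq bool := flatten (map enc_nat s).

Definition enc_instance (n k t : nat) (E : seq (nat * nat)) : seq bool :=
  enc_nats (n :: k :: t :: flatten [seq [:: e.1; e.2] | e <- E]).

Definition SPIDER_COMPLETION (w : seq bool) : Prop :=
  exists (n k t : nat) (E : seq (nat * nat)),
    [/\ w = enc_instance n k t E, wf_edges n E, is_spider (@eadj n E),
        k <= n & has_completion_set (@eadj n E) k t].

(* A model of computation: deterministic single-tape Turing machines   *)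
(* over the alphabet {0,1,blank}                                        *)

Inductive dir := DLeft | DRight | DStay.

Record TM := {
  tm_n : nat;
  tm_delta : 'I_tm_n.+1 -> option bool -> 'I_tm_n.+1 * option bool * dir;
  tm_start : 'I_tm_n.+1;
  tm_halt : 'I_tm_n.+1 }.

(* configuration: state, left part (nearest cell first), head cell, right part *)
Record config (M : TM) := Config {
  c_state : 'I_(tm_n M).+1;
  c_left : seq (option bool);
  c_head : option bool;
  c_right : seq (option bool) }.

Definition step (M : TM) (c : config M) : config M :=
  if c_state c == tm_halt M then c else
  let: (q', s', d) := tm_delta (c_state c) (c_head c) in
  match d with
  | DLeft => Config q' (behead (c_left c)) (head None (c_left c)) (s' :: c_right c)
  | DRight => Config q' (s' :: c_left c) (head None (c_right c)) (behead (c_right c))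
  | DStay => Config q' (c_left c) s' (c_right c)
  end.

Definition init (M : TM) (w : seq bool) : config M :=
  Config (tm_start M) [::] (head None (map Some w)) (behead (map Some w)).

Definition run (M : TM) (T : nat) (w : seq bool) : config M :=
  iter T (step (M := M)) (init M w).

Definition halted (M : TM) (c : config M) : bool := c_state c == tm_halt M.

Definition output (M : TM) (c : config M) : seq bool :=
  let s := c_head c :: c_right c in
  map (odflt false) (take (find (fun o => o == None) s) s).

Definition poly_time_computable (f : seq bool -> seq bool) : Prop :=
  exists (M : TM) (a d : nat), forall w,
    let T := a * (size w) ^ d + a in
    halted (run M T w) /\ output (run M T w) = f w.

Definition in_P (L : seq bool -> Prop) : Prop :=
  exists b : seq bool -> bool,
    poly_time_computable (fun w => [:: b w]) /\ (forall w, L w <-> b w).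

Definition pair_enc (w y : seq bool) : seq bool :=
  flatten [seq [:: true; b] | b <- w] ++ [:: false; false] ++ y.

Definition in_NP (L : seq bool -> Prop) : Prop :=
  exists V : seq bool -> Prop, in_P V /\
  exists a d : nat, forall w,
    L w <-> exists y, size y <= a * (size w) ^ d + a /\ V (pair_enc w y).

Definition NP_hard (L : seq bool -> Prop) : Prop :=
  forall L', in_NP L' ->
    exists f, poly_time_computable f /\ forall w, L' w <-> L (f w).

(* Main.v *)
(** The verifier's run on a guessed certificate is a space-time tableau, that is, a cyclic tiling
    in which consecutive cells and cells one row apart carry matching colours.  Such a tiling is
    turned into a perfect bin packing with polynomially bounded numbers: every possible tile of
    every cell is a bin which either takes the "actual" elements of its edges, and is then the
    chosen tile, or dummies; a bin per edge and colour absorbs the actual elements of the unused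
    colours.  The items become the legs of a spider: a connected graph on [n] vertices whose edges
    lie in [k]-cliques has at least [(n - 1) k / 2] edges, with equality only if the cliques
    pairwise share at most one vertex, and then each clique is the center together with entire
    legs of total length [k - 1].
    The reduction is a bounded-loop program over unary counters, and any such program runs in
    polynomial time on a one-tape machine that keeps the counters as interleaved unary tracks. *)
Require Import Defs.
From mathcomp Require Import all_boot zify.
Set Implicit Arguments. Unset Strict Implicit. Unset Printing Implicit Defensive.

(** * Turing machine combinators *)

(** A spider has as many vertices as its legs have in total, so the packing numbers must stay
    polynomial in value: a weight has twelve digits in a base linear in the number of cells, and the
    top digit is positive on every item, which limits the number of items per bin and rules out
    carries. Bins must be filled exactly, like the cliques: a bin of capacity [B] is a clique of
    order [B + 1] through the center, and [N (B - 1) / 2] added edges on [N + 1] vertices meet the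
    lower bound with no slack. The cells of the tableau form one cyclic sequence, and the two
    adjacencies are its shifts by one and by the row width. Shifts are permutations, so each edge
    has exactly one tail and one head. Conditions that depend on the position of a tile are moved
    into the colours: a forbidden tile gets an outgoing colour that is never an incoming one.
    Programs are not syntax but an inductive predicate on Rocq functions, closed under pointwise
    equality. The reduction is an ordinary function, and its membership is proved along its
    definition. *)

Definition sym := option bool.

Record tape := Tape { tp_left : seq sym; tp_head : sym; tp_right : seq sym }.

Definition tmove (d : dir) (s : sym) (tp : tape) : tape :=
  match d with
  | DLeft => Tape (behead (tp_left tp)) (head None (tp_left tp)) (s :: tp_right tp)
  | DRight => Tape (s :: tp_left tp) (head None (tp_right tp)) (behead (tp_right tp))
  | DStay => Tape (tp_left tp) s (tp_right tp)
  end.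

(** A machine ends by producing a value of [X] instead of reaching a halting state; the value can
    select the next machine, so sequencing is a monadic bind. The entry [ment] may itself be an
    exit, so that [mret] takes no step. *)
Record mach (X : Type) := Mach {
  mst : finType;
  ment : mst + X;
  mdelta : mst -> sym -> (mst + X) * sym * dir }.

Definition mstep X (M : mach X) (c : (mst M + X) * tape) : (mst M + X) * tape :=
  match c.1 with
  | inl q => let: (s, b, d) := mdelta q (tp_head c.2) in (s, tmove d b c.2)
  | inr _ => c
  end.

(** Exits are absorbing, so [n] is an upper bound on the running time. *)
Definition runs X (M : mach X) (tp : tape) (n : nat) (x : X) (tp' : tape) : Prop :=
  iter n (@mstep X M) (ment M, tp) = (inr x, tp').

Lemma iter_mstep_exit X (M : mach X) n x tp :
  iter n (@mstep X M) (inr x, tp) = (inr x, tp).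
Proof. by elim: n => //= n ->. Qed.

Lemma iter_mstep_le X (M : mach X) n n' c x tp : n <= n' ->
  iter n (@mstep X M) c = (inr x, tp) -> iter n' (@mstep X M) c = (inr x, tp).
Proof. by move=> /subnK <-; rewrite iterD => ->; exact: iter_mstep_exit. Qed.

Lemma runs_le X (M : mach X) tp n n' x tp' :
  n <= n' -> runs M tp n x tp' -> runs M tp n' x tp'.
Proof. exact: iter_mstep_le. Qed.

Definition mret X (x : X) : mach X :=
  @Mach X void (inr x) (fun v => match v with end).

Lemma runs_mret X (x : X) tp n : runs (mret x) tp n x tp.
Proof. exact: iter_mstep_exit. Qed.

Section Bind.
Variables (X : finType) (Y : Type) (M : mach X) (f : X -> mach Y).

Definition bind_st : finType := (mst M + {x : X & mst (f x)})%type.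

Definition emb2 (x : X) (s : mst (f x) + Y) : bind_st + Y :=
  match s with inl q => inl (inr (existT _ x q)) | inr y => inr y end.

(** An exit of [M] is sent straight to the entry of [f x], so handing over costs no step. *)
Definition emb1 (s : mst M + X) : bind_st + Y :=
  match s with inl q => inl (inl q) | inr x => emb2 (ment (f x)) end.

Definition mbind : mach Y :=
  @Mach Y bind_st (emb1 (ment M)) (fun q a =>
    match q with
    | inl q1 => let: (s, b, d) := mdelta q1 a in (emb1 s, b, d)
    | inr (existT x q2) => let: (s, b, d) := mdelta q2 a in (emb2 s, b, d)
    end).

Lemma mbind_step2 x (s : mst (f x) + Y) tp :
  @mstep _ mbind (emb2 s, tp) =
  let c := @mstep _ (f x) (s, tp) in (emb2 c.1, c.2).
Proof.
case: s => [q|y] //; rewrite /mstep /=.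
by case: (mdelta q (tp_head tp)) => [[s b] d].
Qed.

Lemma mbind_iter2 x n (c : (mst (f x) + Y) * tape) :
  iter n (@mstep _ mbind) (emb2 c.1, c.2) =
  let c' := iter n (@mstep _ (f x)) c in (emb2 c'.1, c'.2).
Proof.
by elim: n => //= n ->; rewrite mbind_step2 /=; case: (iter n _ c).
Qed.

(** [M] may exit before step [n], and the composed machine then already runs [f x]; hence the
    equality is claimed only at the exact exit time [n']. *)
Lemma mbind_iter1 n (c : (mst M + X) * tape) x tp :
  iter n (@mstep _ M) c = (inr x, tp) ->
  exists2 n', n' <= n & iter n' (@mstep _ mbind) (emb1 c.1, c.2) = (emb2 (ment (f x)), tp).
Proof.
elim: n c => [|n IHn] [[q|x'] tp0].
- by [].
- by case=> -> ->; exists 0.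
- rewrite iterSr => /IHn [n' le_n H]; exists n'.+1 => //.
  rewrite iterSr -H; congr (iter _ _ _); rewrite /mstep /=.
  by case: (mdelta q (tp_head tp0)) => [[s b] d].
- by rewrite iter_mstep_exit => -[-> ->]; exists 0.
Qed.

Lemma runs_mbind tp n1 x tp1 n2 y tp2 :
  runs M tp n1 x tp1 -> runs (f x) tp1 n2 y tp2 -> runs mbind tp (n1 + n2) y tp2.
Proof.
move=> /mbind_iter1 [n' le_n H1] H2.
apply: (@runs_le _ _ _ (n' + n2)); first by rewrite leq_add2r.
rewrite /runs addnC iterD.
rewrite [iter n' _ _]H1 (@mbind_iter2 x n2 (ment (f x), tp1)).
by rewrite [iter n2 _ _]H2.
Qed.

End Bind.

Section Loop.
Variables (Y : Type) (M : mach (option Y)).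

Definition lemb (s : mst M + option Y) : option (mst M) + Y :=
  match s with
  | inl q => inl (Some q)
  | inr None => inl None
  | inr (Some y) => inr y
  end.

(** The body exits with [None] to be repeated and with [Some y] to leave the loop. Re-entry passes
    through an extra state and costs a step, because the entry of the body may itself be the exit
    [None]. *)
Definition mloop : mach Y :=
  @Mach Y (option (mst M)) (inl None) (fun q a =>
    match q with
    | None => (lemb (ment M), a, DStay)
    | Some q' => let: (s, b, d) := mdelta q' a in (lemb s, b, d)
    end).

Lemma mloop_iter n (c : (mst M + option Y) * tape) x tp :
  iter n (@mstep _ M) c = (inr x, tp) ->
  exists2 n', n' <= n & iter n' (@mstep _ mloop) (lemb c.1, c.2) = (lemb (inr x), tp).
Proof.
elim: n c => [|n IHn] [[q|x'] tp0].
- by [].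
- by case=> -> ->; exists 0.
- rewrite iterSr => /IHn [n' le_n H]; exists n'.+1 => //.
  rewrite iterSr -H; congr (iter _ _ _); rewrite /mstep /=.
  by case: (mdelta q (tp_head tp0)) => [[s b] d].
- by rewrite iter_mstep_exit => -[-> ->]; exists 0.
Qed.

Lemma mloop_first tp : @mstep _ mloop (inl None, tp) = (lemb (ment M), tp).
Proof. by case: tp. Qed.

Lemma runs_mloop_end tp n y tp1 :
  runs M tp n (Some y) tp1 -> runs mloop tp n.+1 y tp1.
Proof.
move=> /mloop_iter [n' le_n H].
apply: (@runs_le _ _ _ n'.+1) => //.
by rewrite /runs iterSr mloop_first [iter _ _ _]H.
Qed.

Lemma runs_mloop_step tp n tp1 n1 y tp2 :
  runs M tp n None tp1 -> runs mloop tp1 n1 y tp2 -> runs mloop tp (n.+1 + n1) y tp2.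
Proof.
move=> /mloop_iter [n' le_n H] H1.
apply: (@runs_le _ _ _ (n'.+1 + n1)); first by rewrite leq_add2r.
by rewrite /runs addnC iterD iterSr mloop_first [iter n' _ _]H.
Qed.

End Loop.

Section Compile.
Variable M : mach unit.

Definition st_code (s : mst M + unit) : 'I_(#|mst M|.+1) :=
  cast_ord (card_option (mst M))
    (enum_rank (match s with inl q => Some q | inr _ => None end)).

Definition st_decode (i : 'I_(#|mst M|.+1)) : mst M + unit :=
  match enum_val (cast_ord (esym (card_option (mst M))) i) with
  | Some q => inl q | None => inr tt end.

Lemma st_codeK : cancel st_code st_decode.
Proof. by case=> [q|[]]; rewrite /st_code /st_decode cast_ordK enum_rankK. Qed.

Definition TM_of_mach : TM :=
  @Build_TM #|mst M| (fun i a =>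
    match st_decode i with
    | inl q => let: (s, b, d) := mdelta q a in (st_code s, b, d)
    | inr _ => (i, a, DStay)
    end) (st_code (ment M)) (st_code (inr tt)).

Definition conf_of (c : (mst M + unit) * tape) : config TM_of_mach :=
  @Config TM_of_mach (st_code c.1) (tp_left c.2) (tp_head c.2) (tp_right c.2).

Lemma step_conf_of c : step (conf_of c) = conf_of (mstep c).
Proof.
case: c => [[q|[]] tp]; rewrite /step /mstep /=; last by rewrite eqxx.
rewrite (can_eq st_codeK) /= st_codeK.
by case: (mdelta q (tp_head tp)) => [[s b] []].
Qed.

Definition init_tape (w : seq bool) : tape :=
  Tape [::] (head None (map Some w)) (behead (map Some w)).

Definition tape_output (tp : tape) : seq bool :=
  let s := tp_head tp :: tp_right tp in
  map (odflt false) (take (find (fun o => o == None) s) s).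

Lemma run_TM_of_mach w n tp : runs M (init_tape w) n tt tp ->
  halted (run TM_of_mach n w) /\ output (run TM_of_mach n w) = tape_output tp.
Proof.
move=> H; have -> : run TM_of_mach n w = conf_of (iter n (@mstep _ M) (ment M, init_tape w)).
  by rewrite /run; elim: n {H} => //= n ->; rewrite step_conf_of.
by rewrite [iter _ _ _]H; split=> //; rewrite /halted /=.
Qed.

End Compile.

(* At rest the head scans the separating blank; [u] is the work area on its left and [R] the bit stack on its right. *)
Definition rest (u R : seq bool) (tp : tape) : Prop :=
  exists k k', tp = Tape (map Some u ++ nseq k None) None (map Some R ++ nseq k' None).

Lemma head_nseqNone k : head None (nseq k None) = None :> sym.
Proof. by case: k. Qed.

Lemma behead_nseq (T : Type) k (x : T) : behead (nseq k x) = nseq k.-1 x.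
Proof. by case: k. Qed.

Definition tape_at_left (l r : seq sym) := Tape (behead l) (head None l) r.
Definition tape_at_right (l r : seq sym) := Tape l (head None r) (behead r).

Fixpoint mealy (S : Type) (d : S -> bool -> S * bool) (s : S) (u : seq bool) : S * seq bool :=
  if u is b :: u' then
    let: (s1, b1) := d s b in let: (s2, u2) := mealy d s1 u' in (s2, b1 :: u2)
  else (s, [::]).

Lemma size_mealy (S : Type) (d : S -> bool -> S * bool) s u : size (mealy d s u).2 = size u.
Proof.
elim: u s => //= b u IHu s; case: (d s b) => s1 b1.
by move: (IHu s1); case: (mealy d s1 u) => s2 u2 /= ->.
Qed.

Inductive extends (S : Type) (e : S -> option (bool * S)) : S -> seq bool -> S -> Prop :=
| extends_nil s : e s = None -> extends e s [::] s
| extends_cons s b s1 l s2 : e s = Some (b, s1) -> extends e s1 l s2 -> extends e s (b :: l) s2.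

Section Sweep.
Variables (S : finType) (X : Type) (s0 : S).
Variables (d : S -> bool -> S * bool) (e : S -> option (bool * S)) (out : S -> X).

(** One pass outwards rewrites the work area by [d], the blanks beyond it are filled as long as [e]
    supplies bits, and the pass back keeps the final state, from which [out] computes the exit
    value. *)
Definition sweep : mach X :=
  @Mach X (unit + (S + S))%type (inl (inl tt)) (fun q a =>
    match q with
    | inl _ => (inl (inr (inl s0)), a, DLeft)
    | inr (inl s) =>
      match a with
      | Some b => let: (s1, b1) := d s b in (inl (inr (inl s1)), Some b1, DLeft)
      | None => if e s is Some (b, s1) then (inl (inr (inl s1)), Some b, DLeft)
                else (inl (inr (inr s)), None, DRight)
      end
    | inr (inr s) =>
      match a with
      | Some b => (inl (inr (inr s)), Some b, DRight)
      | None => (inr (out s), None, DStay)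
      end
    end).

Lemma sweep_mealy u s l r :
  iter (size u) (@mstep _ sweep) (inl (inr (inl s)), tape_at_left (map Some u ++ l) r) =
  (inl (inr (inl (mealy d s u).1)), tape_at_left l (rev (map Some (mealy d s u).2) ++ r)).
Proof.
elim: u s r => // b u IHu s r; rewrite [size _]/= iterSr /mstep /=.
case: (d s b) => s1 b1 /=; rewrite IHu.
by case: (mealy d s1 u) => s2 u2 /=; rewrite rev_cons cat_rcons.
Qed.

Lemma sweep_extend s u s' k r : extends e s u s' ->
  iter (size u) (@mstep _ sweep) (inl (inr (inl s)), tape_at_left (nseq k None) r) =
  (inl (inr (inl s')), tape_at_left (nseq (k - size u) None) (rev (map Some u) ++ r)).
Proof.
move=> H; elim: H k r => {s u s'} [s _|s b s1 u s2 He _ IH] k r; first by rewrite subn0.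
rewrite [size _]/= iterSr /mstep /= head_nseqNone He /= !behead_nseq.
have := IH k.-1 (Some b :: r); rewrite /tape_at_left !behead_nseq => ->.
have -> : k - size (b :: u) = k.-1 - size u by rewrite /=; lia.
by rewrite rev_cons cat_rcons.
Qed.

Lemma sweep_return v s l r :
  iter (size v) (@mstep _ sweep) (inl (inr (inr s)), tape_at_right l (map Some v ++ None :: r)) =
  (inl (inr (inr s)), tape_at_right (rev (map Some v) ++ l) (None :: r)).
Proof.
elim: v l => // b v IHv l; rewrite [size _]/= iterSr /mstep /=.
by rewrite IHv rev_cons cat_rcons.
Qed.

Lemma runs_sweep u u' s1 l s2 R tp : rest u R tp ->
  mealy d s0 u = (s1, u') -> extends e s1 l s2 ->
  exists2 tp', rest (u' ++ l) R tp' &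
    runs sweep tp (2 * (size u' + size l) + 3) (out s2) tp'.
Proof.
case=> k [k' ->] Hm He.
have Hs : size u' = size u by rewrite -(size_mealy d s0 u) Hm.
pose U := u' ++ l; pose k2 := k - size l.
(* Blanks are explicit list entries: the extension consumes them, and the turning point writes one
   back. *)
exists (Tape (map Some U ++ nseq (k2.-1).+1 None) None (map Some R ++ nseq k' None)).
  by exists (k2.-1).+1, k'.
have -> : 2 * (size u' + size l) + 3 = 1 + (size (rev U) + (1 + (size l + (size u + 1)))).
  by rewrite size_rev size_cat; lia.
rewrite /runs !iterD.
have -> : iter 1 (@mstep _ sweep) (ment sweep, Tape (map Some u ++ nseq k None) None (map Some R ++ nseq k' None)) = (inl (inr (inl s0)), tape_at_left (map Some u ++ nseq k None) (None :: map Some R ++ nseq k' None)) by [].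
rewrite sweep_mealy Hm [(s1, u').1]/= [(s1, u').2]/= (sweep_extend _ _ He) -/k2.
have He2 : e s2 = None by elim: He.
set rr := (X in tape_at_left (nseq k2 None) X).
have -> : iter 1 (@mstep _ sweep) (inl (inr (inl s2)), tape_at_left (nseq k2 None) rr) =
    (inl (inr (inr s2)), tape_at_right (None :: nseq k2.-1 None) rr).
  by rewrite /= /mstep /= head_nseqNone He2 /= behead_nseq.
have -> : rr = map Some (rev U) ++ None :: map Some R ++ nseq k' None.
  by rewrite map_rev map_cat rev_cat -catA.
by rewrite sweep_return map_rev revK.
Qed.

End Sweep.

(** * The bit stack on the right of the separating blank *)

Section Stack.

(** The top of the stack is its far end. Pushing thus writes the output in reading order, and
    popping delivers the input from its last bit on. *)
Definition push (b : bool) : mach unit :=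
  @Mach unit (option bool) (inl None) (fun q a =>
    match q, a with
    | None, _ => (inl (Some true), a, DRight)
    | Some true, Some c => (inl (Some true), Some c, DRight)
    | Some true, None => (inl (Some false), Some b, DLeft)
    | Some false, Some c => (inl (Some false), Some c, DLeft)
    | Some false, None => (inr tt, None, DStay)
    end).

Lemma push_right b R l r :
  iter (size R) (@mstep _ (push b)) (inl (Some true), tape_at_right l (map Some R ++ r)) =
  (inl (Some true), tape_at_right (rev (map Some R) ++ l) r).
Proof.
elim: R l => // c R IH l; rewrite [size _]/= iterSr /mstep /=.
by rewrite IH rev_cons cat_rcons.
Qed.

Lemma push_left b R l r :
  iter (size R) (@mstep _ (push b)) (inl (Some false), tape_at_left (map Some R ++ l) r) =
  (inl (Some false), tape_at_left l (rev (map Some R) ++ r)).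
Proof.
elim: R r => // c R IH r; rewrite [size _]/= iterSr /mstep /=.
by rewrite IH rev_cons cat_rcons.
Qed.

Lemma runs_push b u R tp : rest u R tp ->
  exists2 tp', rest u (rcons R b) tp' & runs (push b) tp (2 * size R + 3) tt tp'.
Proof.
case=> k [k' ->].
exists (Tape (map Some u ++ nseq k None) None (map Some (rcons R b) ++ nseq k'.-1 None)).
  by exists k, k'.-1.
have -> : 2 * size R + 3 = 1 + (size (rev R) + (1 + (size R + 1))) by rewrite size_rev; lia.
rewrite /runs !iterD.
have -> : iter 1 (@mstep _ (push b)) (ment (push b), Tape (map Some u ++ nseq k None) None (map Some R ++ nseq k' None)) = (inl (Some true), tape_at_right (None :: map Some u ++ nseq k None) (map Some R ++ nseq k' None)) by [].
rewrite push_right.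
set ll := rev (map Some R) ++ _.
have -> : iter 1 (@mstep _ (push b)) (inl (Some true), tape_at_right ll (nseq k' None)) =
    (inl (Some false), tape_at_left ll (Some b :: nseq k'.-1 None)).
  by rewrite /= /mstep /= head_nseqNone /= behead_nseq.
rewrite /ll -map_rev push_left map_rev revK.
by rewrite /= /mstep /= -cats1 map_cat -catA.
Qed.

Definition pop : mach (option bool) :=
  @Mach (option bool) (option (option (option bool))) (inl None) (fun q a =>
    match q, a with
    | None, _ => (inl (Some None), a, DRight)
    | Some None, Some c => (inl (Some None), Some c, DRight)
    | Some None, None => (inl (Some (Some None)), None, DLeft)
    | Some (Some None), Some c => (inl (Some (Some (Some c))), None, DLeft)
    | Some (Some None), None => (inr None, None, DStay)
    | Some (Some (Some b)), Some c => (inl (Some (Some (Some b))), Some c, DLeft)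
    | Some (Some (Some b)), None => (inr (Some b), None, DStay)
    end).

Lemma pop_right R l r :
  iter (size R) (@mstep _ pop) (inl (Some None), tape_at_right l (map Some R ++ r)) =
  (inl (Some None), tape_at_right (rev (map Some R) ++ l) r).
Proof.
elim: R l => // c R IH l; rewrite [size _]/= iterSr /mstep /=.
by rewrite IH rev_cons cat_rcons.
Qed.

Lemma pop_left b R l r :
  iter (size R) (@mstep _ pop) (inl (Some (Some (Some b))), tape_at_left (map Some R ++ l) r) =
  (inl (Some (Some (Some b))), tape_at_left l (rev (map Some R) ++ r)).
Proof.
elim: R r => // c R IH r; rewrite [size _]/= iterSr /mstep /=.
by rewrite IH rev_cons cat_rcons.
Qed.

Lemma runs_pop_nil u tp : rest u [::] tp ->
  exists2 tp', rest u [::] tp' & runs pop tp 3 None tp'.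
Proof.
case=> k [k' ->].
exists (Tape (map Some u ++ nseq k None) None (nseq k'.-1.+1 None)).
  by exists k, k'.-1.+1.
by rewrite /runs /= /mstep /= head_nseqNone /= behead_nseq.
Qed.

Lemma runs_pop u R b tp : rest u (rcons R b) tp ->
  exists2 tp', rest u R tp' & runs pop tp (2 * size R + 5) (Some b) tp'.
Proof.
case=> k [k' ->].
exists (Tape (map Some u ++ nseq k None) None (map Some R ++ nseq k'.-1.+2 None)).
  by exists k, k'.-1.+2.
have -> : 2 * size R + 5 = 1 + (size (rev R) + (1 + (1 + (size (rcons R b) + 1)))).
  by rewrite size_rev size_rcons; lia.
rewrite /runs !iterD.
have -> : iter 1 (@mstep _ pop) (ment pop, Tape (map Some u ++ nseq k None) None (map Some (rcons R b) ++ nseq k' None)) = (inl (Some None), tape_at_right (None :: map Some u ++ nseq k None) (map Some (rcons R b) ++ nseq k' None)) by [].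
rewrite pop_right.
set ll := rev (map Some _) ++ _.
have -> : iter 1 (@mstep _ pop) (inl (Some None), tape_at_right ll (nseq k' None)) =
    (inl (Some (Some None)), tape_at_left ll (None :: nseq k'.-1 None)).
  by rewrite /= /mstep /= head_nseqNone /= behead_nseq.
set l2 := rev (map Some R) ++ None :: map Some u ++ nseq k None.
have -> : iter 1 (@mstep _ pop) (inl (Some (Some None)), tape_at_left ll (None :: nseq k'.-1 None)) =
    (inl (Some (Some (Some b))), tape_at_left l2 (nseq k'.-1.+2 None)).
  by rewrite /ll map_rcons rev_rcons.
by rewrite /l2 -map_rev pop_left map_rev revK.
Qed.

End Stack.

(** * Counters on interleaved tracks *)
(** Action of a transducer on one block, that is, on the bits of all tracks at one position; it
    knows the track [j] of each bit. *)
Fixpoint track_run (S : Type) (d : nat -> S -> bool -> S * bool) (s : S) (js : seq nat)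
    (f : nat -> bool) : S * seq bool :=
  if js is j :: js' then
    let: (s1, b1) := d j s (f j) in
    let: (s2, u2) := track_run d s1 js' f in (s2, b1 :: u2)
  else (s, [::]).

Lemma track_run_id S (s : S) js f : track_run (fun _ s b => (s, b)) s js f = (s, map f js).
Proof. by elim: js => //= j js ->. Qed.

Lemma track_run_one S (g : S -> bool -> S * bool) r s js f : uniq js ->
  track_run (fun j s b => if j == r then g s b else (s, b)) s js f =
  ((if r \in js then (g s (f r)).1 else s),
   map (fun j => if j == r then (g s (f r)).2 else f j) js).
Proof.
elim: js s => //= j js IH s /andP [jNjs Ujs]; rewrite inE.
have [e|ne] := eqVneq j r; last by rewrite IH // [r == j]eq_sym (negbTE ne).
subst j; rewrite /=; case E: (g s (f r)) => [s1 b1] /=.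
rewrite IH // (negbTE jNjs); congr (_, _ :: _).
by apply/eq_in_map => i ij; case: eqP => // ir; rewrite -ir ij in jNjs.
Qed.

Lemma track_run_two S (g1 g2 : S -> bool -> S) lo hi K s f : lo < hi < K ->
  track_run (fun j s b => ((if j == lo then g1 s b else if j == hi then g2 s b else s), b))
    s (iota 0 K) f =
  (g2 (g1 s (f lo)) (f hi), map f (iota 0 K)).
Proof.
move=> /andP [lt1 lt2]; pose h s j := if j == lo then g1 s (f j) else if j == hi then g2 s (f j) else s.
have -> js : track_run (fun j s b => ((if j == lo then g1 s b else if j == hi then g2 s b else s), b)) s js f =
  (foldl h s js, map f js) by elim: js s => //= j js IH s; rewrite IH.
congr (_, _).
have -> : iota 0 K = iota 0 lo ++ lo :: iota lo.+1 (hi - lo.+1) ++ hi :: iota hi.+1 (K - hi.+1).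
  have -> : K = lo + (1 + ((hi - lo.+1) + (1 + (K - hi.+1)))) by lia.
  rewrite !iotaD /=; congr (_ ++ _); rewrite add0n; congr (_ :: _).
  by congr (iota _ _ ++ _ :: iota _ _); lia.
have nop m n s1 : (forall j, m <= j < m + n -> (j != lo) && (j != hi)) -> foldl h s1 (iota m n) = s1.
  elim: n m s1 => //= n IH m s1 H; have /andP [/negbTE e1 /negbTE e2] : (m != lo) && (m != hi) by apply: H; lia.
  by rewrite {2}/h e1 e2 IH // => j Hj; apply: H; lia.
rewrite foldl_cat nop /=; last by move=> j; lia.
rewrite {2}/h eqxx foldl_cat nop /=; last by move=> j; lia.
rewrite {2}/h eqxx ifF; last by lia.
by rewrite nop // => j; lia.
Qed.

Section Tracks.
Variable K' : nat.
Local Notation K := K'.+1.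

(** Track [j] at position [p] is bit [p * K + j], and position 0 is nearest to the separating
    blank. *)
Definition word (P : nat) (tk : nat -> nat -> bool) : seq bool :=
  flatten [seq map (tk p) (iota 0 K) | p <- iota 0 P].

Lemma size_word P tk : size (word P tk) = P * K.
Proof.
rewrite size_flatten /shape -map_comp.
rewrite (eq_map (g := fun=> K)); last by move=> p /=; rewrite size_map size_iota.
by elim: P 0 => //= P IH m; rewrite IH mulSn.
Qed.

Lemma wordS P tk : word P.+1 tk = word P tk ++ map (tk P) (iota 0 K).
Proof. by rewrite /word -[P.+1]addn1 (iotaD 0 P 1) map_cat flatten_cat /= cats0. Qed.

Lemma eq_word P tk tk' : (forall p j, p < P -> j < K -> tk p j = tk' p j) -> word P tk = word P tk'.
Proof.
move=> H; congr flatten; apply/eq_in_map => p; rewrite mem_iota add0n => /andP [_ lp].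
by apply/eq_in_map => j; rewrite mem_iota => /andP [_ lj]; apply: H.
Qed.

Definition track_delta S (d : nat -> S -> bool -> S * bool) (q : 'I_K * S) (b : bool) :=
  let: (s', b') := d (val q.1) q.2 b in ((ordS q.1, s'), b').

Lemma mealy_cat S (d : S -> bool -> S * bool) s u v :
  mealy d s (u ++ v) = let: (s1, u1) := mealy d s u in
                       let: (s2, v2) := mealy d s1 v in (s2, u1 ++ v2).
Proof.
elim: u s => [|b u IHu] s /=; first by case: (mealy d s v).
case: (d s b) => s1 b1; rewrite IHu; case: (mealy d s1 u) => s2 u2.
by case: (mealy d s2 v).
Qed.

Lemma ordS_lt (j : 'I_K) : j.+1 < K -> val (ordS j) = j.+1.
Proof. by move=> lt; rewrite /= modn_small. Qed.

Lemma ordS_last (j : 'I_K) : j.+1 = K -> ordS j = ord0.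
Proof. by move=> e; apply: val_inj; rewrite /= e modnn. Qed.

Lemma mealy_block S (d : nat -> S -> bool -> S * bool) f s (j : 'I_K) m : j + m.+1 = K ->
  mealy (track_delta d) (j, s) (map f (iota j m.+1)) =
  let: (s', v) := track_run d s (iota j m.+1) f in ((ord0, s'), v).
Proof.
elim: m j s => [|m IH] j s e.
  rewrite /= /track_delta /=; case: (d j s (f j)) => s1 b1.
  by rewrite ordS_last //; lia.
have lt : j.+1 < K by lia.
have H s1 := IH (ordS j) s1 (etrans (congr1 (addn^~ _) (ordS_lt lt)) (etrans (addSnnS j m.+1) e)).
have -> : iota j m.+2 = (j : nat) :: iota (ordS j) m.+1 by rewrite ordS_lt.
move: (iota (ordS j) m.+1) H => js H; rewrite map_cons.
rewrite [mealy _ _ _]/= [track_run _ _ _ _]/= {1}/track_delta [(j, s).1]/= [(j, s).2]/=.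
by case: (d j s (f j)) => s1 b1; rewrite H; case: (track_run _ _ _ _).
Qed.

Lemma mealy_word S (d : nat -> S -> bool -> S * bool) (sg : nat -> S) tk tk' P :
  (forall p, p < P -> track_run d (sg p) (iota 0 K) (tk p) = (sg p.+1, map (tk' p) (iota 0 K))) ->
  mealy (track_delta d) (ord0, sg 0) (word P tk) = ((ord0, sg P), word P tk').
Proof.
elim: P => [|P IH] H //.
rewrite !wordS mealy_cat IH => [|p lt]; last by apply: H; lia.
by rewrite (@mealy_block _ d (tk P) (sg P) ord0 K') // H.
Qed.

(** The flag tells whether the extension is finished: a sweep that arrives with [true] appends
    nothing, one that arrives with [false] appends exactly one block. *)
Definition append_block (g : nat -> bool) (q : 'I_K * bool) : option (bool * ('I_K * bool)) :=
  if q.2 then None else Some (g (val q.1), (ordS q.1, val q.1 == K')).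

Lemma extends_append_block g (j : 'I_K) m : j + m.+1 = K ->
  extends (append_block g) (j, false) (map g (iota j m.+1)) (ord0, true).
Proof.
elim: m j => [|m IH] j e.
  apply: (@extends_cons _ _ _ _ (ord0, true)); last exact: extends_nil.
  rewrite /append_block /= ordS_last; last by lia.
  by congr (Some (_, (_, _))); apply/eqP; lia.
have lt : j.+1 < K by lia.
apply: (@extends_cons _ _ _ _ (ordS j, false)).
  by rewrite /append_block /=; congr (Some (_, (_, _))); apply/eqP; lia.
by rewrite -[j.+1]ordS_lt //; apply: IH; rewrite ordS_lt //; lia.
Qed.

Lemma extends_block g : extends (append_block g) (ord0, false) (map g (iota 0 K)) (ord0, true).
Proof. exact: (@extends_append_block g ord0 K'). Qed.

Definition track_sweep (S : finType) X (s0 : S) d e (out : S -> X) : mach X :=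
  @sweep _ X (ord0 : 'I_K, s0) (track_delta d) e (fun q => out q.2).

Lemma runs_track_sweep (S : finType) X d e (out : S -> X) (sg : nat -> S) tk tk' P l s2 R tp :
  rest (word P tk) R tp ->
  (forall p, p < P -> track_run d (sg p) (iota 0 K) (tk p) = (sg p.+1, map (tk' p) (iota 0 K))) ->
  extends e (ord0, sg P) l s2 ->
  exists2 tp', rest (word P tk' ++ l) R tp' &
    runs (track_sweep (sg 0) d e out) tp (2 * (P * K + size l) + 3) (out s2.2) tp'.
Proof.
move=> Hr Hd He; have Hm := mealy_word Hd.
have [tp' H1 H2] := @runs_sweep _ X _ _ _ (fun q => out q.2) _ _ _ _ _ _ _ Hr Hm He.
by exists tp' => //; rewrite size_word in H2.
Qed.

Definition stop (S : Type) (_ : S) : option (bool * S) := None.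
Definition upd (f : nat -> nat) (r v : nat) : nat -> nat := fun j => if j == r then v else f j.

Record store := Store { st_reg : nat -> nat; st_len : nat; st_out : seq bool }.

(** Track 0 carries the input, last bit first; every other track carries a counter in unary. *)
Definition tracks (w : seq bool) (f : nat -> nat) (p j : nat) : bool :=
  if j == 0 then nth false (rev w) p else p < f j.

Definition rep (w : seq bool) (st : store) (tp : tape) : Prop :=
  [/\ size w <= st_len st, (forall j, 0 < j < K -> st_reg st j <= st_len st) &
      rest (word (st_len st) (tracks w (st_reg st))) (st_out st) tp].

Definition weight (st : store) := st_len st + size (st_out st).

(** Bounds the time of one primitive operation on a store of weight at most [C]: a sweep over all
    tracks or an excursion to the top of the stack, both ways. *)
Definition kappa (C : nat) := 2 * (K * C) + 2 * C + 3.

(** The number [N] bounds both the growth of the store and, in units of [kappa C], the time. As [C]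
    dominates [weight st + N], it dominates all intermediate weights, so costs simply add up under
    composition. *)
Definition exec (w : seq bool) X (M : mach X) (st : store) (N : nat) (x : X) (st' : store) : Prop :=
  weight st' <= weight st + N /\
  forall C tp, rep w st tp -> weight st + N <= C ->
    exists2 tp', rep w st' tp' & runs M tp (N * kappa C) x tp'.

Lemma exec_mret w X (x : X) st : exec w (mret x) st 0 x st.
Proof. by split=> [|C tp H _]; [lia | exists tp => //; exact: runs_mret]. Qed.

Lemma exec_mbind w (X : finType) Y (M : mach X) (f : X -> mach Y) st N1 x st1 N2 y st2 :
  exec w M st N1 x st1 -> exec w (f x) st1 N2 y st2 -> exec w (mbind M f) st (N1 + N2) y st2.
Proof.
move=> [W1 H1] [W2 H2]; split; first lia.
move=> C tp Hr leC.
have [||tp1 Hr1 R1] := H1 C tp => //; first by lia.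
have [||tp2 Hr2 R2] := H2 C tp1 => //; first by lia.
by exists tp2 => //; rewrite mulnDl; exact: runs_mbind R1 R2.
Qed.

Lemma exec_mloop_end w Y (M : mach (option Y)) st N y st1 :
  exec w M st N (Some y) st1 -> exec w (mloop M) st N.+1 y st1.
Proof.
move=> [W1 H1]; split; first lia.
move=> C tp Hr leC; have [||tp1 Hr1 R1] := H1 C tp => //; first by lia.
exists tp1 => //; apply: runs_le (runs_mloop_end R1).
by rewrite mulSn /kappa; lia.
Qed.

Lemma exec_mloop_step w Y (M : mach (option Y)) st N st1 N1 y st2 :
  exec w M st N None st1 -> exec w (mloop M) st1 N1 y st2 ->
  exec w (mloop M) st (N.+1 + N1) y st2.
Proof.
move=> [W1 H1] [W2 H2]; split; first lia.
move=> C tp Hr leC.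
have [||tp1 Hr1 R1] := H1 C tp => //; first by lia.
have [||tp2 Hr2 R2] := H2 C tp1 => //; first by lia.
exists tp2 => //; apply: runs_le (runs_mloop_step R1 R2).
by rewrite mulnDl mulSn /kappa; lia.
Qed.

(** A sweep adds at most one block, which settles time and growth; what is left to the user is the
    bitwise effect, described by the state [sg p] on reaching position [p]. *)
Lemma exec_sweep w (S : finType) X d e (out : S -> X) (sg : nat -> S) st st' x l s2 :
  st_out st' = st_out st -> st_len st <= st_len st' <= (st_len st).+1 ->
  (forall j, 0 < j < K -> st_reg st j <= st_len st -> st_reg st' j <= st_len st') ->
  (size w <= st_len st -> (forall j, 0 < j < K -> st_reg st j <= st_len st) ->
   exists tk', [/\
     (forall p, p < st_len st ->
        track_run d (sg p) (iota 0 K) (tracks w (st_reg st) p) = (sg p.+1, map (tk' p) (iota 0 K))),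
     extends e (ord0, sg (st_len st)) l s2,
     word (st_len st) tk' ++ l = word (st_len st') (tracks w (st_reg st')) & out s2.2 = x]) ->
  exec w (track_sweep (sg 0) d e out) st 1 x st'.
Proof.
move=> eo el er H; split; first by rewrite /weight eo; lia.
move=> C tp [H1 H2 H3] leC; have [tk' [H4 H5 H6 H7]] := H H1 H2.
have [tp' R1 R2] := @runs_track_sweep _ X d e out sg _ _ _ _ _ _ _ H3 H4 H5.
exists tp'; first by split; [lia | by move=> j Hj; apply: er (H2 j Hj) | rewrite eo -H6].
rewrite -H7; apply: runs_le R2; rewrite mul1n /kappa.
have : st_len st * K + size l = st_len st' * K by rewrite -(size_word (st_len st) tk') -size_cat H6 size_word.
rewrite /weight in leC; move=> ->.
have : st_len st' * K <= K * C by rewrite mulnC leq_mul2l; lia.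
by lia.
Qed.

Definition mzero (r : nat) : mach unit :=
  track_sweep tt (fun j s b => if j == r then (tt, false) else (s, b)) (@stop _) (fun _ => tt).

Lemma exec_mzero w r f P R : 0 < r < K ->
  exec w (mzero r) (Store f P R) 1 tt (Store (upd f r 0) P R).
Proof.
move=> Hr; apply: (@exec_sweep w _ _ _ _ _ (fun=> tt) _ _ _ [::] (ord0, tt));
  cbn [st_reg st_len st_out] => //; first by lia.
  by move=> j _; rewrite /upd; case: eqP.
move=> H1 H2; exists (fun p j => if j == r then false else tracks w f p j); split=> //.
- move=> p _; rewrite (@track_run_one _ (fun s b => (tt, false))) ?iota_uniq //.
  by case: ifP.
- exact: extends_nil.
- rewrite cats0; apply: eq_word => p j _ _; rewrite /tracks /upd.
  by case: (j =P 0) => [->|_]; case: eqP => //; lia.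
Qed.

(** The first zero of the track becomes a one, and the state records that it has been met. If there
    is none, a block with a single one, on track [r], is appended. *)
Definition minc (r : nat) : mach unit :=
  track_sweep false (fun j s b => if j == r then (s || ~~ b, b || ~~ s) else (s, b))
    (append_block (pred1 r)) (fun _ => tt).

Lemma exec_minc w r f P R : 0 < r < K ->
  exec w (minc r) (Store f P R) 1 tt (Store (upd f r (f r).+1) (if f r < P then P else P.+1) R).
Proof.
move=> Hr; have lt : f r <= P \/ P < f r by lia.
(* A counter longer than the work area is represented by no tape, so only the weight bound has
   content there. *)
case: lt => lt; last first.
  split; first by rewrite /weight /=; case: ifP; lia.
  by move=> C tp [_ H _]; have /= := H r Hr; lia.
apply: (@exec_sweep w _ _ _ _ _ (fun p => f r < p) _ _ _
          (if f r < P then [::] else map (pred1 r) (iota 0 K)) (ord0, true));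
  cbn [st_reg st_len st_out] => //.
- by case: ifP; lia.
- by move=> j Hj; rewrite /upd; case: eqP => [->|_]; case: ifP; lia.
move=> H1 H2; exists (fun p j => if j == r then p < (f r).+1 else tracks w f p j); split=> //.
- move=> p ltp; rewrite (@track_run_one _ (fun s b => (s || ~~ b, b || ~~ s))) ?iota_uniq //.
  have -> : tracks w f p r = (p < f r) by rewrite /tracks ifF //; lia.
  rewrite ifT; last by rewrite mem_iota; lia.
  congr (_, _); first by rewrite [fst _]/=; lia.
  by apply: eq_map => j; case: eqP => // _; rewrite [snd _]/=; lia.
- case: ltnP => ltP; first by rewrite /=; apply: extends_nil.
  exact: extends_block.
- have E p j : p <= P -> j < K -> (if j == r then p < (f r).+1 else tracks w f p j) = tracks w (upd f r (f r).+1) p j.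
    by move=> _ _; rewrite /tracks /upd; case: (j =P 0) => [->|_]; case: (_ =P r) => //; lia.
  case: ltnP => ltP.
    by rewrite cats0; apply: eq_word => p j ltp ltj; apply: E => //; lia.
  rewrite wordS; congr (_ ++ _); first by apply: eq_word => p j ltp ltj; apply: E => //; lia.
  apply/eq_in_map => j; rewrite mem_iota => /andP [_ ltj].
  rewrite -E // /=; case: eqP => // njr; rewrite /tracks.
  case: eqP => [j0|/eqP j0]; first by rewrite nth_default // size_rev.
  by have := H2 j; lia.
Qed.

(** The state keeps the bit of the lower track until the higher track of the same block is read, and
    whether all blocks agreed so far. *)
Definition meq (r s : nat) : mach bool :=
  track_sweep (false, true)
    (fun j q b => ((if j == minn r s then (b, q.2)
                    else if j == maxn r s then (q.1, q.2 && (q.1 == b)) else q), b))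
    (@stop _) (fun q => q.2).

Lemma exec_meq w r s f P R : 0 < r < K -> 0 < s < K -> r != s ->
  exec w (meq r s) (Store f P R) 1 (f r == f s) (Store f P R).
Proof.
move=> Hr Hs rs; set lo := minn r s; set hi := maxn r s.
pose sg p := ((if p is p'.+1 then p' < f lo else false), minn p (f lo) == minn p (f hi)).
have sg0 : sg 0 = (false, true) by rewrite /sg !min0n eqxx.
rewrite /meq -sg0; apply: (@exec_sweep w _ _ _ _ _ sg _ _ _ [::] (ord0, sg P));
  cbn [st_reg st_len st_out] => //; first by lia.
move=> H1 H2; exists (tracks w f); split=> //.
- move=> p _; rewrite (@track_run_two _ (fun q b => (b, q.2)) (fun q b => (q.1, q.2 && (q.1 == b)))); last first.
    by rewrite /lo /hi; lia.
  have -> : tracks w f p lo = (p < f lo) by rewrite /tracks ifF //; rewrite /lo; lia.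
  have -> : tracks w f p hi = (p < f hi) by rewrite /tracks ifF //; rewrite /hi; lia.
  rewrite /sg [fst _]/= [snd _]/=; congr ((_, _), _).
  by move: (f lo) (f hi) => x y; apply/idP/idP; lia.
- exact: extends_nil.
- by rewrite cats0.
- have := H2 _ Hr; have := H2 _ Hs; rewrite /sg /lo /hi /=.
  by case: (ltngtP r s) rs => // _ _ l1 l2; apply/idP/idP; lia.
Qed.

(** The position of the first zero of track [r] is the value of the counter. The input bit of that
    block, read just before on track 0, becomes the answer; a counter without zero points beyond the
    input and yields the default [false]. *)
Definition minp (r : nat) : mach bool :=
  track_sweep (false, false, false)
    (fun j q b => ((if j == 0 then (b, q.1.2, q.2)
                    else if j == r then (if q.1.2 || b then q else (q.1.1, true, q.1.1)) else q), b))
    (@stop _) (fun q => q.2).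

Lemma exec_minp w r f P R : 0 < r < K ->
  exec w (minp r) (Store f P R) 1 (nth false (rev w) (f r)) (Store f P R).
Proof.
move=> Hr.
pose sg p := ((if p is p'.+1 then nth false (rev w) p' else false), f r < p,
              (f r < p) && nth false (rev w) (f r)).
apply: (@exec_sweep w _ _ _ _ _ sg _ _ _ [::] (ord0, sg P));
  cbn [st_reg st_len st_out] => //; first by lia.
move=> H1 H2; exists (tracks w f); split=> //.
- move=> p _; rewrite (@track_run_two _ (fun q b => (b, q.1.2, q.2))
    (fun q b => if q.1.2 || b then q else (q.1.1, true, q.1.1))); last by lia.
  have -> : tracks w f p r = (p < f r) by rewrite /tracks ifF //; lia.
  have -> : tracks w f p 0 = nth false (rev w) p by [].
  congr (_, _); rewrite /sg; cbn [fst snd].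
  case: (ltngtP (f r) p) => cmp; cbn [orb andb].
  + by have -> : f r < p.+1 by lia.
  + by have -> : (f r < p.+1) = false by lia.
  + by rewrite cmp ltnSn.
- exact: extends_nil.
- by rewrite cats0.
- rewrite /sg /=; case: ltnP => //= le.
  by rewrite nth_default // size_rev; lia.
Qed.

Lemma exec_push w b f P R :
  exec w (push b) (Store f P R) 1 tt (Store f P (rcons R b)).
Proof.
split; first by rewrite /weight /= size_rcons; lia.
move=> C tp [H1 H2 /= /(runs_push b) [tp' R1 R2]] leC; exists tp'; first by split.
by apply: runs_le R2; rewrite mul1n /kappa; rewrite /weight /= in leC; lia.
Qed.

(** Besides the input bit the block has a one on track 1, so that register 1 ends up with the length
    of the input. *)
Definition mappend (b : bool) : mach unit :=
  track_sweep false (fun _ s b => (s, b)) (append_block (fun j => if j == 0 then b else j == 1)) (fun _ => tt).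

Lemma runs_mappend b P tk R tp : rest (word P tk) R tp ->
  exists2 tp', rest (word P tk ++ map (fun j => if j == 0 then b else j == 1) (iota 0 K)) R tp' &
    runs (mappend b) tp (2 * (P * K + K) + 3) tt tp'.
Proof.
move=> Hr.
have [|tp' R1 R2] := @runs_track_sweep _ _ (fun _ s b => (s, b)) _ (fun _ => tt) (fun=> false) _ tk _ _ _ _ _ Hr _ (extends_block (fun j => if j == 0 then b else j == 1)).
  by move=> p _; rewrite track_run_id.
by exists tp' => //; move: R2; rewrite size_map size_iota.
Qed.

Definition mload_bit (o : option bool) : mach (option unit) :=
  if o is Some b then mbind (mappend b) (fun _ => mret None) else mret (Some tt).

Definition mload : mach unit := mloop (mbind pop mload_bit).

Definition start_store (w : seq bool) : store :=
  Store (fun j => if j == 1 then size w else 0) (size w) [::].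

(** Input bits are popped from the end of the word while blocks are appended outwards: [v] is
    loaded, [u] is still on the stack. This is why track 0 holds [rev w]. *)
Lemma runs_mload w v u tp : rev w = v ++ rev u ->
  rest (word (size v) (tracks (rev v) (fun j => if j == 1 then size v else 0))) u tp ->
  exists2 tp', rep w (start_store w) tp' &
    runs mload tp ((size u).+1 * (2 * (K * (size w).+1) + 2 * size w + 10)) tt tp'.
Proof.
elim/last_ind: u v tp => [|u b IH] v tp e Hr.
  have ev : v = rev w by rewrite e cats0.
  have [tp' R1 R2] := runs_pop_nil Hr.
  exists tp'.
    split=> //=; first by move=> j; case: eqP.
    by move: R1; rewrite ev revK size_rev.
  have R3 : runs (mload_bit None) tp' 0 (Some tt) tp' by apply: runs_mret.
  by apply: runs_le (runs_mloop_end (runs_mbind R2 R3)); lia.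
have [tp1 R1 R2] := runs_pop Hr.
have [tp2 R3 R4] := runs_mappend b R1.
have [||tp3 R5 R6] := IH (rcons v b) tp2.
- by rewrite e rev_rcons cat_rcons.
- move: R3; congr (rest _ _ _); rewrite size_rcons wordS; congr (_ ++ _).
    apply: eq_word => p j ltp _; rewrite /tracks !revK nth_rcons ltp.
    by case: eqP => // _; case: eqP => // _; lia.
  apply/eq_map => j; rewrite /tracks revK nth_rcons ltnn eqxx.
  by case: eqP => // _; case: eqP => // _; lia.
exists tp3 => //.
have R7 : runs (mload_bit (Some b)) tp1 (2 * (size v * K + K) + 3 + 0) None tp2.
  by apply: runs_mbind R4 _; apply: runs_mret.
apply: runs_le (runs_mloop_step (runs_mbind R2 R7) R6); rewrite size_rcons [(size u).+2 * _]mulSn.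
have : size w = size v + (size u).+1 by rewrite -size_rev e size_cat size_rev size_rcons.
move=> esz; rewrite leq_add2r.
have : size v * K + K <= K * (size w).+1 by rewrite -mulSnr mulnC leq_mul2l; lia.
by lia.
Qed.

End Tracks.

(** * Loop programs run in polynomial time *)
Lemma exec_le K' w X (M : mach X) st N N' x st' : N <= N' ->
  exec K' w M st N x st' -> exec K' w M st N' x st'.
Proof.
move=> leN [W H]; split; first by lia.
move=> C tp Hr leC; have [||tp' R1 R2] := H C tp => //; first by lia.
by exists tp' => //; apply: runs_le R2; rewrite leq_mul2r leN orbT.
Qed.

Definition mseq (A B : mach unit) : mach unit := mbind A (fun _ => B).

Lemma exec_mseq K' w A B st N1 st1 N2 st2 :
  exec K' w A st N1 tt st1 -> exec K' w B st1 N2 tt st2 ->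
  exec K' w (mseq A B) st (N1 + N2) tt st2.
Proof. by move=> H1 H2; apply: exec_mbind H1 _. Qed.

Definition mfor_step K' x body (b : bool) : mach (option unit) :=
  if b then mret (Some tt)
  else mbind body (fun _ : unit => mbind (minc K' x) (fun _ => mret None)).

Definition mfor K' x y body : mach unit :=
  mseq (mzero K' x) (mloop (mbind (meq K' x y) (mfor_step K' x body))).

Lemma upd_same f r v : upd f r v r = v.
Proof. by rewrite /upd eqxx. Qed.

Lemma upd_other f r v j : j != r -> upd f r v j = f j.
Proof. by rewrite /upd => /negbTE ->. Qed.

(** The loop stops when [x] equals [y], so the body has to restore both; the invariant is stated
    with [x] already advanced. The 3 per round pays for test, increment and re-entry, the initial 3
    for the reset and the last test. *)
Lemma exec_mfor K' w x y body n (Nb : nat -> nat)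
    (I : nat -> (nat -> nat) -> seq bool -> Prop) f P R :
  0 < x < K'.+1 -> 0 < y < K'.+1 -> x != y -> f y = n -> I 0 (upd f x 0) R ->
  (forall i f P R, i < n -> f x = i -> f y = n -> I i f R ->
     exists f' P' R', [/\ exec K' w body (Store f P R) (Nb i) tt (Store f' P' R'),
       f' x = i, f' y = n & I i.+1 (upd f' x i.+1) R']) ->
  exists f' P' R', [/\ exec K' w (mfor K' x y body) (Store f P R) (3 + \sum_(i < n) (Nb i + 3)) tt
       (Store f' P' R'), f' x = n, f' y = n & I n f' R'].
Proof.
move=> Hx Hy xy fy I0 Hb.
suff H m i f1 P1 R1 : i + m = n -> f1 x = i -> f1 y = n -> I i f1 R1 ->
    exists f' P' R', [/\ exec K' w (mloop (mbind (meq K' x y) (mfor_step K' x body)))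
      (Store f1 P1 R1) (2 + \sum_(i <= j < n) (Nb j + 3)) tt (Store f' P' R'),
      f' x = n, f' y = n & I n f' R'].
  have [||||f' [P' [R' [E e1 e2 e3]]]] := H n 0 (upd f x 0) P R => //.
  - exact: upd_same.
  - by rewrite upd_other // eq_sym.
  exists f', P', R'; split=> //.
  by have := exec_mseq (exec_mzero w f P R Hx) E; rewrite big_mkord.
elim: m i f1 P1 R1 => [|m IH] i f1 P1 R1 e ex ey Ii.
  have ein : i = n by lia.
  rewrite ein in ex Ii *; exists f1, P1, R1; split=> //.
  rewrite big_geq // addn0; apply: exec_mloop_end.
  rewrite -[1]/(1 + 0); apply: (exec_mbind (exec_meq w f1 P1 R1 Hx Hy xy)).
  by rewrite ex ey eqxx; apply: exec_mret.
have lt : i < n by lia.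
have [f2 [P2 [R2 [E2 e2 e2' I2]]]] := Hb i f1 P1 R1 lt ex ey Ii.
have [||||f' [P' [R' [E e4 e5 e6]]]] := IH i.+1 (upd f2 x i.+1) (if f2 x < P2 then P2 else P2.+1) R2 => //.
- by lia.
- exact: upd_same.
- by rewrite upd_other // eq_sym.
exists f', P', R'; split=> //.
rewrite big_ltn //.
have E3 : exec K' w (mbind (meq K' x y) (mfor_step K' x body)) (Store f1 P1 R1) (1 + (Nb i + (1 + 0)))
    None (Store (upd f2 x i.+1) (if f2 x < P2 then P2 else P2.+1) R2).
  apply: (exec_mbind (exec_meq w f1 P1 R1 Hx Hy xy)).
  have -> : (f1 x == f1 y) = false by rewrite ex ey; lia.
  apply: (exec_mbind E2); rewrite -[in upd f2 x i.+1]e2.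
  by apply: (exec_mbind (exec_minc w f2 P2 R2 Hx)); apply: exec_mret.
by apply: exec_le (exec_mloop_step E3 E); lia.
Qed.

Lemma exec_copy K' w s r f P R : 0 < s < K'.+1 -> 0 < r < K'.+1 -> s != r ->
  exists f' P', [/\ exec K' w (mfor K' s r (mret tt)) (Store f P R) (3 + f r * 3) tt (Store f' P' R),
    f' s = f r & forall j, j != s -> f' j = f j].
Proof.
move=> Hs Hr sr.
have [|||f' [P' [R' [E e1 e2 [e3 e4]]]]] := @exec_mfor K' w s r (mret tt) (f r) (fun=> 0)
  (fun _ f1 R1 => (forall j, j != s -> f1 j = f j) /\ R1 = R) f P R Hs Hr sr.
- by [].
- by split=> // j js; rewrite upd_other.
- move=> i f1 P1 R1 lti es er [e ->]; exists f1, P1, R; split=> //; first exact: exec_mret.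
  by split=> // j js; rewrite upd_other ?e.
rewrite e4 in E; exists f', P'; split=> //.
by move: E; rewrite sum_nat_const card_ord.
Qed.

Lemma exec_addto K' w s z r f P R : 0 < s < K'.+1 -> 0 < r < K'.+1 -> 0 < z < K'.+1 ->
  s != r -> z != r -> z != s ->
  exists f' P', [/\ exec K' w (mfor K' s r (minc K' z)) (Store f P R) (3 + f r * 4) tt (Store f' P' R),
    f' z = f z + f r & forall j, j != s -> j != z -> f' j = f j].
Proof.
move=> Hs Hr Hz sr zr zs.
have [|||f' [P' [R' [E e1 e2 [e3 e4 e5]]]]] := @exec_mfor K' w s r (minc K' z) (f r) (fun=> 1)
  (fun i f1 R1 => [/\ forall j, j != s -> j != z -> f1 j = f j, R1 = R & f1 z = f z + i]) f P R Hs Hr sr.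
- by [].
- by split=> // [j js|]; rewrite upd_other // addn0.
- move=> i f1 P1 R1 lti es er [e -> ez].
  exists (upd f1 z (f1 z).+1), (if f1 z < P1 then P1 else P1.+1), R; split.
  + exact: exec_minc.
  + by rewrite upd_other // eq_sym.
  + by rewrite upd_other // eq_sym.
  + split=> // [j js jz|]; first by rewrite !upd_other ?e.
    by rewrite upd_other // upd_same ez addnS.
rewrite e4 in E; exists f', P'; split=> //.
by move: E; rewrite sum_nat_const card_ord.
Qed.

(** * Bounded-loop programs and their polynomial bounds *)

Fixpoint ctx (k : nat) : Type := if k is k'.+1 then (ctx k' * nat)%type else seq bool.

Fixpoint inp (k : nat) : ctx k -> seq bool :=
  match k return ctx k -> seq bool with
  | 0 => fun g => g
  | k'.+1 => fun g => inp g.1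
  end.

(* Input bits are addressed from the end of the word, because the machine reads its input as a stack. *)
Inductive PE : forall k, (ctx k -> nat) -> Prop :=
| PE_len : @PE 0 (fun w => size w)
| PE_var k : @PE k.+1 (fun g => g.2)
| PE_wk k (F : ctx k -> nat) : PE F -> @PE k.+1 (fun g => F g.1)
| PE_zero k : @PE k (fun _ => 0)
| PE_succ k (F : ctx k -> nat) : PE F -> PE (fun g => (F g).+1)
| PE_sum k (F1 : ctx k -> nat) (F2 : ctx k -> nat -> nat) :
    PE F1 -> @PE k.+1 (fun g => F2 g.1 g.2) -> PE (fun g => \sum_(i < F1 g) F2 g i)
| PE_if k (F1 F2 F3 F4 : ctx k -> nat) :
    PE F1 -> PE F2 -> PE F3 -> PE F4 -> PE (fun g => if F1 g == F2 g then F3 g else F4 g)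
| PE_inp k (F : ctx k -> nat) : PE F -> PE (fun g => nat_of_bool (nth false (rev (inp g)) (F g)))
| PE_ext k (F G : ctx k -> nat) : F =1 G -> PE F -> PE G.

Inductive PC : forall k, (ctx k -> seq bool) -> Prop :=
| PC_nil k : @PC k (fun _ => [::])
| PC_out k b : @PC k (fun _ => [:: b])
| PC_cat k (G1 G2 : ctx k -> seq bool) : PC G1 -> PC G2 -> PC (fun g => G1 g ++ G2 g)
| PC_for k (F : ctx k -> nat) (G : ctx k -> nat -> seq bool) :
    PE F -> @PC k.+1 (fun g => G g.1 g.2) -> PC (fun g => flatten [seq G g i | i <- iota 0 (F g)])
| PC_if k (F1 F2 : ctx k -> nat) (G1 G2 : ctx k -> seq bool) :
    PE F1 -> PE F2 -> PC G1 -> PC G2 -> PC (fun g => if F1 g == F2 g then G1 g else G2 g)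
| PC_ext k (F G : ctx k -> seq bool) : F =1 G -> PC F -> PC G.

Fixpoint bnd (k : nat) : ctx k -> nat -> Prop :=
  match k return ctx k -> nat -> Prop with
  | 0 => fun g Z => size g <= Z
  | k'.+1 => fun g Z => g.2 <= Z /\ bnd g.1 Z
  end.

Lemma bnd_le k (g : ctx k) Z Z' : Z <= Z' -> bnd g Z -> bnd g Z'.
Proof.
move=> le; elim: k g => [|k IH] g /=; first by move/leq_trans; apply.
by case=> H1 H2; split; [apply: leq_trans le | apply: IH].
Qed.

(** Any [Z] that dominates the input length and all loop variables will do, which makes the notion
    stable under binding a variable; [1 < Z] lets constants be absorbed into the exponent. *)
Definition polyb k (F : ctx k -> nat) :=
  exists D, forall g Z, 1 < Z -> bnd g Z -> F g <= Z ^ D.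

Lemma polyb_const k c : @polyb k (fun _ => c).
Proof.
exists c => g Z lt _; apply: (leq_trans (ltnW (ltn_expl c (ltnSn 1)))).
by case: c => // c; rewrite leq_exp2r.
Qed.

Lemma polyb_add k (F G : ctx k -> nat) : polyb F -> polyb G -> polyb (fun g => F g + G g).
Proof.
move=> [D1 H1] [D2 H2]; exists (D1 + D2).+1 => g Z lt b.
have le1 : F g <= Z ^ (D1 + D2) by apply: leq_trans (H1 _ _ lt b) _; rewrite leq_exp2l // leq_addr.
have le2 : G g <= Z ^ (D1 + D2) by apply: leq_trans (H2 _ _ lt b) _; rewrite leq_exp2l // leq_addl.
rewrite expnS; apply: (@leq_trans (2 * Z ^ (D1 + D2))); first by lia.
by rewrite leq_mul2r lt orbT.
Qed.

Lemma polyb_mul k (F G : ctx k -> nat) : polyb F -> polyb G -> polyb (fun g => F g * G g).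
Proof.
move=> [D1 H1] [D2 H2]; exists (D1 + D2) => g Z lt b.
by rewrite expnD leq_mul ?H1 ?H2.
Qed.

Lemma polyb_le k (F G : ctx k -> nat) : (forall g, F g <= G g) -> polyb G -> polyb F.
Proof. by move=> le [D H]; exists D => g Z lt b; apply: leq_trans (le g) (H _ _ lt b). Qed.

Lemma polyb_wk k (F : ctx k -> nat) : polyb F -> @polyb k.+1 (fun g => F g.1).
Proof. by move=> [D H]; exists D => g Z lt [_ b]; apply: H. Qed.

Lemma polyb_var k : @polyb k.+1 (fun g => g.2).
Proof. by exists 1 => g Z lt [b _]; rewrite expn1. Qed.

Lemma polyb_inp k : @polyb k (fun g => size (inp g)).
Proof.
exists 1 => g Z lt; rewrite expn1; elim: k g => [|k IH] g //= [_]; exact: IH.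
Qed.

Lemma polyb_sum k (F : ctx k -> nat) (G : ctx k -> nat -> nat) :
  polyb F -> @polyb k.+1 (fun g => G g.1 g.2) -> polyb (fun g => \sum_(i < F g) G g i).
Proof.
(* The summation index stays below [Z ^ D1], so inside the sum [Z ^ D1.+1] takes the role of [Z];
   the successor keeps it at least [Z] even for [D1 = 0]. *)
move=> [D1 H1] [D2 H2]; exists (D1 + D1.+1 * D2) => g Z lt b.
have le1 := H1 _ _ lt b.
have leZ : Z <= Z ^ D1.+1 by rewrite -{1}[Z]expn1 leq_exp2l.
rewrite expnD expnM; apply: (@leq_trans (\sum_(i < F g) (Z ^ D1.+1) ^ D2)).
  apply: leq_sum => i _; apply: (H2 (g, i : nat)); first by apply: leq_trans leZ.
  split; last exact: bnd_le b.
  apply: leq_trans (ltnW (ltn_ord i)) (leq_trans le1 _).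
  by rewrite leq_exp2l.
by rewrite sum_nat_const card_ord leq_mul2r le1 orbT.
Qed.

Lemma PE_polyb k (F : ctx k -> nat) : PE F -> polyb F.
Proof.
elim=> {k F}.
- exact: (@polyb_inp 0).
- exact: polyb_var.
- by move=> k F _; apply: polyb_wk.
- by move=> k; apply: polyb_const.
- move=> k F _ H; apply: polyb_le (polyb_add H (polyb_const k 1)) => g; lia.
- by move=> k F1 F2 _ H1 _ H2; apply: polyb_sum.
- move=> k F1 F2 F3 F4 _ _ _ _ _ H3 _ H4.
  by apply: polyb_le (polyb_add H3 H4) => g; case: ifP; lia.
- by move=> k F _ _; apply: polyb_le (polyb_const k 1) => g; case: nth.
- by move=> k F G e _; apply: polyb_le => g; rewrite e.
Qed.

Fixpoint env_ok (k : nat) : ctx k -> (nat -> nat) -> (nat -> nat) -> Prop :=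
  match k return ctx k -> (nat -> nat) -> (nat -> nat) -> Prop with
  | 0 => fun _ _ _ => True
  | k'.+1 => fun g f rho => f (rho k') = g.2 /\ env_ok g.1 f rho
  end.

Lemma env_ok_eq k (g : ctx k) f f' rho rho' :
  (forall j, j < k -> f' (rho' j) = f (rho j)) -> env_ok g f rho -> env_ok g f' rho'.
Proof.
elim: k g => //= k IH g H [e1 e2]; split; first by rewrite H.
by apply: IH e2 => j lt; apply: H; lia.
Qed.

(** Register discipline: loop variables and earlier results lie below [t] and are preserved, the
    result goes to [t], and the registers up to [t + need] are available. Track 0 and register 1
    belong to the input and its length, hence [1 < t]. One machine serves all contexts. *)
Definition computes k (F N : ctx k -> nat) (need : nat) :=
  forall K' rho t, 1 < t -> (forall j, j < k -> 0 < rho j < t) -> t + need <= K' ->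
  exists M : mach unit, forall g f P R, f 1 = size (inp g) -> env_ok g f rho ->
  exists f' P', [/\ exec K' (inp g) M (Store f P R) (N g) tt (Store f' P' R), f' t = F g &
                   forall j, j < t -> f' j = f j].

Lemma PE_computes k (F : ctx k -> nat) : PE F ->
  exists need N, polyb N /\ computes F N need.
Proof.
elim=> {k F}.
- exists 1, (fun g => 3 + size g * 3); split.
    apply: polyb_add; first exact: polyb_const.
    by apply: polyb_mul; [exact: (@polyb_inp 0) | exact: polyb_const].
  move=> K' rho t t1 _ tK; exists (mfor K' t 1 (mret tt)) => g f P R e1 _.
  have [|||f' [P' [E e2 e3]]] := @exec_copy K' g t 1 f P R; try lia.
  exists f', P'; split; rewrite ?e2 // -?e1 // => j jt; apply: e3; lia.
- move=> k; exists 1, (fun g => 3 + g.2 * 3); split.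
    apply: polyb_add; first exact: polyb_const.
    by apply: polyb_mul; [exact: polyb_var | exact: polyb_const].
  move=> K' rho t t1 Hrho tK; have Hk := Hrho k (ltnSn k).
  exists (mfor K' t (rho k) (mret tt)) => g f P R e1 [eg _].
  have [|||f' [P' [E e2 e3]]] := @exec_copy K' (inp g) t (rho k) f P R; try lia.
  exists f', P'; split; rewrite ?e2 ?eg // -?eg // => j jt; apply: e3; lia.
- move=> k F _ [need [N [Np H]]]; exists need, (fun g => N g.1); split; first exact: polyb_wk.
  move=> K' rho t t1 Hrho tK.
  have [|M HM] := H K' rho t t1 _ tK; first by move=> j jk; apply: Hrho; lia.
  by exists M => g f P R e1 [_ eg]; apply: HM.
- move=> k; exists 1, (fun=> 1); split; first exact: polyb_const.
  move=> K' rho t t1 Hrho tK; exists (mzero K' t) => g f P R _ _.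
  exists (upd f t 0), P; split; first by apply: exec_mzero; lia.
    exact: upd_same.
  by move=> j jt; rewrite upd_other //; lia.
- move=> k F _ [need [N [Np H]]]; exists need.+1, (fun g => N g + 1); split.
    by apply: polyb_add => //; apply: polyb_const.
  move=> K' rho t t1 Hrho tK; have [|M HM] := H K' rho t t1 Hrho; first by lia.
  exists (mseq M (minc K' t)) => g f P R e1 eg.
  have [f1 [P1 [E1 e2 e3]]] := HM g f P R e1 eg.
  exists (upd f1 t (f1 t).+1), (if f1 t < P1 then P1 else P1.+1); split.
  + by apply: exec_mseq E1 _; apply: exec_minc; lia.
  + by rewrite upd_same e2.
  + by move=> j jt; rewrite upd_other ?e3 //; lia.
- move=> k F1 F2 P1 [need1 [N1 [Np1 H1]]] P2 [need2 [N2 [Np2 H2]]].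
  exists (need1 + need2 + 6), (fun g => (N1 g + 1) +
     (3 + \sum_(i < F1 g) ((N2 (g, i : nat) + (3 + F2 g i * 4)) + 3))); split.
    apply: polyb_add; first by apply: polyb_add => //; apply: polyb_const.
    apply: polyb_add; first exact: polyb_const.
    apply: (polyb_sum (G := fun g i => N2 (g, i) + (3 + F2 g i * 4) + 3)) (PE_polyb P1) _.
    apply: polyb_add; last exact: polyb_const.
    apply: polyb_add; first by apply: polyb_le Np2 => -[].
    apply: polyb_add; first exact: polyb_const.
    by apply: polyb_mul; [exact: (PE_polyb P2) | exact: polyb_const].
  move=> K' rho t t1 Hrho tK.
  have [|||M1 HM1] := H1 K' rho t.+1; try lia.
    by move=> j /Hrho; lia.
  (* Register [t] accumulates the sum, [t + 1] holds the bound, [t + 2] the summation index, [t + 3]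
     the summand, and [t + 4] counts while the summand is added. *)
  pose rho' := upd rho k (t + 2).
  have [|||M2 HM2] := H2 K' rho' (t + 3); try lia.
    by move=> j jk; rewrite /rho' /upd; case: eqP => [_|/eqP jk']; [lia | have := Hrho j; lia].
  pose body := mseq M2 (mfor K' (t + 4) (t + 3) (minc K' t)).
  exists (mseq (mseq M1 (mzero K' t)) (mfor K' (t + 2) t.+1 body)) => g f P R e1 eg.
  have [f1 [Q1 [E1 e2 e3]]] := HM1 g f P R e1 eg.
  have [||||||f' [P' [R' [E e4 e5 [e6 e7 e8]]]]] := @exec_mfor K' (inp g) (t + 2) t.+1 body (F1 g)
     (fun i => N2 (g, i) + (3 + F2 g i * 4))
     (fun i f' R' => [/\ forall j, j < t -> f' j = f j, R' = R & f' t = \sum_(u < i) F2 g u])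
     (upd f1 t 0) Q1 R; try lia.
  + by rewrite upd_other ?e2 //; lia.
  + rewrite big_ord0; split=> // [j jt|]; last by rewrite upd_other ?upd_same //; lia.
    by rewrite !upd_other ?e3 //; lia.
  + move=> i f2 P2' R2 lti ex ey [I1 -> I3].
    have [||f3 [P3 [E3 e9 e10]]] := HM2 (g, i) f2 P2' R.
    * by rewrite I1 //; lia.
    * split; first by rewrite /rho' upd_same.
      apply: env_ok_eq eg => j jk; rewrite /rho' upd_other; last by lia.
      by rewrite I1 //; have := Hrho j jk; lia.
    have [||||||f4 [P4 [E4 e11 e12]]] := @exec_addto K' (inp g) (t + 4) t (t + 3) f3 P3 R; try lia.
    exists f4, P4, R; split.
    * by have := exec_mseq E3 E4; rewrite e9.
    * by rewrite e12; [rewrite e10 //; lia | lia | lia].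
    * by rewrite e12; [rewrite e10 //; lia | lia | lia].
    * split=> // [j jt|].
        rewrite upd_other; last by lia.
        by rewrite e12; [rewrite e10 ?I1 //; lia | lia | lia].
      rewrite upd_other; last by lia.
      by rewrite e11 big_ord_recr /= e9 e10 ?I3 //; lia.
  exists f', P'; split=> //.
  rewrite e7 in E; apply: (exec_mseq _ E); apply: exec_mseq E1 _.
  by apply: exec_mzero; lia.
- move=> k F1 F2 F3 F4 P1 [need1 [N1 [Np1 H1]]] P2 [need2 [N2 [Np2 H2]]].
  move=> P3 [need3 [N3 [Np3 H3]]] P4 [need4 [N4 [Np4 H4]]].
  exists (need1 + need2 + need3 + need4 + 3), (fun g => N1 g + N2 g + 1 + (N3 g + N4 g)); split.
    by apply: polyb_add; [apply: polyb_add; [exact: polyb_add | exact: polyb_const] | exact: polyb_add].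
  move=> K' rho t t1 Hrho tK.
  have [|||M1 HM1] := H1 K' rho t; try lia; first by move=> j /Hrho; lia.
  have [|||M2 HM2] := H2 K' rho t.+1; try lia; first by move=> j /Hrho; lia.
  have [|||M3 HM3] := H3 K' rho t; try lia; first by move=> j /Hrho; lia.
  have [|||M4 HM4] := H4 K' rho t; try lia; first by move=> j /Hrho; lia.
  exists (mbind (mbind (mseq M1 M2) (fun _ => meq K' t t.+1)) (fun b : bool => if b then M3 else M4)) => g f P R e1 eg.
  have [f1 [Q1 [E1 a1 b1]]] := HM1 g f P R e1 eg.
  have eg1 : env_ok g f1 rho by apply: env_ok_eq eg => j jk; apply: b1; have := Hrho j jk; lia.
  have [|f2 [Q2 [E2 a2 b2]]] := HM2 g f1 Q1 R _ eg1; first by rewrite b1 //; lia.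
  have b2' j : j < t -> f2 j = f j by move=> jt; rewrite b2 ?b1 //; lia.
  have eg2 : env_ok g f2 rho by apply: env_ok_eq eg => j jk; apply: b2'; have := Hrho j jk; lia.
  have e21 : f2 1 = size (inp g) by rewrite b2' //; lia.
  have eqE : (f2 t == f2 t.+1) = (F1 g == F2 g) by rewrite a2 b2 // a1.
  have Em := @exec_meq K' (inp g) t t.+1 f2 Q2 R; rewrite eqE in Em.
  have {}Em : exec K' (inp g) (mbind (mseq M1 M2) (fun _ => meq K' t t.+1)) (Store f P R) (N1 g + N2 g + 1) (F1 g == F2 g) (Store f2 Q2 R).
    by apply: (exec_mbind (exec_mseq E1 E2)); apply: Em; lia.
  case: eqP Em => c Em.
    have [f3 [Q3 [E3 a3 b3]]] := HM3 g f2 Q2 R e21 eg2.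
    exists f3, Q3; split=> //; last by move=> j jt; rewrite b3 ?b2'.
    by apply: exec_mbind Em _; apply: exec_le E3; lia.
  have [f3 [Q3 [E3 a3 b3]]] := HM4 g f2 Q2 R e21 eg2.
  exists f3, Q3; split=> //; last by move=> j jt; rewrite b3 ?b2'.
  by apply: exec_mbind Em _; apply: exec_le E3; lia.
- move=> k F PF [need [N [Np H]]]; exists need.+1, (fun g => N g + 3); split.
    by apply: polyb_add => //; apply: polyb_const.
  move=> K' rho t t1 Hrho tK; have [|M HM] := H K' rho t t1 Hrho; first by lia.
  exists (mbind (mbind M (fun _ => minp K' t)) (fun b : bool => mseq (mzero K' t) (if b then minc K' t else mret tt))).
  move=> g f P R e1 eg; have [f1 [Q1 [E1 a1 b1]]] := HM g f P R e1 eg.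
  have E2 : exec K' (inp g) (mbind M (fun _ => minp K' t)) (Store f P R) (N g + 1) (nth false (rev (inp g)) (F g)) (Store f1 Q1 R).
    by apply: exec_mbind E1 _; rewrite -a1; apply: exec_minp; lia.
  have Ht : 0 < t < K'.+1 by lia.
  have E3 := exec_mzero (inp g) f1 Q1 R Ht.
  case: (nth false _ _) E2 => E2.
    exists (upd (upd f1 t 0) t (upd f1 t 0 t).+1), (if upd f1 t 0 t < Q1 then Q1 else Q1.+1); split.
    + have -> : N g + 3 = N g + 1 + (1 + 1) by lia.
      by apply: exec_mbind E2 _; apply: exec_mseq E3 _; apply: exec_minc.
    + by rewrite !upd_same.
    + by move=> j jt; rewrite !upd_other ?b1 //; lia.
  exists (upd f1 t 0), Q1; split.
  + apply: (@exec_le _ _ _ _ _ (N g + 1 + (1 + 0))); first by lia.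
    by apply: exec_mbind E2 _; apply: exec_mseq E3 _; apply: exec_mret.
  + by rewrite !upd_same.
  + by move=> j jt; rewrite !upd_other ?b1 //; lia.
- move=> k F G e _ [need [N [Np H]]]; exists need, N; split=> // K' rho t t1 Hrho tK.
  have [M HM] := H K' rho t t1 Hrho tK; exists M => g f P R e1 eg.
  by have [f1 [Q1 [E1 a1 b1]]] := HM g f P R e1 eg; exists f1, Q1; rewrite -e.
Qed.

Definition emits k (G : ctx k -> seq bool) (N : ctx k -> nat) (need : nat) :=
  forall K' rho t, 1 < t -> (forall j, j < k -> 0 < rho j < t) -> t + need <= K' ->
  exists M : mach unit, forall g f P R, f 1 = size (inp g) -> env_ok g f rho ->
  exists f' P', exec K' (inp g) M (Store f P R) (N g) tt (Store f' P' (R ++ G g)) /\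
                   forall j, j < t -> f' j = f j.

Lemma PC_emits k (G : ctx k -> seq bool) : PC G ->
  exists need N, polyb N /\ emits G N need.
Proof.
elim=> {k G}.
- move=> k; exists 0, (fun=> 0); split; first exact: polyb_const.
  move=> K' rho t t1 Hrho tK; exists (mret tt) => g f P R _ _; exists f, P; rewrite cats0.
  by split=> //; apply: exec_mret.
- move=> k b; exists 0, (fun=> 1); split; first exact: polyb_const.
  move=> K' rho t t1 Hrho tK; exists (push b) => g f P R _ _; exists f, P; rewrite cats1.
  by split=> //; apply: exec_push.
- move=> k G1 G2 _ [need1 [N1 [Np1 H1]]] _ [need2 [N2 [Np2 H2]]].
  exists (need1 + need2), (fun g => N1 g + N2 g); split; first exact: polyb_add.
  move=> K' rho t t1 Hrho tK.
  have [|||M1 HM1] := H1 K' rho t; try lia; first by move=> j /Hrho; lia.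
  have [|||M2 HM2] := H2 K' rho t; try lia; first by move=> j /Hrho; lia.
  exists (mseq M1 M2) => g f P R e1 eg.
  have [f1 [Q1 [E1 b1]]] := HM1 g f P R e1 eg.
  have eg1 : env_ok g f1 rho by apply: env_ok_eq eg => j jk; apply: b1; have := Hrho j jk; lia.
  have [|f2 [Q2 [E2 b2]]] := HM2 g f1 Q1 (R ++ G1 g) _ eg1; first by rewrite b1 //; lia.
  exists f2, Q2; split; first by rewrite catA; apply: exec_mseq E1 E2.
  by move=> j jt; rewrite b2 ?b1.
- move=> k F G PF _ [need2 [N2 [Np2 H2]]]; have [need1 [N1 [Np1 H1]]] := PE_computes PF.
  exists (need1 + need2 + 4), (fun g => N1 g + (3 + \sum_(i < F g) (N2 (g, i : nat) + 3))); split.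
    apply: polyb_add => //; apply: polyb_add; first exact: polyb_const.
    apply: (polyb_sum (G := fun g i => N2 (g, i) + 3)) (PE_polyb PF) _.
    by apply: polyb_add; [by apply: polyb_le Np2 => -[] | exact: polyb_const].
  move=> K' rho t t1 Hrho tK.
  have [|||M1 HM1] := H1 K' rho t; try lia; first by move=> j /Hrho; lia.
  (* Register [t] holds the bound and [t + 1] the loop variable; the body works from [t + 2] on. *)
  pose rho' := upd rho k (t + 1).
  have [|||M2 HM2] := H2 K' rho' (t + 2); try lia.
    by move=> j jk; rewrite /rho' /upd; case: eqP => [_|/eqP jk']; [lia | have := Hrho j; lia].
  exists (mseq M1 (mfor K' (t + 1) t M2)) => g f P R e1 eg.
  have [f1 [Q1 [E1 e2 e3]]] := HM1 g f P R e1 eg.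
  have [||||||f' [P' [R' [E e4 e5 [e6 e7]]]]] := @exec_mfor K' (inp g) (t + 1) t M2 (F g)
     (fun i => N2 (g, i))
     (fun i f' R' => (forall j, j < t -> f' j = f j) /\ R' = R ++ flatten [seq G g j | j <- iota 0 i])
     f1 Q1 R; try lia.
  + by split=> [j jt|]; rewrite ?cats0 // upd_other ?e3 //; lia.
  + move=> i f2 P2' R2 lti ex ey [I1 ->].
    have [||f3 [P3 [E3 e9]]] := HM2 (g, i) f2 P2' (R ++ flatten [seq G g j | j <- iota 0 i]).
    * by rewrite I1 //; lia.
    * split; first by rewrite /rho' upd_same.
      apply: env_ok_eq eg => j jk; rewrite /rho' upd_other; last by lia.
      by rewrite I1 //; have := Hrho j jk; lia.
    exists f3, P3, (R ++ flatten [seq G g j | j <- iota 0 i.+1]); split.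
    * by move: E3; rewrite -catA -[i.+1]addn1 (iotaD 0 i 1) map_cat flatten_cat /= cats0.
    * by rewrite e9 //; lia.
    * by rewrite e9 //; lia.
    * by split=> // j jt; rewrite upd_other ?e9 ?I1 //; lia.
  exists f', P'; split=> //.
  by rewrite -e7; apply: exec_mseq E1 E.
- move=> k F1 F2 G3 G4 P1 P2 _ [need3 [N3 [Np3 H3]]] _ [need4 [N4 [Np4 H4]]].
  have [need1 [N1 [Np1 H1]]] := PE_computes P1; have [need2 [N2 [Np2 H2]]] := PE_computes P2.
  exists (need1 + need2 + need3 + need4 + 3), (fun g => N1 g + N2 g + 1 + (N3 g + N4 g)); split.
    by apply: polyb_add; [apply: polyb_add; [exact: polyb_add | exact: polyb_const] | exact: polyb_add].
  move=> K' rho t t1 Hrho tK.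
  have [|||M1 HM1] := H1 K' rho t; try lia; first by move=> j /Hrho; lia.
  have [|||M2 HM2] := H2 K' rho t.+1; try lia; first by move=> j /Hrho; lia.
  have [|||M3 HM3] := H3 K' rho t; try lia; first by move=> j /Hrho; lia.
  have [|||M4 HM4] := H4 K' rho t; try lia; first by move=> j /Hrho; lia.
  exists (mbind (mbind (mseq M1 M2) (fun _ => meq K' t t.+1)) (fun b : bool => if b then M3 else M4)) => g f P R e1 eg.
  have [f1 [Q1 [E1 a1 b1]]] := HM1 g f P R e1 eg.
  have eg1 : env_ok g f1 rho by apply: env_ok_eq eg => j jk; apply: b1; have := Hrho j jk; lia.
  have [|f2 [Q2 [E2 a2 b2]]] := HM2 g f1 Q1 R _ eg1; first by rewrite b1 //; lia.
  have b2' j : j < t -> f2 j = f j by move=> jt; rewrite b2 ?b1 //; lia.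
  have eg2 : env_ok g f2 rho by apply: env_ok_eq eg => j jk; apply: b2'; have := Hrho j jk; lia.
  have e21 : f2 1 = size (inp g) by rewrite b2' //; lia.
  have eqE : (f2 t == f2 t.+1) = (F1 g == F2 g) by rewrite a2 b2 // a1.
  have Em := @exec_meq K' (inp g) t t.+1 f2 Q2 R; rewrite eqE in Em.
  have {}Em : exec K' (inp g) (mbind (mseq M1 M2) (fun _ => meq K' t t.+1)) (Store f P R) (N1 g + N2 g + 1) (F1 g == F2 g) (Store f2 Q2 R).
    by apply: (exec_mbind (exec_mseq E1 E2)); apply: Em; lia.
  case: eqP Em => c Em.
    have [f3 [Q3 [E3 b3]]] := HM3 g f2 Q2 R e21 eg2.
    exists f3, Q3; split=> //; last by move=> j jt; rewrite b3 ?b2'.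
    by apply: exec_mbind Em _; apply: exec_le E3; lia.
  have [f3 [Q3 [E3 b3]]] := HM4 g f2 Q2 R e21 eg2.
  exists f3, Q3; split=> //; last by move=> j jt; rewrite b3 ?b2'.
  by apply: exec_mbind Em _; apply: exec_le E3; lia.
- move=> k F G e _ [need [N [Np H]]]; exists need, N; split=> // K' rho t t1 Hrho tK.
  have [M HM] := H K' rho t t1 Hrho tK; exists M => g f P R e1 eg.
  by have [f1 [Q1 [E1 b1]]] := HM g f P R e1 eg; exists f1, Q1; rewrite -e.
Qed.

Definition mmove (d : dir) : mach unit :=
  @Mach unit unit (inl tt) (fun _ a => (inr tt, a, d)).

Lemma polyb_time (F : ctx 0 -> nat) : polyb F ->
  exists a d, forall w, F w <= a * size w ^ d + a.
Proof.
(* The bound is used at [Z = size w + 2], which exceeds 1 even for the empty word and is at most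
   [3 * size w] for any other. *)
move=> [D H]; exists (3 ^ D), D => w.
apply: (leq_trans (H w (size w + 2) _ _)); [by rewrite addn2 | exact: leq_addr |].
case: (posnP (size w)) => [->|pos].
  by rewrite add0n; apply: leq_trans (leq_addl _ _); case: (D) => // D'; rewrite leq_exp2r.
apply: leq_trans (leq_addr _ _); rewrite -expnMn.
by case: (D) => // D'; rewrite leq_exp2r //; lia.
Qed.

Theorem PC_poly_time (f : seq bool -> seq bool) : @PC 0 f -> poly_time_computable f.
Proof.
move=> /PC_emits [need [N [Np H]]].
pose K' := need + 2.
have [|||M HM] := H K' id 2; try by rewrite /K'; lia.
(* The step to the left turns the input into a stack beside a separating blank; the final step to
   the right puts the head on the first output bit. *)
pose M' := mseq (mseq (mmove DLeft) (mload K')) (mseq M (mmove DRight)).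
pose C w := size w + N w.
pose time w := 1 + (size w).+1 * (2 * (K'.+1 * (size w).+1) + 2 * size w + 10) + (N w * kappa K' (C w) + 1).
have Hp : @polyb 0 time.
  have Ps : @polyb 0 (fun w => size w) by exact: (@polyb_inp 0).
  have Ps1 : @polyb 0 (fun w => (size w).+1).
    by apply: polyb_le (polyb_add Ps (polyb_const 0 1)) => g; lia.
  apply: polyb_add.
    apply: polyb_add; first exact: polyb_const.
    apply: polyb_mul => //; apply: polyb_add; last exact: polyb_const.
    apply: polyb_add; last by apply: polyb_mul => //; apply: polyb_const.
    by apply: polyb_mul; [exact: polyb_const | apply: polyb_mul => //; exact: polyb_const].
  apply: polyb_add; last exact: polyb_const.
  apply: polyb_mul => //.
  have PCb : @polyb 0 C by apply: polyb_add.
  apply: polyb_add; last exact: polyb_const.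
  apply: polyb_add; last by apply: polyb_mul => //; exact: polyb_const.
  by apply: polyb_mul; [exact: polyb_const | apply: polyb_mul => //; exact: polyb_const].
have [a [d le]] := polyb_time Hp.
exists (TM_of_mach M'), a, d => w T.
have [|tp1 Hr1 R1] := @runs_mload K' w [::] w (tmove DLeft (tp_head (init_tape w)) (init_tape w)) erefl.
  exists 0; case: (w) => [|b w']; first by exists 1.
  by exists 0; rewrite /= cats0.
have [|f' [P' [[W E] _]]] := HM w (st_reg (start_store w)) (size w) [::] erefl.
  by [].
have [||tp2 Hr2 R2] := E (C w) tp1 => //.
  by rewrite /weight /= addn0.
have R0 : runs (mmove DLeft) (init_tape w) 1 tt (tmove DLeft (tp_head (init_tape w)) (init_tape w)) by [].
have R3 : runs (mmove DRight) tp2 1 tt (tmove DRight (tp_head tp2) tp2) by [].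
have RR : runs M' (init_tape w) T tt (tmove DRight (tp_head tp2) tp2).
  apply: (@runs_le _ _ _ (time w)) (le w) _.
  by apply: (runs_mbind (runs_mbind R0 R1)); apply: (runs_mbind R2).
have [h1 h2] := run_TM_of_mach RR; split=> //; rewrite h2.
case: Hr2 => _ _ [k [k' ->]] /=; rewrite /tape_output /=.
case: (f w) => [|b u] /=; first by rewrite head_nseqNone.
congr (_ :: _); elim: u => [|c u IH] /=; first by case: (k').
by rewrite IH.
Qed.

(** * Graphs covered by cliques *)
(** Each bin is named by an item that it contains, so only inhabited bins are constrained; their
    number is not prescribed but follows from the total. *)
Definition packable (I : finType) (a : I -> nat) (B : nat) : Prop :=
  exists (T : finType) (f : I -> T), forall q, \sum_(q' | f q' == f q) a q' = B.

Definition offdiag (V : finType) (K : {set V}) : {set V * V} :=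
  [set p | [&& p.1 \in K, p.2 \in K & p.1 != p.2]].

Lemma card_pairs (V : finType) (r : rel V) :
  #|[set p | r p.1 p.2]| = \sum_x #|[set y | r x y]|.
Proof.
rewrite -sum1_card (eq_bigl (fun p : V * V => r p.1 p.2)); last by move=> p; rewrite inE.
rewrite -(pair_big_dep xpredT r (fun _ _ => 1)) /=.
by apply: eq_bigr => x _; rewrite -sum1_card; apply: eq_bigl => y; rewrite inE.
Qed.

Lemma card_offdiag (V : finType) (K : {set V}) : #|offdiag K| = #|K| * #|K|.-1.
Proof.
rewrite (@card_pairs V (fun x y => [&& x \in K, y \in K & x != y])).
rewrite (bigID [in K]) /= [X in _ + X]big1 ?addn0; last first.
  by move=> x /negbTE xK; apply: eq_card0 => y; rewrite !inE xK.
rewrite (eq_bigr (fun=> #|K|.-1)) ?sum_nat_const // => x xK.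
have -> : #|K|.-1 = #|K :\ x| by rewrite (cardsD1 x K) xK.
apply: eq_card => y; rewrite !inE [x == y]eq_sym.
by rewrite xK /= andbC.
Qed.

Lemma card_sym_pairs n (r : rel 'I_n) : symmetric r -> irreflexive r ->
  #|[set p | r p.1 p.2]| = 2 * #|[set p : 'I_n * 'I_n | (val p.1 < val p.2) && r p.1 p.2]|.
Proof.
move=> rS rI; set A := [set p | r p.1 p.2].
pose lt := [set p : 'I_n * 'I_n | val p.1 < val p.2].
have sw_inj : injective (fun p : 'I_n * 'I_n => (p.2, p.1)) by move=> [x y] [x' y'] [-> ->].
have e1 : [set p | (val p.1 < val p.2) && r p.1 p.2] = A :&: lt.
  by apply/setP => p; rewrite !inE andbC.
have e2 : #|A :\: lt| = #|A :&: lt|.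
  rewrite -(card_imset _ sw_inj); apply: eq_card => -[x y]; rewrite !inE /=.
  apply/imsetP/idP => [[[x' y'] /setDP [] /[!inE] /= rxy] | /andP [rxy ltxy]].
    rewrite -leqNgt => le [-> ->]; rewrite rS rxy /= ltn_neqAle le andbT.
    by apply: contraTneq rxy => /val_inj ->; rewrite rI.
  by exists (y, x) => //; rewrite !inE /= -leqNgt rS rxy ltnW.
by rewrite e1 -(cardsID lt A) e2; lia.
Qed.

(** The difference [k (k - 1) - j (j - 1)] factors as [(k - j) (k + j - 1)], and [j] is positive. *)
Lemma grow_arith n k j s0 s1 A0 A1 A : A0 + (k * k.-1 - j * j.-1) <= A1 ->
  A1 + (n - s1) * k <= A -> s1 + j = s0 + k -> 0 < j -> j < k -> s1 <= n ->
  A0 + (n - s0) * k <= A.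
Proof.
move=> H1 H2 es j0 jk sn.
have -> : n - s0 = (n - s1) + (k - j) by clear H1 H2; lia.
rewrite mulnDl; apply: leq_trans H2; rewrite addnCA addnC leq_add2r.
apply: leq_trans H1; rewrite leq_add2l {es sn n s0 s1 A0 A1 A}.
case: j j0 jk => // j _ jk; have [d ->] : exists d, k = j.+1 + d.+1 by exists (k - j.+2); lia.
have -> : j.+1 + d.+1 - j.+1 = d.+1 by lia.
have -> : (j.+1 + d.+1).-1 = j + d.+1 by lia.
have le : j.+1 * j <= (j.+1 + d.+1) * j by rewrite leq_mul2r leq_addr orbT.
move: (j.+1 + d.+1) le => X le; rewrite mulnDr [d.+1 * _]mulnC [j.+1.-1]/=; move: le.
by move: (j.+1 * j) (X * j) (X * d.+1) => x y z; clear; lia.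
Qed.

(** With [s = 2 k - j] the last inequality reduces to [(j - 1) k <= (j - 1) j]. *)
Lemma inter_arith k j s : 1 < j -> j < k -> s + j = k + k ->
  2 * (k * k.-1) - j * j.-1 <= s.-1 * k -> False.
Proof.
case: j => [//|[//|j]] _ jk es.
have lt : j.+2 * j.+1 < j.+1 * k by rewrite mulnC ltn_mul2l; lia.
have : s.-1 * k + j.+1 * k = 2 * (k * k.-1).
  by rewrite -mulnDl mulnCA mulnC; congr (_ * _); lia.
rewrite [j.+2.-1]/=; move: lt; move: (j.+2 * j.+1) (j.+1 * k) (k * k.-1) (s.-1 * k) => x y z u.
clear; lia.
Qed.

Section CliqueCover.
Variables (n : nat) (G : rel 'I_n) (k : nat).
Hypotheses (GI : irreflexive G) (k_gt0 : 0 < k).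
Hypothesis Gconn : forall x y, connect G x y.
Hypothesis Gcov : has_k1_cover G k.

Definition arcs (S : {set 'I_n}) : {set 'I_n * 'I_n} :=
  [set p | [&& p.1 \in S, p.2 \in S & G p.1 p.2]].

Lemma exit_edge (S : {set 'I_n}) x : x \in S -> S != setT ->
  exists x' y', [/\ x' \in S, y' \notin S & G x' y'].
Proof.
move=> xS SnT.
have [y yS] : exists y, y \notin S.
  by apply/existsP; move: SnT; apply: contraR; rewrite negb_exists => /forallP H;
     apply/eqP/setP => y; rewrite inE; have := H y; rewrite negbK.
case/connectP: (Gconn x y) => p; elim: p x xS => [|z p IH] x xS /=.
  by move=> _ e; rewrite e xS in yS.
case/andP=> Gxz pth e; case zS: (z \in S); first exact: (IH z).
by exists x, z; rewrite zS.
Qed.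

(* A clique meeting [S] in [j] vertices brings [k - j] new vertices and at least
   [k (k-1) - j (j-1) >= k (k - j)] new arcs. *)
Lemma arcs_grow (S : {set 'I_n}) : S != set0 ->
  #|arcs S| + (n - #|S|) * k <= #|arcs setT|.
Proof.
move: {2}(n - #|S|) (leqnn (n - #|S|)) => m; elim: m S => [|m IH] S le S0.
  have : S = setT.
    by apply/eqP; rewrite eqEcard subsetT cardsT card_ord /= -subn_eq0 -leqn0.
  by move=> ->; rewrite cardsT card_ord subnn mul0n addn0.
have [->|SnT] := eqVneq S setT; first by rewrite cardsT card_ord subnn mul0n addn0.
have /set0Pn [x xS] := S0.
have [x' [y' [x'S y'S Gxy]]] := exit_edge xS SnT.
have [K [cK x'K y'K Kcl]] := Gcov Gxy.
have S'0 : S :|: K != set0 by apply/set0Pn; exists x; rewrite inE xS.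
have cU := cardsUI S K.
have j1 : 0 < #|S :&: K| by apply/card_gt0P; exists x'; rewrite inE x'S.
have jk : #|S :&: K| < k.
  rewrite -cK; apply: proper_card; rewrite properE subsetIr /=.
  by apply/subsetPn; exists y'; rewrite // inE (negbTE y'S).
have Un : #|S :|: K| <= n by rewrite -[n in _ <= n]card_ord max_card.
have lt : #|S| < #|S :|: K|.
  by rewrite -(ltn_add2r #|S :&: K|) cU cK ltn_add2l.
have {}IH := IH (S :|: K) _ S'0.
have {}IH : #|arcs (S :|: K)| + (n - #|S :|: K|) * k <= #|arcs setT|.
  apply: IH; rewrite -ltnS; apply: leq_trans le.
  by apply: ltn_sub2l => //; apply: leq_trans Un.
have sub : arcs S :|: (offdiag K :\: offdiag (S :&: K)) \subset arcs (S :|: K).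
  apply/subsetP => -[u v]; rewrite !inE /= => /orP [/and3P [-> -> ->] //|].
  case/andP=> _ /and3P [uK vK uv]; rewrite uK vK !orbT /=.
  exact: Kcl.
have dis : [disjoint arcs S & offdiag K :\: offdiag (S :&: K)].
  rewrite -setI_eq0; apply/eqP/setP => -[u v]; rewrite !inE /=.
  case uS: (u \in S) => //=; case vS: (v \in S) => //=.
  by case: (u \in K); case: (v \in K); case: (u != v); rewrite ?andbF.
have := subset_leq_card sub; rewrite cardsU (disjoint_setI0 dis) cards0 subn0.
have sub2 : offdiag (S :&: K) \subset offdiag K.
  by apply/subsetP => -[u v]; rewrite !inE /= => /and3P [/andP [_ ->] /andP [_ ->] ->].
rewrite cardsD (setIidPr sub2) !card_offdiag cK => leA.
by apply: grow_arith leA IH _ j1 jk Un; rewrite cU cK.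
Qed.

Hypothesis Gmin : #|arcs setT| <= n.-1 * k.

(** By [arcs_grow] the vertices outside [S] account for [k] arcs each, and [Gmin] caps the total. *)
Lemma arcs_le (S : {set 'I_n}) : S != set0 -> #|arcs S| <= #|S|.-1 * k.
Proof.
move=> S0; have := arcs_grow S0; move: S0; rewrite -card_gt0 => S0.
have Un : #|S| <= n by rewrite -[n in _ <= n]card_ord max_card.
have e : n.-1 = (n - #|S|) + #|S|.-1 by lia.
by move: Gmin; rewrite e mulnDl; lia.
Qed.

Lemma arcs_total : 0 < n -> #|arcs setT| = n.-1 * k.
Proof.
move=> n0; apply/eqP; rewrite eqn_leq Gmin /=.
have x0 := Ordinal n0.
have S0 : [set x0] != set0 by apply/set0Pn; exists x0; rewrite inE.
have := arcs_grow S0; rewrite cards1 subn1.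
exact: leq_trans (leq_addl _ _).
Qed.

Definition kcliques : {set {set 'I_n}} :=
  [set K : {set 'I_n} | (#|K| == k) && (offdiag K \subset [set p | G p.1 p.2])].

Lemma kcliques_clique K x y : K \in kcliques -> x \in K -> y \in K -> x != y -> G x y.
Proof.
rewrite inE => /andP [_ /subsetP H] xK yK xy.
by have := H (x, y); rewrite !inE /= xK yK xy => /(_ isT).
Qed.

Lemma card_kcliques K : K \in kcliques -> #|K| = k.
Proof. by rewrite inE => /andP [/eqP]. Qed.

(** Two distinct [k]-cliques with at least two common vertices would put more arcs on their union
    than [arcs_le] permits. *)
Lemma kcliques_inter K K' x y : K \in kcliques -> K' \in kcliques ->
  x != y -> x \in K -> y \in K -> x \in K' -> y \in K' -> K = K'.
Proof.
move=> HK HK' xy xK yK xK' yK'.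
have cK := card_kcliques HK; have cK' := card_kcliques HK'.
have S0 : K :|: K' != set0 by apply/set0Pn; exists x; rewrite inE xK.
have sub : offdiag K :|: offdiag K' \subset arcs (K :|: K').
  apply/subsetP => -[u v]; rewrite !inE /= => /orP [] /and3P [uK vK uv]; rewrite uK vK ?orbT /=.
    exact: (kcliques_clique HK).
  exact: (kcliques_clique HK').
have := leq_trans (subset_leq_card sub) (arcs_le S0).
have -> : #|offdiag K :|: offdiag K'| = 2 * (k * k.-1) - #|K :&: K'| * #|K :&: K'|.-1.
  rewrite cardsU !card_offdiag cK cK' -card_offdiag; congr (_ - _); first by rewrite mul2n addnn.
  apply: eq_card => -[u v]; rewrite !inE /=.
  by case: (u \in K); case: (u \in K'); case: (v \in K); case: (v \in K'); case: (u != v).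
have := cardsUI K K'; rewrite cK cK'; set j := #|K :&: K'|.
have j2 : 1 < j.
  have := cards2 x y; rewrite xy => <-; apply: subset_leq_card; apply/subsetP => z.
  by rewrite !inE => /orP [] /eqP ->; apply/andP.
have jk : j <= k by rewrite -cK; apply: subset_leq_card; apply: subsetIl.
move=> cU le; have ejk : j = k.
  apply/eqP; rewrite eqn_leq jk /= leqNgt; apply/negP => jk'.
  exact: inter_arith j2 jk' cU le.
have eK : K :&: K' = K by apply/eqP; rewrite eqEcard subsetIl /= cK -/j ejk.
have eK' : K :&: K' = K' by apply/eqP; rewrite eqEcard subsetIr /= cK' -/j ejk.
exact: etrans (esym eK) eK'.
Qed.

Definition clique_of (x y : 'I_n) : {set 'I_n} :=
  odflt set0 [pick K in kcliques | (x \in K) && (y \in K)].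

Lemma clique_ofP x y : G x y ->
  [/\ clique_of x y \in kcliques, x \in clique_of x y & y \in clique_of x y].
Proof.
move=> Gxy; rewrite /clique_of; case: pickP => [K /and3P [? ? ?] //|].
have [K [cK xK yK Kcl]] := Gcov Gxy => /(_ K); rewrite inE cK eqxx xK yK /= andbT.
case/negP; apply/subsetP => -[u v]; rewrite !inE /= => /and3P [uK vK uv].
exact: Kcl.
Qed.

Lemma clique_of_uniq K x y : G x y -> K \in kcliques -> x \in K -> y \in K -> clique_of x y = K.
Proof.
move=> Gxy HK xK yK; have [H1 H2 H3] := clique_ofP Gxy.
by apply: (kcliques_inter H1 HK (x := x) (y := y)) => //; apply: contraTneq Gxy => ->; rewrite GI.
Qed.

(** Every arc lies in exactly one clique of order [k], so the [(n - 1) k] arcs split into classes of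
    size [k (k - 1)]. *)
Lemma num_kcliques : 0 < n -> #|kcliques| * k.-1 = n.-1.
Proof.
move=> n0; have tot := arcs_total n0.
suff : #|arcs setT| = #|kcliques| * (k * k.-1).
  by rewrite tot mulnCA mulnC => /eqP; rewrite eqn_pmul2l // => /eqP.
rewrite -sum1_card (partition_big (fun p => clique_of p.1 p.2) [in kcliques]) /=; last first.
  by move=> -[x y]; rewrite inE => /and3P [_ _ /clique_ofP []].
rewrite -sum_nat_const; apply: eq_bigr => K HK.
have -> : k * k.-1 = #|offdiag K| by rewrite card_offdiag (card_kcliques HK).
rewrite sum1_card.
apply: eq_card => -[x y]; rewrite [RHS]inE unfold_in /= inE /= !in_setT /=.
apply/andP/and3P => [[Gxy /eqP <-]|[xK yK xy]].
  by have [_ -> ->] := clique_ofP Gxy; split=> //; apply: contraTneq Gxy => ->; rewrite GI.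
have Gxy := kcliques_clique HK xK yK xy; split=> //.
by apply/eqP; apply: clique_of_uniq.
Qed.

End CliqueCover.

(** * Spiders and bin packing *)
Section Spider.
Variables (a : nat -> nat) (Q B : nat).
Hypotheses (a_gt0 : forall q, q < Q -> 0 < a q) (a_leB : forall q, q < Q -> a q <= B).
Hypothesis Q_ge3 : 2 < Q.

(** Vertex 0 is the center, and leg [q] consists of the vertices [pre q + 1] to [pre q + a q],
    numbered outwards. *)
Definition pre (q : nat) := \sum_(j < q) a j.
Let N := pre Q.

Definition leg_edges (q : nat) : seq (nat * nat) :=
  [seq ((if s == 0 then 0 else pre q + s), (pre q + s).+1) | s <- iota 0 (a q)].

Definition spider_edges : seq (nat * nat) := flatten [seq leg_edges q | q <- iota 0 Q].

Local Notation E := spider_edges.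
Local Notation V := 'I_N.+1.
Local Notation adj := (@eadj N.+1 E).

Lemma preS q : pre q.+1 = pre q + a q.
Proof. by rewrite /pre big_ord_recr. Qed.

Lemma pre_mono q q' : q <= q' -> pre q <= pre q'.
Proof. by move=> /subnK <-; elim: (q' - q) => // d IH; rewrite addSn preS; lia. Qed.

Definition leg (v : nat) := find (fun q => v <= pre q.+1) (iota 0 Q).

Lemma legP v : 0 < v <= N -> leg v < Q /\ pre (leg v) < v <= pre (leg v).+1.
Proof.
move=> /andP [v0 vN]; pose p q := v <= pre q.+1.
have h : has p (iota 0 Q).
  apply/hasP; exists Q.-1; first by rewrite mem_iota; lia.
  by rewrite /p prednK //; lia.
have lt : leg v < Q by rewrite -[Q in _ < Q](size_iota 0) -has_find.
have := nth_find 0 h; rewrite -/(leg v) nth_iota // add0n /p => le; split=> //.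
rewrite le andbT; case e: (leg v) => [|l]; first by rewrite /pre big_ord0.
rewrite ltnNge; apply/negP => H.
have : l < find p (iota 0 Q) by rewrite -/(leg v) e.
by move/(before_find 0); rewrite nth_iota ?add0n /p ?H //; lia.
Qed.

Lemma leg_uniq v q : q < Q -> pre q < v <= pre q.+1 -> leg v = q.
Proof.
move=> qQ H; have vN : 0 < v <= N by have := @pre_mono q.+1 Q; rewrite /N; lia.
have [l1 l2] := legP vN.
case: (ltngtP (leg v) q) => // c.
  by have := pre_mono c; lia.
by have := pre_mono c; lia.
Qed.

(** The neighbour towards the center. It has the smaller number, so induction on vertices walks
    along a leg to the center. *)
Definition par (v : nat) := if v == (pre (leg v)).+1 then 0 else v.-1.

Lemma par_lt v : 0 < v -> par v < v.
Proof. by rewrite /par; case: ifP; lia. Qed.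

Lemma mem_spider_edges x y : ((x, y) \in E) = (0 < y <= N) && (x == par y).
Proof.
apply/flattenP/andP.
  case=> _ /mapP [q /[!mem_iota] qQ ->] /mapP [s /[!mem_iota] sa [-> ->]].
  have el : leg (pre q + s).+1 = q by apply: leg_uniq; rewrite ?preS; lia.
  have := @pre_mono q.+1 Q; rewrite preS -/N => le; split; first by lia.
  by rewrite /par el; case: (s =P 0) => [->|s0]; [rewrite addn0 eqxx | rewrite ifF //=; lia].
case=> Hy /eqP ->; have [l1 l2] := legP Hy; rewrite preS in l2.
exists (leg_edges (leg y)); first by apply/mapP; exists (leg y) => //; rewrite mem_iota.
apply/mapP; exists (y - (pre (leg y)).+1); first by rewrite mem_iota; lia.
rewrite /par; congr (_, _); last by lia.
by case: eqP => e1; case: eqP => e2 //; lia.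
Qed.

Lemma adjE (x y : V) : adj x y = ((0 < y) && (x == par y :> nat)) || ((0 < x) && (y == par x :> nat)).
Proof.
rewrite /eadj !mem_spider_edges.
have := ltn_ord x; have := ltn_ord y; rewrite !ltnS => -> ->; rewrite !andbT.
case: (eqVneq x y) => //= -> ; case: posnP => //= y0.
by have := par_lt y0; case: eqP; lia.
Qed.

Lemma adj_sym : symmetric adj.
Proof. by move=> x y; rewrite !adjE orbC. Qed.

Lemma adj_irr : irreflexive adj.
Proof. by move=> x; rewrite /eadj eqxx. Qed.

Definition vpar (v : V) : V := inord (par v).

Lemma vparE v : vpar v = par v :> nat.
Proof.
rewrite /vpar /= inordK //; case: (posnP v) => [e|v0].
  by rewrite /par e.
by have := par_lt v0; have := ltn_ord v; lia.
Qed.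

Lemma adj_par (v : V) : 0 < v -> adj (vpar v) v.
Proof. by move=> v0; rewrite adjE v0 vparE eqxx. Qed.

Lemma connect_root (v : V) : connect adj v ord0.
Proof.
have [m le] := ubnP (nat_of_ord v); elim: m v le => // m IH v lt.
case: (posnP v) => [e|v0]; first by have -> : v = ord0 by apply: val_inj.
have Hp : adj v (vpar v) by rewrite adj_sym adj_par.
apply: connect_trans (connect1 Hp) (IH _ _); rewrite vparE.
exact: leq_trans (par_lt v0) lt.
Qed.

Lemma adj_connected : connected_graph adj.
Proof.
move=> x y; apply: connect_trans (connect_root x) _.
by rewrite sym_connect_sym ?connect_root //; exact: adj_sym.
Qed.

Lemma nz_set_card : #|[set v : V | 0 < v]| = N.
Proof.
have -> : [set v : V | 0 < v] = setT :\ ord0.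
  by apply/setP => v; rewrite !inE andbT lt0n.
by have /eqP := cardsD1 ord0 [set: V]; rewrite inE cardsT card_ord add1n eqSS eq_sym => /eqP.
Qed.

Lemma edge_set_card : #|edge_set adj| = N.
Proof.
have -> : edge_set adj = [set (vpar v, v) | v in [set v : V | 0 < v]].
  apply/setP => -[x y]; rewrite inE /= adjE; apply/andP/imsetP.
    case=> ltxy /orP [/andP [y0 /eqP e]|/andP [x0 /eqP e]].
      by exists y; rewrite ?inE //; congr (_, _); apply: val_inj; rewrite /= vparE.
    by have := par_lt x0; rewrite -e ltnNge (ltnW ltxy).
  case=> v; rewrite inE => v0 [-> ->].
  by split; [rewrite /= vparE par_lt | rewrite v0 vparE eqxx].
by rewrite card_imset ?nz_set_card // => x y [].
Qed.

Lemma first_ok q : q < Q -> [/\ (pre q).+1 <= N, leg (pre q).+1 = q & par (pre q).+1 = 0].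
Proof.
move=> qQ; have := a_gt0 qQ => aq.
have el : leg (pre q).+1 = q by apply: leg_uniq; rewrite ?preS; lia.
have := @pre_mono q.+1 Q; rewrite preS -/N => le; split=> //; first by lia.
by rewrite /par el eqxx.
Qed.

Lemma par_cases v : 0 < v <= N ->
  par v = 0 /\ v = (pre (leg v)).+1 \/ [/\ par v = v.-1, 1 < v & leg v.-1 = leg v].
Proof.
move=> Hv; have [l1 l2] := legP Hv; rewrite /par; case: eqP => e; [by left | right].
by split=> //; [lia | apply: leg_uniq => //; lia].
Qed.

Lemma leg_card q : q < Q -> #|[set v : V | (0 < v) && (leg v == q)]| = a q.
Proof.
move=> qQ; have le : pre q + a q <= N by rewrite -preS; apply: pre_mono.
have h (s : 'I_(a q)) : (pre q + s).+1 < N.+1 by have := ltn_ord s; lia.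
have -> : [set v : V | (0 < v) && (leg v == q)] = [set Ordinal (h s) | s in 'I_(a q)].
  apply/setP => v; rewrite inE; apply/andP/imsetP.
    case=> v0 /eqP e; have Hv : 0 < v <= N by have := ltn_ord v; lia.
    have [l1 l2] := legP Hv; rewrite e preS in l2.
    have hs : v - (pre q).+1 < a q by lia.
    by exists (Ordinal hs) => //; apply: val_inj => /=; lia.
  case=> s _ ->; split=> //=; apply/eqP; apply: leg_uniq => //.
  by rewrite preS; have := ltn_ord s; lia.
by rewrite card_imset ?card_ord // => s s' /(congr1 val) /= e; apply: val_inj => /=; lia.
Qed.

Lemma spider_wf : wf_edges N.+1 E.
Proof.
apply/allP => -[x y]; rewrite mem_spider_edges /= => /andP [Hy /eqP ->].
by have := @par_lt y; lia.
Qed.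

Lemma spider_is_spider : is_spider adj.
Proof.
split; first by split=> //; split; [exact: adj_connected | rewrite edge_set_card].
have -> : [set x | 2 < degree adj x] = [set ord0]; last by rewrite cards1.
apply/setP => x; rewrite !inE; apply/idP/eqP => [|->].
  case: (posnP x) => [e _|x0]; first exact: val_inj.
  rewrite ltnNge => /negP; case; rewrite /degree.
  apply: (@leq_trans #|[set vpar x; inord x.+1]|); last by rewrite cards2; case: eqP.
  apply: subset_leq_card; apply/subsetP => y; rewrite !inE adjE x0 /=.
  case/orP=> [/andP [y0 /eqP e]|/eqP e]; last by rewrite -vparE in e; rewrite (val_inj e) eqxx.
  have Hy : 0 < y <= N by have := ltn_ord y; lia.
  have [[e1 _]|[e1 y1 _]] := par_cases Hy; first by rewrite e1 in e; lia.
  apply/orP; right; apply/eqP; apply: val_inj => /=; rewrite inordK; first by lia.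
  by have := ltn_ord y; lia.
apply: (leq_trans Q_ge3); rewrite /degree.
have h (q : 'I_Q) : (pre q).+1 < N.+1 by have [] := first_ok (ltn_ord q).
have -> : Q = #|[set Ordinal (h q) | q in 'I_Q]|.
  rewrite card_imset ?card_ord // => q q' /(congr1 val) /= e; apply: val_inj => /=.
  by have [_ <- _] := first_ok (ltn_ord q); have [_ <- _] := first_ok (ltn_ord q'); rewrite e.
apply: subset_leq_card; apply/subsetP => y /imsetP [q _ ->]; rewrite inE adjE /=.
by have [_ _ ->] := first_ok (ltn_ord q).
Qed.

Lemma add_edges_sym F : symmetric (add_edges adj F).
Proof. by move=> x y; rewrite /add_edges adj_sym [X in _ || X]orbC. Qed.

Lemma insubd_ord (q0 : 'I_Q) m : m < Q -> insubd q0 m = m :> nat.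
Proof. by move=> lt; rewrite -[LHS]/(val _) val_insubd lt. Qed.

(** * From a completion set to a packing *)

Section Sound.
Variables (t : nat) (F : {set V * V}).
Hypotheses (F_ok : forall p, p \in F -> (val p.1 < val p.2) && ~~ adj p.1 p.2).
Hypotheses (F_card : #|F| = t) (t_le : 2 * t <= N * B.-1).
Hypothesis F_cov : has_k1_cover (add_edges adj F) B.+1.

Let G := add_edges adj F.

Lemma G_irr : irreflexive G.
Proof.
move=> x; rewrite /G /add_edges adj_irr /= orbb; apply/negP => /F_ok.
by rewrite /= ltnn.
Qed.

Lemma G_conn x y : connect G x y.
Proof.
by apply: connect_sub (adj_connected x y) => u v uv; apply: connect1; rewrite /G /add_edges uv.
Qed.

(** The [N] tree edges and [t] added ones make at most [2 N + N (B - 1) = N (B + 1)] arcs, the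
    minimum for [N + 1] vertices and cliques of order [B + 1]. *)
Lemma G_arcs : #|arcs G setT| <= N.+1.-1 * B.+1.
Proof.
have -> : arcs G setT = [set p | G p.1 p.2] by apply/setP => p; rewrite !inE.
rewrite (card_sym_pairs (add_edges_sym F) G_irr).
have le : #|[set p : V * V | (val p.1 < val p.2) && G p.1 p.2]| <= N + t.
  apply: (@leq_trans #|edge_set adj :|: F|); last by rewrite cardsU edge_set_card F_card leq_subr.
  apply: subset_leq_card; apply/subsetP => -[x y]; rewrite !inE /= => /andP [lt].
  case/or3P=> [->|->|/F_ok /=]; rewrite ?lt ?orbT //; lia.
have B0 : 0 < B by have := a_gt0 (q := 0); have := a_leB (q := 0); lia.
rewrite /=; have -> : N * B.+1 = 2 * N + N * B.-1 by rewrite -[B]prednK //= !mulnS; lia.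
by apply: leq_trans (leq_mul (leqnn 2) le) _; rewrite mulnDr leq_add2l.
Qed.

Let KK := kcliques G B.+1.
(** Tree edges are named by their outer end [v]; [Kv v] is the clique covering that edge, and [D K]
    collects the edges covered by [K]. *)
Let Kv (v : V) := clique_of G B.+1 (vpar v) v.
Let D (K : {set V}) := [set v : V | (0 < v) && (Kv v == K)].

Lemma G_par (v : V) : 0 < v -> G (vpar v) v.
Proof. by move=> v0; rewrite /G /add_edges adj_par. Qed.

Lemma KvP (v : V) : 0 < v -> [/\ Kv v \in KK, vpar v \in Kv v & v \in Kv v].
Proof. by move=> v0; apply: clique_ofP F_cov _ _ (G_par v0). Qed.

(** The least vertex of a clique cannot lie in [D K]: its parent would be a smaller vertex of the
    clique. *)
Lemma D_sub K : K \in KK -> exists m, [/\ m \in K, D K \subset K :\ m & forall v, v \in K -> m <= v].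
Proof.
move=> HK; have cK := card_kcliques HK.
have /card_gt0P [x xK] : 0 < #|K| by rewrite cK.
case: (@arg_minnP _ x [in K] val xK) => m mK Hm; exists m; split=> //.
apply/subsetP => v; rewrite !inE => /andP [v0 /eqP e]; have [_ pv vv] := KvP v0.
rewrite e in pv vv; rewrite vv andbT; apply: contraTneq v0 => e'.
have := Hm _ pv; rewrite /= vparE -e' leqNgt.
by case: posnP => // v0; rewrite par_lt.
Qed.

(** There are [N / B] cliques, each covers at most [B] of the [N] tree edges, so each covers exactly
    [B]. *)
Lemma D_card K : K \in KK -> #|D K| = B.
Proof.
have le K' : K' \in KK -> #|D K'| <= B.
  move=> HK; have [m [mK /subset_leq_card le _]] := D_sub HK.
  apply: leq_trans le _.
  by have := cardsD1 m K'; rewrite mK (card_kcliques HK) add1n => -[->].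
have tot : \sum_(K' in KK) #|D K'| = N.
  rewrite -[RHS]nz_set_card -[RHS]sum1_card.
  rewrite (partition_big Kv [in KK]) /=; last by move=> v; rewrite inE => /KvP [].
  apply: eq_bigr => K' _; rewrite sum1_card; apply: eq_card => v.
  by rewrite !inE unfold_in /= inE.
have num := num_kcliques G_irr (ltn0Sn B) G_conn F_cov G_arcs (ltn0Sn _).
move=> HK; apply/eqP; rewrite eqn_leq le //= leqNgt; apply/negP => lt.
suff : N < N by rewrite ltnn.
rewrite -{1}tot -[X in _ < X]num -sum_nat_const (bigD1 K) //= [X in _ < X](bigD1 K) //=.
rewrite -addSn; apply: leq_add => //; apply: leq_sum => K' /andP [HK' _]; exact: le.
Qed.

(** By equality in [D_sub] every vertex of [K] but the least has its parent in [K]. Without the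
    center such a set stays on one leg, which has at most [B] vertices, while [K] has [B + 1]. *)
Lemma root_in K : K \in KK -> ord0 \in K.
Proof.
move=> HK; have [m [mK sub Hm]] := D_sub HK; apply: contraT => NK.
have cK := card_kcliques HK.
have eD : D K = K :\ m.
  apply/eqP; rewrite eqEcard sub (D_card HK) /=.
  by have := cardsD1 m K; rewrite mK cK add1n => -[->].
have nz (v : V) : v \in K -> 0 < v.
  by move=> vK; rewrite lt0n; apply: contraNneq NK => e; have <- : v = ord0 by apply: val_inj.
have legK (v : V) : v \in K -> leg v = leg m.
  have [b lb] := ubnP (nat_of_ord v); elim: b v lb => // b IH v lb vK.
  have [->//|vm] := eqVneq v m.
  have : v \in D K by rewrite eD !inE vm.
  rewrite inE => /andP [v0 /eqP e]; have [_ pv _] := KvP v0; rewrite e in pv.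
  have Hv : 0 < v <= N by rewrite v0 -ltnS ltn_ord.
  have [[p0 _]|[p1 v1 <-]] := par_cases Hv.
    by have := nz _ pv; rewrite vparE p0.
  have := IH (vpar v); rewrite vparE p1; apply=> //.
  by move: lb v0; rewrite /=; case: (nat_of_ord v).
have sub2 : K \subset [set v : V | (0 < v) && (leg v == leg m)].
  by apply/subsetP => v vK; rewrite inE nz //= legK.
have Hm0 : 0 < m <= N by rewrite nz //= -ltnS ltn_ord.
have [lQ _] := legP Hm0.
have := leq_trans (subset_leq_card sub2) _; rewrite leg_card // cK => /(_ _ (a_leB lQ)).
by rewrite ltnn.
Qed.

(** The cliques of two consecutive edges of a leg share the common vertex and the center, hence
    coincide. *)
Lemma Kv_leg (v : V) : 0 < v -> Kv v = Kv (inord (pre (leg v)).+1).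
Proof.
have [b lb] := ubnP (nat_of_ord v); elim: b v lb => // b IH v lb v0.
have Hv : 0 < v <= N by rewrite v0 -ltnS ltn_ord.
have [[_ e]|[p1 v1 el]] := par_cases Hv.
  by congr Kv; apply: val_inj => /=; rewrite inordK -e.
have vp0 : 0 < vpar v by rewrite vparE p1; move: v1; case: (nat_of_ord v) => [|[]].
have [H1 H2 H3] := KvP v0; have [H4 H5 H6] := KvP vp0.
have -> : Kv v = Kv (vpar v).
  apply: (kcliques_inter (ltn0Sn B) G_conn F_cov G_arcs H1 H4 (x := ord0) (y := vpar v)) => //.
  - by apply: contraTneq vp0 => <-.
  - exact: root_in.
  - exact: root_in.
rewrite IH // vparE p1 ?el //.
by move: lb v0; rewrite /=; case: (nat_of_ord v).
Qed.

(** The bin of a leg is the clique of its first edge; the legs in the bin [K] have total length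
    [#|D K|]. *)
Lemma spider_sound : packable (fun q : 'I_Q => a q) B.
Proof.
exists {set V}, (fun q : 'I_Q => Kv (inord (pre q).+1)) => q.
have [le el ep] := first_ok (ltn_ord q).
have q0 : 0 < (inord (pre q).+1 : V) by rewrite inordK.
have [HK _ _] := KvP q0; rewrite -(D_card HK).
have legQ (v : V) : 0 < v -> leg v < Q.
  by move=> v0; case: (@legP v) => //; rewrite v0 -ltnS ltn_ord.
rewrite -sum1_card (eq_bigl (fun v : V => (0 < v) && (Kv v == Kv (inord (pre q).+1)))); last by move=> v; rewrite inE.
pose o0 : 'I_Q := q.
rewrite (partition_big (fun v : V => insubd o0 (leg v)) (fun q' : 'I_Q => Kv (inord (pre q').+1) == Kv (inord (pre q).+1))) /=; last first.
  by move=> v /andP [v0 /eqP <-]; rewrite (Kv_leg v0) insubd_ord ?legQ.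
apply: eq_bigr => q' Hq'; rewrite sum1_card -(leg_card (ltn_ord q')).
apply: eq_card => v; rewrite !inE unfold_in /=.
case: (posnP v) => //= v0; rewrite -[insubd _ _ == q']val_eqE /= insubd_ord ?legQ //.
by case: eqP => [e|]; rewrite ?andbF // andbT (Kv_leg v0) e.
Qed.

End Sound.

(** * From a packing to a completion set *)

Section Complete.
Variables (T : finType) (f : 'I_Q -> T).
Hypothesis fB : forall q, \sum_(q' | f q' == f q) a q' = B.

Let q0 : 'I_Q := Ordinal (ltnW (ltnW Q_ge3)).
Let bin (v : V) : T := f (insubd q0 (leg v)).
(** Adjacency or equality in the completed graph, whose cliques are the center together with one bin
    each. *)
Let same (x y : V) := [|| x == ord0, y == ord0 | bin x == bin y].

Lemma legV (v : V) : 0 < v -> leg v < Q.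
Proof. by move=> v0; case: (@legP v) => //; rewrite v0 -ltnS ltn_ord. Qed.

Lemma bin_card q : #|[set v : V | (0 < v) && (bin v == f q)]| = B.
Proof.
rewrite -(fB q) -sum1_card (eq_bigl (fun v : V => (0 < v) && (bin v == f q))); last by move=> v; rewrite inE.
rewrite (partition_big (fun v : V => insubd q0 (leg v)) (fun q' => f q' == f q)) /=; last by move=> v /andP [].
apply: eq_bigr => q' Hq'; rewrite sum1_card -(leg_card (ltn_ord q')).
apply: eq_card => v; rewrite !inE unfold_in /=.
case: (posnP v) => //= v0; rewrite /bin -[insubd _ _ == q']val_eqE /= insubd_ord ?legV //.
case: (leg v =P q') => [e|_]; rewrite ?andbF // andbT.
by have -> : insubd q0 (leg v) = q' by apply: val_inj; rewrite /= insubd_ord ?legV.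
Qed.

Lemma same_sym x y : same x y = same y x.
Proof. by rewrite /same orbCA [bin x == _]eq_sym. Qed.

Lemma adj_same x y : adj x y -> same x y.
Proof.
have H (u v : V) : 0 < v -> u = par v :> nat -> same u v.
  move=> v0 e; have Hv : 0 < v <= N by rewrite v0 -ltnS ltn_ord.
  have [[p0 _]|[p1 v1 el]] := par_cases Hv.
    by apply/orP; left; apply/eqP; apply: val_inj; rewrite /= e p0.
  by rewrite /same /bin e p1 el eqxx !orbT.
rewrite adjE => /orP [] /andP [p /eqP e]; first exact: H.
by rewrite same_sym; apply: H.
Qed.

Let F : {set V * V} := [set p | [&& val p.1 < val p.2, ~~ adj p.1 p.2 & same p.1 p.2]].

Let r (x y : V) := [&& 0 < x, 0 < y, x != y & bin x == bin y].

Lemma same_pair_card : #|[set p | r p.1 p.2]| = N * B.-1.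
Proof.
rewrite card_pairs (bigID (fun x : V => 0 < x)) /= [X in _ + X]big1 ?addn0; last first.
  by move=> x /negbTE x0; apply: eq_card0 => y; rewrite inE /r x0.
have -> : N * B.-1 = \sum_(x in [set v : V | 0 < v]) B.-1 by rewrite sum_nat_const nz_set_card.
rewrite [RHS](eq_bigl (fun x : V => 0 < x)); last by move=> x; rewrite inE.
apply: eq_bigr => x x0.
have := bin_card (insubd q0 (leg x)); rewrite -/(bin x) => <-.
rewrite [in RHS](cardsD1 x) inE x0 eqxx /=.
by apply: eq_card => y; rewrite !inE /r x0 /= eq_sym [bin x == _]eq_sym andbCA.
Qed.

(** The edges of the completed graph are counted in two ways: as pairs with the center and pairs
    within a bin, and as tree edges and added edges. There are [N] center pairs and [N] tree edges.
    The pairs within bins show that [N * B.-1] is even, so the halving is exact. *)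
Lemma F_half : #|F| = (N * B.-1)./2.
Proof.
have rS : symmetric r by move=> x y; rewrite /r andbCA eq_sym [bin x == _]eq_sym.
have rI : irreflexive r by move=> x; rewrite /r eqxx /= !andbF.
have := same_pair_card; rewrite (card_sym_pairs rS rI) mul2n => <-; rewrite doubleK.
pose A := [set p : V * V | (val p.1 < val p.2) && r p.1 p.2].
pose Z := [set (ord0 : V, v) | v in [set v : V | 0 < v]].
have cZ : #|Z| = N by rewrite card_imset ?nz_set_card // => x y [].
have dis : [disjoint Z & A].
  by rewrite -setI_eq0; apply/eqP/setP => p; rewrite !inE; apply/negP => /andP [/imsetP [v _ ->]] /andP [].
have eU : Z :|: A = F :|: edge_set adj.
  apply/setP => -[x y]; rewrite !inE /=; apply/orP/orP.
  - case=> [/imsetP [v]|].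
      rewrite inE => v0 [-> ->]; case ad: (adj ord0 v); [right | left]; by rewrite ?ad ?/same ?eqxx !andbT.
    case/andP=> lt /and4P [x0 y0 xy b]; rewrite lt /=; case ad: (adj x y); [by right | left].
    by rewrite /same b !orbT.
  - move=> H; have {H} [lt sm] : val x < val y /\ same x y.
      by case: H => [/and3P [? _ ?]|/andP [? /adj_same ?]].
    case: (posnP x) => [x0|x0]; [left | right].
      have ex : x = ord0 by apply: val_inj.
      by apply/imsetP; exists y; rewrite ?ex // inE (leq_trans _ lt).
    rewrite lt /r x0 (leq_ltn_trans _ lt) //=.
    move: sm; rewrite /same -!val_eqE /=.
    have -> : (nat_of_ord x == 0) = false by lia.
    have -> : (nat_of_ord y == 0) = false by move: lt => /=; lia.
    by move=> /= ->; rewrite andbT neq_ltn lt.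
have dis2 : [disjoint F & edge_set adj].
  by rewrite -setI_eq0; apply/eqP/setP => p; rewrite !inE; apply/negP => /andP [/and3P [_ /negP nad _] /andP [_]].
have := congr1 (fun X : {set V * V} => #|X|) eU.
rewrite !cardsU (disjoint_setI0 dis) (disjoint_setI0 dis2) cards0 !subn0 edge_set_card cZ addnC => /eqP.
by rewrite eqn_add2r => /eqP.
Qed.

Lemma spider_complete : has_completion_set adj B.+1 (N * B.-1)./2.
Proof.
exists F; split; [by move=> p; rewrite inE => /and3P [-> ->] | exact: F_half |].
have sameG x y : same x y -> x != y -> add_edges adj F x y.
  move=> sm xy; rewrite /add_edges; case ad: (adj x y) => //=; 
  rewrite !inE /= ad [adj y x]adj_sym ad [same y x]same_sym sm /= !andbT.
  by rewrite -neq_ltn.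
have Gsame x y : add_edges adj F x y -> same x y.
  case/or3P=> [/adj_same //||]; rewrite inE /= => /and3P [_ _] //.
  by rewrite same_sym.
move=> x y Gxy; have sm := Gsame _ _ Gxy.
(* An end other than the center determines the bin. *)
pose z := if x == ord0 then y else x.
pose K := [set v : V | (v == ord0) || (bin v == bin z)].
exists K; split.
- have -> : K = ord0 |: [set v : V | (0 < v) && (bin v == bin z)].
    by apply/setP => v; rewrite !inE -val_eqE /=; case: posnP.
  by rewrite cardsU1 inE /= add1n bin_card.
- by rewrite inE /z; case: (x =P ord0) => //= _; rewrite eqxx.
- rewrite inE /z; case: (x =P ord0) => [_|/eqP x0]; first by rewrite eqxx orbT.
  by move: sm; rewrite /same (negbTE x0) /= [bin y == _]eq_sym.
- move=> u v; rewrite !inE => Hu Hv uv; apply: sameG => //; rewrite /same.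
  case/orP: Hu => [->//|/eqP ->]; case/orP: Hv => [->|/eqP ->]; by rewrite ?eqxx ?orbT.
Qed.

End Complete.

(** Provides [k <= n] for the instance. *)
Lemma packable_leq : packable (fun q : 'I_Q => a q) B -> B <= N.
Proof.
case=> T [f H]; rewrite -(H (Ordinal (ltnW (ltnW Q_ge3)))) /N /pre.
by rewrite [X in _ <= X](bigID (fun q => f q == f (Ordinal (ltnW (ltnW Q_ge3))))) /= leq_addr.
Qed.

Theorem spider_completion_packable :
  has_completion_set adj B.+1 (N * B.-1)./2 <-> packable (fun q : 'I_Q => a q) B.
Proof.
split; last by case=> T [f fB]; apply: spider_complete fB.
(* Soundness asks for [2 * t <= N * B.-1], which rounding down guarantees. *)
case=> F [H1 H2 H3]; apply: (spider_sound H1 H2 _ H3).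
by rewrite mul2n -{2}[N * B.-1]odd_double_half leq_addl.
Qed.

End Spider.

(** * Tilings and bin packing *)
Lemma digits_lt W q (v : nat -> nat) : (forall j, j < q -> v j < W) ->
  \sum_(j < q) v j * W ^ j < W ^ q.
Proof.
elim: q => [|q IH] H; first by rewrite big_ord0.
rewrite big_ord_recr /= expnS.
have lt1 : \sum_(j < q) v j * W ^ j < W ^ q by apply: IH => j jq; apply: H; lia.
have lt2 : (v q).+1 * W ^ q <= W * W ^ q by rewrite leq_mul2r H ?orbT.
by apply: leq_trans lt2; rewrite mulSn ltn_add2r.
Qed.

Lemma digits_inj W q (u v : nat -> nat) :
  (forall j, j < q -> u j < W) -> (forall j, j < q -> v j < W) ->
  \sum_(j < q) u j * W ^ j = \sum_(j < q) v j * W ^ j ->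
  forall j, j < q -> u j = v j.
Proof.
elim: q => [//|q IH] Hu Hv; rewrite !big_ord_recr /= => e.
have lu : \sum_(j < q) u j * W ^ j < W ^ q by apply: digits_lt => j jq; apply: Hu; lia.
have lv : \sum_(j < q) v j * W ^ j < W ^ q by apply: digits_lt => j jq; apply: Hv; lia.
have W0 : 0 < W ^ q by apply: leq_ltn_trans lu.
have eq1 : u q = v q.
  have := congr1 (divn^~ (W ^ q)) e.
  by rewrite ![_ + _ * _]addnC !divnMDl // !divn_small // !addn0.
move=> j jq; case: (ltngtP j q) => [lt||->] //; last by lia.
apply: IH => //; [by move=> i iq; apply: Hu; lia | by move=> i iq; apply: Hv; lia |].
by move: e; rewrite eq1 => /addIn.
Qed.

(** The top digits are positive, so at most [b q] items share the bin. All digit sums then stay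
    below [W], no carry occurs, and the two expansions agree digit by digit. *)
Lemma digit_sums (I : finType) (P : pred I) (D : I -> nat -> nat) (b : nat -> nat) W M q :
  (forall x, P x -> 0 < D x q) -> (forall x j, j <= q -> D x j <= M) ->
  (forall j, j <= q -> b j <= M) -> M < W -> b q * M < W ->
  \sum_(x | P x) \sum_(j < q.+1) D x j * W ^ j = \sum_(j < q.+1) b j * W ^ j ->
  forall j, j < q.+1 -> \sum_(x | P x) D x j = b j.
Proof.
move=> Dq DM bM MW bMW e.
have W0 : 0 < W ^ q by rewrite expn_gt0; lia.
have S1 c : \sum_(x | P x) c = (\sum_(x | P x) 1) * c.
  by rewrite big_distrl /=; apply: eq_bigr => x _; rewrite mul1n.
have cP : \sum_(x | P x) 1 <= b q.
  have lt : \sum_(x | P x) W ^ q < (b q).+1 * W ^ q.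
    apply: (@leq_ltn_trans (\sum_(x | P x) \sum_(j < q.+1) D x j * W ^ j)).
      apply: leq_sum => x Px; rewrite big_ord_recr /=.
      by apply: leq_trans (leq_addl _ _); rewrite -{1}[W ^ q]mul1n leq_mul2r Dq ?orbT.
    rewrite e big_ord_recr /= mulSn ltn_add2r.
    by apply: digits_lt => j jq; apply: leq_ltn_trans (bM _ _) MW; lia.
  by move: lt; rewrite S1 ltn_mul2r W0 ltnS.
apply: (@digits_inj W).
- move=> j jq; apply: leq_ltn_trans bMW.
  apply: (@leq_trans (\sum_(x | P x) M)); last by rewrite S1 leq_mul2r cP orbT.
  by apply: leq_sum => x _; apply: DM.
- by move=> j jq; apply: leq_ltn_trans (bM _ _) MW; lia.
- rewrite -e exchange_big /=; apply: eq_bigr => j _; exact: big_distrl.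
Qed.

Section Tiling.
Variables (L : nat) (tile col : finType) (t0 : tile) (c0 : col).
Variables (out : bool -> 'I_L -> tile -> col) (inn : bool -> tile -> col).
Variables (sh sh' : bool -> 'I_L -> 'I_L).
Hypotheses (shK : forall d, cancel (sh d) (sh' d)) (shK' : forall d, cancel (sh' d) (sh d)).

(** Bins are identified with leaders, items too heavy for two to share a bin: one for each cell and
    tile, and one for each edge, given by its tail and direction, and colour. *)
Definition ld : finType := ('I_L * (tile + bool * col))%type.
(** [None] marks the switch element of a tile or of an edge colour. [Some (d, s)] with a tile is a
    dummy for one of its edges; [Some s] with a colour is an actual element. The side [s] is [false]
    at the tail and [true] at the head of an edge, and the cell of an actual element is the cell at
    that end. *)
Definition elem : finType := ('I_L * (tile * option (bool * bool) + bool * col * option bool))%type.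

Definition eid (i : nat) (c : col) : nat := i * #|col| + enum_rank c.
(** The offset keeps these identifiers apart from the cell numbers, which identify the tile
    switches. *)
Definition sid (d : bool) (i : nat) : nat := L * d.+1 + i.
Definition id_max := 3 * L + L * #|col|.
(** A bin holds at most 20 items and a digit is at most [id_max + 20], so no carry can occur. *)
Definition base := 21 * (id_max + 20).

(** Class 0 is that of the switches; classes 1 to 4 are the four combinations of direction and side,
    recovered by [cls_dir] and [cls_side]. *)
Definition cls (d s : bool) : nat := (d.*2 + s).+1.
Definition cls_dir (k : nat) : bool := if k is _.+3 then true else false.
Definition cls_side (k : nat) : bool := ~~ odd k.

Definition tcol (i : 'I_L) (t : tile) (d s : bool) := if s then inn d t else out d i t.

(** The identifier of the element of class [k] that belongs into the bin of [l], or [None] if the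
    bin takes no element of that class. *)
Definition expects (l : ld) (k : nat) : option nat :=
  let: (i, g) := l in
  match g with
  | inl t => Some (if k == 0 then i : nat else eid i (tcol i t (cls_dir k) (cls_side k)))
  | inr (d, c) => if k == 0 then Some (sid d i)
                  else if cls_dir k == d then Some (eid (if cls_side k then sh d i else i) c)
                  else None
  end.

Definition ld_count (l : ld) := if l.2 is inl _ then 5 else 3.
Definition ld_mode (l : ld) := if l.2 is inl _ then 4 else 2.

Definition elem_class (e : elem) : nat :=
  match e.2 with
  | inl (_, None) | inr (_, None) => 0
  | inl (_, Some (d, s)) => cls d s
  | inr ((d, _), Some s) => cls d s
  end.

Definition elem_id (e : elem) : nat :=
  match e.2 with
  | inl (_, None) => e.1
  | inl (t, Some (d, s)) => eid e.1 (tcol e.1 t d s)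
  | inr ((d, _), None) => sid d e.1
  | inr ((d, c), Some s) => eid e.1 c
  end.

(* The mode digit forces a bin to be all-actual or all-dummy: the switch element of a tile
   weighs 4 = the number of dummy edge elements it replaces, that of an edge weighs 2. *)
Definition elem_mode (e : elem) : nat :=
  match e.2 with
  | inl (t, None) => if t == t0 then 4 else 0
  | inl (_, Some _) => 1
  | inr ((_, c), None) => if c == c0 then 0 else 2
  | inr (_, Some _) => 0
  end.

(** Digits [2 k] and [2 k + 1] count the elements of class [k] and add up their identifiers, digit
    10 adds up the modes, and digit 11 counts each element once. A leader supplies what the expected
    elements leave open, and itself fills the count of a class it does not expect. The capacity 20
    of digit 11 is more than five elements can reach and less than two leaders contribute, with at
    least 15 each. *)
Definition ld_digit (l : ld) (j : nat) : nat :=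
  if j == 11 then 20 - ld_count l
  else if j == 10 then 4 - ld_mode l
  else if odd j then id_max - odflt 0 (expects l j./2)
  else ~~ isSome (expects l j./2).

Definition elem_digit (e : elem) (j : nat) : nat :=
  if j == 11 then 1
  else if j == 10 then elem_mode e
  else if j./2 == elem_class e then (if odd j then elem_id e else 1) else 0.

Definition bin_digit (j : nat) : nat :=
  if j == 11 then 20 else if j == 10 then 4 else if odd j then id_max else 1.

Definition item : finType := (ld + elem)%type.
Definition digit (x : item) (j : nat) := match x with inl l => ld_digit l j | inr e => elem_digit e j end.

Definition number (D : nat -> nat) := \sum_(j < 12) D j * base ^ j.
Definition weight_of (x : item) := number (digit x).
Definition capacity := number bin_digit.

Lemma eid_lt (i : 'I_L) c : eid i c < L * #|col|.
Proof.
apply: (@leq_trans ((i : nat).+1 * #|col|)); last by rewrite leq_mul2r ltn_ord orbT.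
by rewrite /eid mulSnr ltn_add2l ltn_ord.
Qed.

Lemma eid_inj (i i' : 'I_L) c c' : eid i c = eid i' c' -> i = i' /\ c = c'.
Proof.
move=> e; have C0 : 0 < #|col| by apply/card_gt0P; exists c.
have ei : i = i' :> nat.
  have := congr1 (divn^~ #|col|) e.
  by rewrite /eid !divnMDl // !divn_small ?ltn_ord // !addn0.
split; first exact: val_inj.
by move: e; rewrite /eid ei => /addnI /val_inj /enum_rank_inj.
Qed.

Lemma sid_lt (d : bool) (i : 'I_L) : sid d i < 3 * L.
Proof. by have := ltn_ord i; rewrite /sid; case: d; lia. Qed.

Lemma sid_inj (d d' : bool) (i i' : 'I_L) : sid d i = sid d' i' -> d = d' /\ i = i'.
Proof.
have := ltn_ord i; have := ltn_ord i'; rewrite /sid.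
case: d; case: d' => l1 l2 e; split=> //; try apply: val_inj => /=; lia.
Qed.

Lemma sid_cell (d : bool) (i i' : 'I_L) : sid d i <> i'.
Proof. by have := ltn_ord i'; rewrite /sid; lia. Qed.

Lemma cell_le (i : 'I_L) : i <= id_max.
Proof. by have := ltn_ord i; rewrite /id_max; lia. Qed.

Lemma eid_le (i : 'I_L) c : eid i c <= id_max.
Proof. exact: leq_trans (ltnW (eid_lt i c)) (leq_addl _ _). Qed.

Lemma sid_le d (i : 'I_L) : sid d i <= id_max.
Proof. exact: leq_trans (ltnW (sid_lt d i)) (leq_addr _ _). Qed.

Lemma expects_le l k : odflt 0 (expects l k) <= id_max.
Proof.
case: l => i [t|[d c]] /=; first by case: ifP => _; rewrite ?cell_le ?eid_le.
by case: ifP => _ /=; rewrite ?sid_le //; case: ifP => _ //=; rewrite eid_le.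
Qed.

Lemma elem_id_le e : elem_id e <= id_max.
Proof.
case: e => i [[t [[d s]|]]|[[d c] [s|]]]; rewrite /elem_id /=.
- exact: eid_le.
- exact: cell_le.
- exact: eid_le.
- exact: sid_le.
Qed.

Lemma elem_class_lt e : elem_class e < 5.
Proof. by case: e => i [[t [[[] []]|]]|[[[] c] [[]|]]]. Qed.

Lemma digit_le x j : digit x j <= id_max + 20.
Proof.
case: x => [l|e]; rewrite /digit /ld_digit /elem_digit.
  by do 2!(case: ifP => _; first by lia); case: ifP => _; [lia | case: isSome; lia].
case: ifP => _; first by lia.
case: ifP => _; first by case: e => i [[t [[[] []]|]]|[[[] c] [[]|]]]; rewrite /elem_mode /=; try case: ifP; lia.
by case: ifP => // _; case: ifP => _; [have := elem_id_le e; lia | lia].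
Qed.

Section Sound.
Variables (T : finType) (f : item -> T).
Hypothesis fB : forall y, \sum_(x | f x == f y) weight_of x = capacity.

Lemma bin_digits y j : j < 12 -> \sum_(x | f x == f y) digit x j = bin_digit j.
Proof.
move=> j12; apply: (@digit_sums _ (fun x => f x == f y) digit bin_digit base (id_max + 20) 11) j12; last exact: (fB y).
- by move=> [l|e] _; rewrite /digit /ld_digit /elem_digit //= /ld_count; case: (l.2).
- by move=> x j' _; apply: digit_le.
- by move=> j' _; rewrite /bin_digit; do 2!(case: ifP => _; first by lia); case: ifP => _; lia.
- by rewrite /base; lia.
- by rewrite /bin_digit /= /base; lia.
Qed.

Lemma bin_digits2 y j : j < 12 ->
  \sum_(l | f (inl l) == f y) ld_digit l j + \sum_(e | f (inr e) == f y) elem_digit e j = bin_digit j.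
Proof. by move=> /(bin_digits y); rewrite big_sumType. Qed.

(** Without a leader digit 11 demands 20 elements, but the counts of the five classes admit only
    five. *)
Lemma leader_exists y : exists l, f (inl l) = f y.
Proof.
have [/existsP [l /eqP e]|no] := boolP [exists l, f (inl l) == f y]; first by exists l.
have z j : \sum_(l | f (inl l) == f y) ld_digit l j = 0.
  by rewrite big1 // => l e; case/existsP: no; exists l.
have H j : j < 12 -> \sum_(e | f (inr e) == f y) elem_digit e j = bin_digit j.
  by move/(bin_digits2 y); rewrite z.
have e11 := H 11 isT.
have : \sum_(k < 5) \sum_(e | f (inr e) == f y) elem_digit e k.*2 = 5.
  rewrite (eq_bigr (fun k : 'I_5 => bin_digit k.*2)); first by rewrite !big_ord_recr big_ord0.
  by move=> k _; apply: H; have := ltn_ord k; lia.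
rewrite exchange_big /= (eq_bigr (fun e => elem_digit e 11)); first by rewrite e11.
move=> e _; rewrite !big_ord_recr big_ord0 /= /elem_digit /=.
by have := elem_class_lt e; case: (elem_class e) => [|[|[|[|[|]]]]].
Qed.

Lemma leader_uniq l l' : f (inl l) = f (inl l') -> l = l'.
Proof.
move=> e; apply/eqP; apply: contraT => ne.
have := bin_digits2 (inl l') (j := 11) isT.
rewrite (bigD1 l) /=; last by rewrite e.
rewrite (bigD1 l') /=; last by rewrite eqxx eq_sym.
have ge x : 15 <= ld_digit x 11 by rewrite /ld_digit /= /ld_count; case: (x.2).
by have := ge l; have := ge l'; rewrite /bin_digit /=; lia.
Qed.

Lemma elem_sum l j : j < 12 ->
  ld_digit l j + \sum_(e | f (inr e) == f (inl l)) elem_digit e j = bin_digit j.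
Proof.
move=> /(bin_digits2 (inl l)); rewrite (big_pred1 l) // => x.
by apply/eqP/eqP => [/leader_uniq|->].
Qed.

Lemma class_count l k : k < 5 ->
  \sum_(e | f (inr e) == f (inl l)) (k == elem_class e) = isSome (expects l k) :> nat.
Proof.
move=> k5; have := elem_sum l (j := k.*2) ltac:(lia).
rewrite /ld_digit /bin_digit /elem_digit odd_double doubleK.
have -> : (k.*2 == 11) = false by lia.
have -> : (k.*2 == 10) = false by lia.
rewrite (eq_bigr (fun e => nat_of_bool (k == elem_class e))); last by move=> e _; case: ifP.
by case: (expects l k) => //=; rewrite ?add0n // => -[].
Qed.

Lemma class_ids l k : k < 5 ->
  \sum_(e | f (inr e) == f (inl l)) (if k == elem_class e then elem_id e else 0) =
  odflt 0 (expects l k).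
Proof.
move=> k5; have := elem_sum l (j := k.*2.+1) ltac:(lia).
rewrite /ld_digit /bin_digit /elem_digit /= odd_double /= uphalf_double.
have -> : (k.*2.+1 == 11) = false by lia.
have -> : (k.*2.+1 == 10) = false by lia.
by have := expects_le l k; lia.
Qed.

Lemma elem_class_uniq l e e' : f (inr e) = f (inl l) -> f (inr e') = f (inl l) ->
  elem_class e = elem_class e' -> e = e'.
Proof.
move=> fe fe' ec; apply/eqP; apply: contraT => ne.
have := class_count l (elem_class_lt e).
rewrite (bigD1 e) /=; last by rewrite fe.
rewrite (bigD1 e') /=; last by rewrite fe' eqxx eq_sym.
by rewrite ec eqxx; case: isSome; lia.
Qed.

(** A class occurs at most once in a bin, so the sum of its identifiers is the identifier of its
    only element. *)
Lemma elem_expected l e : f (inr e) = f (inl l) -> expects l (elem_class e) = Some (elem_id e).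
Proof.
move=> fe; have := class_count l (elem_class_lt e); have := class_ids l (elem_class_lt e).
rewrite (bigD1 e) /=; last by rewrite fe.
rewrite eqxx big1 ?addn0 => [|e' /andP [/eqP fe' ne]]; last first.
  by case: eqP => // ec; case/eqP: ne; apply: elem_class_uniq fe' fe _.
move=> eid_e; rewrite (bigD1 e) /= ?eqxx; last by rewrite fe.
by case: (expects l _) eid_e => //= x ->.
Qed.

Lemma elem_exists l k : k < 5 -> isSome (expects l k) ->
  exists2 e, f (inr e) = f (inl l) & elem_class e = k.
Proof.
move=> k5 ex; have := class_count l k5; rewrite ex.
have [/existsP [e /andP [/eqP fe /eqP ke]] _|no] :=
  boolP [exists e, (f (inr e) == f (inl l)) && (k == elem_class e)]; first by exists e.
rewrite big1 // => e fe; case: eqP => // ke; case/existsP: no.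
by exists e; rewrite fe ke eqxx.
Qed.

Lemma mode_sum l : \sum_(e | f (inr e) == f (inl l)) elem_mode e = ld_mode l.
Proof.
have := elem_sum l (j := 10) isT; rewrite /ld_digit /bin_digit /elem_digit /= /ld_mode.
by case: (l.2) => [t|d]; lia.
Qed.

(** Applied to a switch that fills the mode alone: it excludes dummies, whose mode is 1, so the edge
    elements beside it are actual. *)
Lemma mode_forced l e e' : f (inr e) = f (inl l) -> f (inr e') = f (inl l) -> e != e' ->
  elem_mode e = ld_mode l -> elem_mode e' = 0.
Proof.
move=> fe fe' ne em; have := mode_sum l.
rewrite (bigD1 e) /=; last by rewrite fe.
rewrite (bigD1 e') /=; last by rewrite fe' eqxx eq_sym.
by rewrite em; lia.
Qed.

(** The tile whose bin receives the switch of [t0] is the chosen tile of the cell. *)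
Lemma cell_leader i : exists t, f (inl (i, inl t)) = f (inr (i, inl (t0, None))).
Proof.
have [[i' [t|[d c]]] e] := leader_exists (inr (i, inl (t0, None))).
  have := elem_expected (esym e); rewrite /elem_class /elem_id /= => -[/val_inj ei].
  by subst i'; exists t.
by have := elem_expected (esym e); rewrite /elem_class /elem_id /= => -[/sid_cell].
Qed.

(** The switch of [c0], of mode 0, marks the colour of the edge; every other colour gets a switch of
    mode 2 and must absorb its actual elements. *)
Lemma edge_leader d i : exists c, f (inl (i, inr (d, c))) = f (inr (i, inr (d, c0, None))).
Proof.
have [[i' [t|[d' c]]] e] := leader_exists (inr (i, inr (d, c0, None))).
  by have := elem_expected (esym e); rewrite /elem_class /elem_id /= => -[/esym /sid_cell].
have := elem_expected (esym e); rewrite /elem_class /elem_id /= => -[/sid_inj [ed ei]].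
by subst d' i'; exists c.
Qed.

Lemma cls_lt d s : cls d s < 5. Proof. by case: d; case: s. Qed.
Lemma cls_dirK d s : cls_dir (cls d s) = d. Proof. by case: d; case: s. Qed.
Lemma cls_sideK d s : cls_side (cls d s) = s. Proof. by case: d; case: s. Qed.
Lemma cls_neq0 d s : (cls d s == 0) = false. Proof. by case: d; case: s. Qed.
Lemma cls_inj d s d' s' : cls d s = cls d' s' -> d = d' /\ s = s'.
Proof. by case: d; case: s; case: d'; case: s'. Qed.

Lemma actual_elem l sw d s (i' : 'I_L) c : f (inr sw) = f (inl l) -> elem_class sw = 0 ->
  elem_mode sw = ld_mode l -> expects l (cls d s) = Some (eid i' c) ->
  f (inr (i', inr (d, c, Some s))) = f (inl l).
Proof.
move=> fsw ksw msw ex.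
have [|e fe ke] := @elem_exists l (cls d s) (cls_lt d s); first by rewrite ex.
have ne : sw != e by apply: contraNneq (negbT (cls_neq0 d s)) => es; rewrite -ke -es ksw.
have m0 := mode_forced fsw fe ne msw.
have := elem_expected fe; rewrite ke ex.
case: e fe ke ne m0 => j [[t [[d' s']|]]|[[d' c'] [s'|]]] fe ke ne m0; rewrite /elem_id /=.
- by move: m0; rewrite /elem_mode.
- by have := cls_neq0 d s; rewrite -ke.
- move=> -[/eid_inj [-> ->]]; rewrite -fe.
  by have [-> ->] := cls_inj ke.
- by have := cls_neq0 d s; rewrite -ke.
Qed.

(** An actual element exists only once. The chosen tile holds those of its own colours, and the bins
    of an edge hold those of every colour but [c]; hence the tiles at both ends show [c]. *)
Lemma packing_tiling : exists tau : 'I_L -> tile,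
  forall d i, out d i (tau i) = inn d (tau (sh d i)).
Proof.
have [tau Ht] := fin_all_exists cell_leader.
exists tau => d i; have [c Hc] := edge_leader d i.
have R1 i' s : f (inr (i', inr (d, tcol i' (tau i') d s, Some s))) = f (inl (i', inl (tau i'))).
  apply: (actual_elem (sw := (i', inl (t0, None)))) => //.
    by rewrite /elem_mode /= eqxx.
  by rewrite /expects cls_neq0 cls_dirK cls_sideK.
have R2 c' s : c' != c -> f (inr ((if s then sh d i else i), inr (d, c', Some s))) = f (inl (i, inr (d, c'))).
  move=> nc; have [|sw fsw ksw] := @elem_exists (i, inr (d, c')) 0 isT; first by [].
  apply: (actual_elem fsw ksw); last first.
    by rewrite /expects cls_neq0 cls_dirK cls_sideK eqxx.
  have := elem_expected fsw; rewrite ksw /=; case: sw fsw ksw => j [[t [[[] []]|]]|[[d' c''] [[]|]]] //=.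
  - by rewrite /elem_id /= => _ _ [/sid_cell].
  move=> fsw _; rewrite /elem_id /= => -[/sid_inj [ed ei]]; rewrite /elem_mode /=.
  (* Only the switch of [c0] falls short of mode 2, and it lies in the bin of [c]. *)
  case: eqP => // ec; move: fsw; rewrite ec -ed -ei -Hc => /leader_uniq [e'].
  by rewrite e' eqxx in nc.
have H s : tcol (if s then sh d i else i) (tau (if s then sh d i else i)) d s = c.
  apply/eqP; apply: contraT => nc; have := R2 _ s nc; rewrite R1 => /leader_uniq.
  by case.
by rewrite [LHS](H false) -(H true).
Qed.

End Sound.

(** * From a tiling to a packing *)

Section Complete.
Variable tau : 'I_L -> tile.
Hypothesis tauP : forall d i, out d i (tau i) = inn d (tau (sh d i)).

(** A transposition of the switches: that of [t0] moves to the chosen tile, and every bin still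
    receives exactly one. *)
Definition swap (X : eqType) (x y z : X) := if z == x then y else if z == y then x else z.

Definition assign (x : item) : ld :=
  match x with
  | inl l => l
  | inr (i, inl (t, None)) => (i, inl (swap t0 (tau i) t))
  | inr (i, inl (t, Some (d, s))) =>
      if t == tau i then ((if s then sh' d i else i), inr (d, tcol i t d s)) else (i, inl t)
  | inr (i, inr (d, c, None)) => (i, inr (d, swap c0 (out d i (tau i)) c))
  | inr (i, inr (d, c, Some s)) =>
      if c == tcol i (tau i) d s then (i, inl (tau i)) else ((if s then sh' d i else i), inr (d, c))
  end.

(** A chosen tile takes the actual element and any other tile its own dummy. The dummies released by
    chosen tiles go to the bins of the chosen colours, through [colour_edge]. *)
Definition tile_edge (i : 'I_L) (t : tile) (d s : bool) : item :=
  inr (if t == tau i then (i, inr (d, tcol i t d s, Some s)) else (i, inl (t, Some (d, s)))).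

Definition colour_edge (i : 'I_L) (c : col) (d s : bool) : item :=
  let i' := if s then sh d i else i in
  inr (if c == tcol i' (tau i') d s then (i', inl (tau i', Some (d, s))) else (i', inr (d, c, Some s))).

Definition bin_items (l : ld) : seq item :=
  match l with
  | (i, inl t) => [:: inl l; inr (i, inl (swap t0 (tau i) t, None));
                      tile_edge i t false false; tile_edge i t false true;
                      tile_edge i t true false; tile_edge i t true true]
  | (i, inr (d, c)) => [:: inl l; inr (i, inr (d, swap c0 (out d i (tau i)) c, None));
                      colour_edge i c d false; colour_edge i c d true]
  end.

Lemma swapK (X : eqType) (x y : X) : involutive (swap x y).
Proof.
move=> z; rewrite /swap; have [->|zx] := eqVneq z x.
  by have [->|] := eqVneq y x; rewrite ?eqxx.
have [->|zy] := eqVneq z y; first by rewrite eqxx.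
by rewrite (negbTE zx) (negbTE zy).
Qed.

Lemma swap_eq (X : eqType) (x y z : X) : (swap x y z == x) = (z == y).
Proof.
rewrite /swap; have [->|zx] := eqVneq z x; first by rewrite eq_sym.
by case: (z =P y) => _; rewrite ?eqxx // (negbTE zx).
Qed.

Lemma assign_tile_edge i t d s : assign (tile_edge i t d s) = (i, inl t).
Proof.
by rewrite /tile_edge; case: eqP => [->|ne]; rewrite /= ?eqxx //; case: eqP.
Qed.

Lemma assign_colour_edge i c d s : assign (colour_edge i c d s) = (i, inr (d, c)).
Proof.
by rewrite /colour_edge; case: ifP => H; rewrite /= ?eqxx ?H; case: s H; rewrite ?shK // => /eqP ->.
Qed.

Lemma mem_assign x : x \in bin_items (assign x).
Proof.
case: x => [[i [t|[d c]]]|[i [[t [[d s]|]]|[[d c] [s|]]]]]; rewrite /assign ?inE ?eqxx //.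
- case: eqP => [->|/eqP ne].
    have H : inr (i, inl (tau i, Some (d, s))) =
             colour_edge (if s then sh' d i else i) (tcol i (tau i) d s) d s.
      by rewrite /colour_edge; case: s; rewrite ?shK' eqxx.
    by rewrite H /bin_items; case: (s); rewrite !inE eqxx ?orbT.
  have -> : inr (i, inl (t, Some (d, s))) = tile_edge i t d s by rewrite /tile_edge (negbTE ne).
  by case: d; case: s; rewrite /bin_items !inE eqxx ?orbT.
- by rewrite swapK eqxx ?orbT.
- case: eqP => [->|/eqP ne].
    have -> : inr (i, inr (d, tcol i (tau i) d s, Some s)) = tile_edge i (tau i) d s by rewrite /tile_edge eqxx.
    by case: d; case: s; rewrite /bin_items !inE eqxx ?orbT.
  have H : inr (i, inr (d, c, Some s)) = colour_edge (if s then sh' d i else i) c d s.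
    by rewrite /colour_edge; case: s ne; rewrite ?shK' => /negbTE ->.
  by rewrite H /bin_items; case: (s); rewrite !inE eqxx ?orbT.
- by rewrite swapK eqxx ?orbT.
Qed.

(** Turns a sum over a fibre of [assign] into a sum over an explicit list of six or four items. *)
Lemma mem_bin_items l x : (x \in bin_items l) = (assign x == l).
Proof.
apply/idP/eqP => [|<-]; last exact: mem_assign.
case: l => i [t|[d c]]; rewrite /bin_items !inE.
  case/orP=> [/eqP ->//|]; case/orP=> [/eqP -> /=|]; first by rewrite swapK.
  by case/or4P=> /eqP ->; rewrite assign_tile_edge.
case/orP=> [/eqP ->//|]; case/orP=> [/eqP -> /=|]; first by rewrite swapK.
by case/orP=> /eqP ->; rewrite assign_colour_edge.
Qed.

Lemma class_tile_edge i t d s : exists2 e, tile_edge i t d s = inr e & elem_class e = cls d s.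
Proof. by rewrite /tile_edge; case: ifP => _; (eexists; first reflexivity). Qed.

Lemma class_colour_edge i c d s : exists2 e, colour_edge i c d s = inr e & elem_class e = cls d s.
Proof. by rewrite /colour_edge; case: ifP => _; (eexists; first reflexivity). Qed.

Lemma bin_items_uniq l : uniq (bin_items l).
Proof.
pose cl (x : item) := if x is inr e then elem_class e else 9.
apply: (@map_uniq _ _ cl); case: l => i [t|[d c]]; rewrite /bin_items !map_cons.
  have H d s : cl (tile_edge i t d s) = cls d s by have [e -> <-] := class_tile_edge i t d s.
  by rewrite !H.
have H s : cl (colour_edge i c d s) = cls d s by have [e -> <-] := class_colour_edge i c d s.
by rewrite !H; case: d {H}.
Qed.

(** An actual element and the dummy that it replaces share class and identifier; they differ only in
    the mode [m]. *)
Definition edig (k id m j : nat) := if j == 11 then 1 else if j == 10 then m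
  else if j./2 == k then (if odd j then id else 1) else 0.

Lemma digit_tile_edge i t d s j :
  digit (tile_edge i t d s) j = edig (cls d s) (eid i (tcol i t d s)) (t != tau i) j.
Proof. by rewrite /tile_edge; case: eqP. Qed.

Lemma digit_colour_edge i c d s j :
  digit (colour_edge i c d s) j =
  edig (cls d s) (eid (if s then sh d i else i) c) (c == out d i (tau i)) j.
Proof.
have H : (c == tcol (if s then sh d i else i) (tau (if s then sh d i else i)) d s) = (c == out d i (tau i)).
  by rewrite tauP /tcol; case: s; rewrite ?tauP.
rewrite /colour_edge H; case: eqP => // e; rewrite /digit /elem_digit /elem_class /elem_id /elem_mode /=.
by rewrite /edig e tauP /tcol; case: s H; rewrite ?tauP.
Qed.

Lemma bin_items_digits l j : j < 12 -> \sum_(x <- bin_items l) digit x j = bin_digit j.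
Proof.
case: l => i [t|[d c]] j12; rewrite /bin_items !big_cons big_nil.
  have lc := cell_le i; have := eid_le i (out false i t); have := eid_le i (inn false t).
  have := eid_le i (out true i t); have := eid_le i (inn true t).
  rewrite !digit_tile_edge /digit /ld_digit /elem_digit /elem_class /elem_id /elem_mode /=.
  rewrite swap_eq /ld_count /ld_mode /bin_digit /edig /=.
  by case: (t == tau i); move: j12; do 12!(case: j => [|j];
    first by rewrite /tcol /cls_dir /cls_side /=; lia).
have := sid_le d i; have := eid_le i c; have := eid_le (sh d i) c.
rewrite !digit_colour_edge /digit /ld_digit /elem_digit /elem_class /elem_id /elem_mode /=.
rewrite swap_eq /ld_count /ld_mode /bin_digit /edig /=.
by case: (c == _); case: d; move: j12; do 12!(case: j => [|j];
  first by rewrite /cls_dir /cls_side /=; lia).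
Qed.

Lemma tiling_packing : packable weight_of capacity.
Proof.
exists ld, assign => y.
rewrite (eq_bigl [in bin_items (assign y)]) => [|x]; last by rewrite /= mem_bin_items.
rewrite -big_uniq ?bin_items_uniq //= /weight_of /number exchange_big /=.
rewrite /capacity /number; apply: eq_bigr => j _.
by rewrite -big_distrl /= bin_items_digits.
Qed.

End Complete.

Theorem tiling_packable : packable weight_of capacity <->
  exists tau : 'I_L -> tile, forall d i, out d i (tau i) = inn d (tau (sh d i)).
Proof.
split; first by case=> T [f fB]; apply: packing_tiling fB.
by case=> tau tauP; apply: tiling_packing tauP.
Qed.

Lemma weight_gt0 x : 0 < weight_of x.
Proof.
rewrite /weight_of /number big_ord_recr /= addn_gt0; apply/orP; right.
rewrite muln_gt0 expn_gt0 /base; apply/andP; split; last by lia.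
by case: x => [l|e]; rewrite /digit /ld_digit /elem_digit //= /ld_count; case: (l.2).
Qed.

(** The top digit of an item is at most 17 against 20 for the capacity, and its lower digits amount
    to less than one unit of the top digit. *)
Lemma weight_le x : weight_of x <= capacity.
Proof.
have le j : j < 11 -> digit x j < base.
  by move=> _; apply: leq_ltn_trans (digit_le x j) _; rewrite /base; lia.
have lt := digits_lt le; rewrite /weight_of /capacity /number [X in X <= _]big_ord_recr /=.
rewrite [X in _ <= X]big_ord_recr /=; apply: leq_trans (leq_addl _ _).
have d17 : digit x 11 <= 17.
  by case: x {le lt} => [l|e]; rewrite /digit /ld_digit /elem_digit //= /ld_count; case: (l.2).
apply: (@leq_trans (base ^ 11 + 17 * base ^ 11)); first by apply: leq_add; [exact: ltnW | rewrite leq_mul2r d17 orbT].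
by rewrite -mulSn leq_mul2r orbT.
Qed.

End Tiling.

(** * Computation tableaux *)
Section Rows.
Variable M : TM.

Definition state : finType := 'I_(tm_n M).+1.
Definition cell : finType := (option bool * option state)%type.
Definition blank : cell := (None, None).

Definition sym_at (c : config M) (h x : nat) : option bool :=
  if x < h then nth None (c_left c) (h - x).-1
  else if x == h then c_head c else nth None (c_right c) (x - h).-1.

Definition cell_at (c : config M) (h x : nat) : cell :=
  (sym_at c h x, if x == h then Some (c_state c) else None).

(** A halted head acts by staying and rewriting its symbol, so rows repeat after halting. *)
Definition act (u : cell) : option (state * option bool * dir) :=
  if u.2 is Some q then
    Some (if q == tm_halt M then (q, u.1, DStay) else tm_delta q u.1)
  else None.

Definition phi (l m r : cell) : cell :=
  (if act m is Some (_, s, _) then s else m.1,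
   if act m is Some (q, _, DStay) then Some q
   else if act l is Some (q, _, DRight) then Some q
   else if act r is Some (q, _, DLeft) then Some q else None).

Definition head_step (c : config M) (h : nat) : nat :=
  if c_state c == tm_halt M then h else
  match (tm_delta (c_state c) (c_head c)).2 with
  | DLeft => h.-1 | DRight => h.+1 | DStay => h end.

Definition left_of (f : nat -> cell) (x : nat) : cell := if x is x'.+1 then f x' else blank.

Lemma sym_at_head c h : sym_at c h h = c_head c.
Proof. by rewrite /sym_at ltnn eqxx. Qed.

Lemma act_cell_at c h x : act (cell_at c h x) =
  if x == h then Some (if c_state c == tm_halt M then (c_state c, c_head c, DStay)
                       else tm_delta (c_state c) (c_head c)) else None.
Proof. by rewrite /act /cell_at /=; case: eqP => [->|//]; rewrite sym_at_head. Qed.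

Lemma act_left_of c h x : act (left_of (cell_at c h) x) =
  if x == h.+1 then Some (if c_state c == tm_halt M then (c_state c, c_head c, DStay)
                       else tm_delta (c_state c) (c_head c)) else None.
Proof. by case: x => [|x] //=; rewrite act_cell_at eqSS. Qed.

(** A positive head position makes [h.-1] the position to its left. *)
Lemma phi_cell_at c h x : 0 < h ->
  cell_at (step c) (head_step c h) x =
  phi (left_of (cell_at c h) x) (cell_at c h x) (cell_at c h x.+1).
Proof.
move=> h0; rewrite /phi !act_cell_at act_left_of /head_step /step.
case: ifP => [_|nh].
  rewrite /cell_at; case: eqP => [->|ne]; first by rewrite sym_at_head.
  by do 2!case: ifP => // _.
case: (tm_delta (c_state c) (c_head c)) => [[q s] []]; rewrite /cell_at /sym_at /=.
- case: (ltngtP x h) => [lt|gt|->].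
  + have -> : (x.+1 == h) = (x == h.-1) by apply/eqP/eqP; lia.
    have -> : (x == h.+1) = false by lia.
    case: (ltngtP x h.-1) => [lt'|gt'|ex]; [|lia|rewrite ex].
      by rewrite nth_behead; congr (nth _ _ _, _); lia.
    by have -> : (h - h.-1).-1 = 0 by lia; rewrite nth0.
  + have -> : (x < h.-1) = false by lia.
    have -> : (x == h.-1) = false by lia.
    have -> : (x.+1 == h) = false by lia.
    have -> : (x - h.-1).-1 = (x - h).-1.+1 by lia.
    by case: eqP.
  + have -> : (h < h.-1) = false by lia.
    have -> : (h == h.-1) = false by lia.
    have -> : (h - h.-1).-1 = 0 by lia.
    have -> : (h.+1 == h) = false by lia.
    by have -> : (h == h.+1) = false by lia.
- case: (ltngtP x h) => [lt|gt|->].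
  + have -> : x < h.+1 by lia.
    have -> : (x == h.+1) = false by lia.
    have -> : (h.+1 - x).-1 = (h - x).-1.+1 by lia.
    by case: eqP.
  + case: (ltngtP x h.+1) => [lt'|gt'|ex]; [lia| |rewrite ?ex].
      by rewrite nth_behead; case: eqP => [|_]; [lia|]; congr (nth _ _ _, _); lia.
    by have -> : (h.+1 - h).-1 = 0 by lia; rewrite nth0.
  + rewrite ltnSn subSnn /=.
    have -> : (h == h.+1) = false by lia.
    by have -> : (h.+1 == h) = false by lia.
- case: (ltngtP x h) => [lt|gt|_] //.
  + by do 2!case: eqP => _.
  + by do 2!case: eqP => _.
Qed.

Section Run.
Variables (z : seq bool) (O : nat).

Fixpoint head_pos (t : nat) : nat := if t is t'.+1 then head_step (run M t' z) (head_pos t') else O.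

Definition row (t x : nat) : cell := cell_at (run M t z) (head_pos t) x.

Lemma head_step_le c h : h.-1 <= head_step c h <= h.+1.
Proof. by rewrite /head_step; case: ifP => _; [lia | case: (_.2); lia]. Qed.

Lemma head_pos_bound t : O - t <= head_pos t <= O + t.
Proof.
elim: t => [|t IH] /=; first by lia.
by have := head_step_le (run M t z) (head_pos t); lia.
Qed.

Lemma rowS t x : t < O -> row t.+1 x = phi (left_of (row t) x) (row t x) (row t x.+1).
Proof.
move=> tO; have h0 : 0 < head_pos t by have := head_pos_bound t; lia.
exact: (@phi_cell_at (run M t z) (head_pos t) x h0).
Qed.

Lemma row0 x : row 0 x = ((if x < O then None else nth None (map Some z) (x - O)),
                          if x == O then Some (tm_start M) else None).
Proof.
rewrite /row /cell_at /sym_at /run /=; congr (_, _); case: (ltngtP x O) => [lt|gt|->].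
- by rewrite nth_nil.
- by rewrite nth_behead; congr (nth _ _ _); lia.
- by rewrite subnn nth0.
Qed.

(** The head moves by at most one position per step, so it has not been near [x] yet. *)
Lemma row_left t x : t <= O -> x + t < O -> row t x = blank.
Proof.
elim: t x => [|t IH] x tO lt.
  have ne : (x == O) = false by lia.
  by rewrite row0 ne ifT //; lia.
rewrite rowS // !IH; try lia.
by case: x lt => [|x] lt //=; rewrite IH //; lia.
Qed.

Lemma row_right t x : t <= O -> O + t < x -> O + size z <= x -> row t x = blank.
Proof.
elim: t x => [|t IH] x tO lt le.
  have ne : (x == O) = false by lia.
  by rewrite row0 ne ifF; [rewrite nth_default // size_map; lia | lia].
rewrite rowS // !IH; try lia.
case: x lt le => [|x] lt le //=; case: (leqP (O + size z) x) => c; first by rewrite IH //; lia.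
by rewrite /phi act_cell_at; case: eqP => [e|//]; have := head_pos_bound t; lia.
Qed.

(** Acceptance concerns only the head cell and its right neighbour, so a single tile of the last row
    can test it. *)
Lemma row_accept t : (output (run M t z) == [:: true]) =
  ((row t (head_pos t)).1 == Some true) && ((row t (head_pos t).+1).1 == None).
Proof.
rewrite /row /cell_at /= sym_at_head /sym_at /output.
have -> : ((head_pos t).+1 < head_pos t) = false by lia.
have -> : ((head_pos t).+1 == head_pos t) = false by lia.
have -> : ((head_pos t).+1 - head_pos t).-1 = 0 by lia.
case: (c_head _) => [b|] //=.
by case: (c_right _) => [|[c|] s] /=; case: b.
Qed.

End Run.
End Rows.

(** Used to read the certificate off the first row of a tiling. *)
Lemma option_word (g : nat -> option bool) Y :
  (forall j, j.+1 < Y -> g j = None -> g j.+1 = None) ->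
  exists2 y, size y <= Y & forall j, j < Y -> g j = nth None (map Some y) j.
Proof.
elim: Y g => [|Y IH] g H; first by exists [::].
case e: (g 0) => [b|].
  have [j jY|y sy Hy] := IH (g \o succn); first by apply: H.
  by exists (b :: y) => // -[|j] jY //=; apply: Hy.
exists [::] => // j jY; rewrite nth_nil.
by elim: j jY => // j IHj jY; apply: H => //; apply: IHj; lia.
Qed.

Lemma size_pair_enc (w y : seq bool) : size (pair_enc w y) = 2 * size w + 2 + size y.
Proof.
rewrite /pair_enc !size_cat; have -> : size (flatten [seq [:: true; b] | b <- w]) = 2 * size w.
  by elim: w => //= b s ->; rewrite mulnS.
by rewrite -addnA.
Qed.

Section Tableau.
Variable M : TM.
Variables (w : seq bool) (T Y : nat).
Let n := size w.
Hypothesis fit : 2 * n + 2 + Y <= T.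

(** The cells at left, middle and right at one time, and the middle cell one step later. *)
Definition tile : finType := (cell M * cell M * cell M * cell M)%type.
Definition t_l (u : tile) := u.1.1.1.
Definition t_m (u : tile) := u.1.1.2.
Definition t_r (u : tile) := u.1.2.
Definition t_b (u : tile) := u.2.

(** Within [T] steps a head that starts at [T + 1] stays between 1 and [2 T + 1], so the border
    positions 0 and [2 T + 2] remain blank. *)
Definition width := 2 * T + 3.
Definition area := T.+1 * width.
Definition origin := T.+1.

(** Bit [e] of [pair_enc w y] before the certificate: [true] in even places and [w] in odd places,
    then two [false]. *)
Definition prefix_bit (e : nat) : bool := (e < 2 * n) && (~~ odd e || nth false w e./2).

(** Here [b] is the symbol to the right of [a]. On the [Y] places of the certificate symbols are
    free, except that a blank is followed by a blank. *)
Definition init_sym (p : nat) (a b : option bool) : bool :=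
  if p < origin then a == None
  else if p < origin + (2 * n + 2) then a == Some (prefix_bit (p - origin))
  else if p < origin + (2 * n + 2) + Y then (a == None) ==> (b == None)
  else a == None.

Definition allowed (t p : nat) (u : tile) : bool :=
  [&& (t < T) ==> (t_b u == phi (t_l u) (t_m u) (t_r u)),
      (t == 0) ==> ((t_m u).2 == if p == origin then Some (tm_start M) else None) &&
                   init_sym p (t_m u).1 (t_r u).1,
      (t == T) ==> (isSome (t_m u).2 ==> ((t_m u).1 == Some true) && ((t_r u).1 == None)),
      (p == 0) ==> (t_l u == blank M) & (p == width.-1) ==> (t_r u == blank M)].

(** The end of a row is followed by the start of the next, and row [T] by row 0. The blank borders
    make the first wrap consistent; for the second, [allowed] leaves [t_b] free on row [T]. *)
Definition tiling (tau : nat -> tile) : Prop :=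
  forall i, i < area -> [/\ allowed (i %/ width) (i %% width) (tau i),
    (t_m (tau i), t_r (tau i)) = (t_l (tau ((i + 1) %% area)), t_m (tau ((i + 1) %% area))) &
    t_b (tau i) = t_m (tau ((i + width) %% area))].

Lemma width_gt0 : 0 < width. Proof. by rewrite /width; lia. Qed.

Lemma idx_div t p : p < width -> (t * width + p) %/ width = t.
Proof. by move=> lt; rewrite divnMDl ?width_gt0 // divn_small // addn0. Qed.

Lemma idx_mod t p : p < width -> (t * width + p) %% width = p.
Proof. by move=> lt; rewrite modnMDl modn_small. Qed.

Lemma idx_lt t p : t <= T -> p < width -> t * width + p < area.
Proof.
move=> tT lt; apply: (@leq_trans (t.+1 * width)); first by rewrite mulSnr ltn_add2l.
by rewrite leq_mul2r ltnS tT orbT.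
Qed.

Lemma nth_prefix y e : e < 2 * n + 2 -> nth None (map Some (pair_enc w y)) e = Some (prefix_bit e).
Proof.
rewrite /prefix_bit /n /pair_enc; elim: w e => [|c s IH] [|[|e]] lt;
  try (by rewrite /= mul2n ?doubleS); try (by []).
rewrite /= in lt *; rewrite IH; last by lia.
by rewrite negbK; congr (Some (_ && _)); lia.
Qed.

Lemma nth_suffix y j : nth None (map Some (pair_enc w y)) (2 * n + 2 + j) = nth None (map Some y) j.
Proof.
rewrite /pair_enc catA map_cat nth_cat size_map.
have -> : size (flatten [seq [:: true; b] | b <- w] ++ [:: false; false]) = 2 * n + 2.
  by have := size_pair_enc w [::]; rewrite /pair_enc cats0 addn0.
by rewrite ltnNge leq_addr /= addKn.
Qed.

Lemma init_sym_row y p : size y <= Y -> p < width ->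
  init_sym p (row M (pair_enc w y) origin 0 p).1 (row M (pair_enc w y) origin 0 p.+1).1.
Proof.
move=> sy pw; rewrite /init_sym !row0 /=; case: ltnP => [//|ge].
case: ltnP => [lt|ge2]; first by rewrite nth_prefix //; lia.
have -> : (p.+1 < origin) = false by lia.
have -> : p - origin = 2 * n + 2 + (p - origin - (2 * n + 2)) by lia.
have -> : p.+1 - origin = 2 * n + 2 + (p - origin - (2 * n + 2)).+1 by lia.
rewrite !nth_suffix; case: ifP => [lt|ge3].
  apply/implyP; move: (p - origin - (2 * n + 2)) => j.
  by elim: y j {sy} => [|b y IH] [|j] //=; apply: IH.
by rewrite nth_default // size_map; lia.
Qed.

Variable b : seq bool -> bool.
Hypothesis b_ok : forall y, size y <= Y -> output (run M T (pair_enc w y)) = [:: b (pair_enc w y)].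

Lemma tiling_complete y : size y <= Y -> b (pair_enc w y) -> exists tau, tiling tau.
Proof.
move=> sy by_; pose rw t p := row M (pair_enc w y) origin t p.
have sz := size_pair_enc w y.
have R0 t p : t <= T -> p < width -> (p == 0) || (p == width.-1) -> rw t p = blank M.
  move=> tT pw /orP [/eqP ->|/eqP ->]; first by apply: row_left; rewrite /origin; lia.
  by apply: row_right; rewrite /origin /width; lia.
pose tau i : tile := let t := i %/ width in let p := i %% width in
  (left_of (rw t) p, rw t p, rw t p.+1, if t < T then rw t.+1 p else rw 0 p).
exists tau => i lti.
have [t [p [ei pw tT]]] : exists t p, [/\ i = t * width + p, p < width & t <= T].
  exists (i %/ width), (i %% width); split; first exact: divn_eq.
    by rewrite ltn_mod width_gt0.
  by rewrite -ltnS ltn_divLR ?width_gt0.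
have Rw : rw t width = blank M by apply: row_right; rewrite /origin /width; lia.
have tauE t' p' : p' < width -> tau (t' * width + p') =
    (left_of (rw t') p', rw t' p', rw t' p'.+1, if t' < T then rw t'.+1 p' else rw 0 p').
  by move=> lt; rewrite /tau idx_div // idx_mod.
have dE : i %/ width = t by rewrite ei idx_div.
have mE : i %% width = p by rewrite ei idx_mod.
have E := tauE t p pw; rewrite -ei in E; rewrite dE mE E; split.
- rewrite /allowed /t_b /t_l /t_m /t_r; cbn [fst snd]; apply/and5P; split; apply/implyP.
  + by move=> lt; rewrite lt /rw rowS // /origin; lia.
  + by move=> /eqP ->; rewrite /rw init_sym_row // row0 /= eqxx.
  + move=> /eqP ->; apply/implyP; rewrite {1}/rw {1}/row {1}/cell_at; cbn [fst snd].
    case: eqP => // eh _; have := row_accept M (pair_enc w y) origin T.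
    by rewrite b_ok // by_ eqxx -eh => /esym.
  + by move/eqP ->.
  + by move/eqP => ep; rewrite ep prednK ?width_gt0 // Rw.
- rewrite /t_m /t_r /t_l; cbn [fst snd]; have [e|ne] := eqVneq p width.-1.
    have e1 : i + 1 = t.+1 * width + 0 by rewrite ei e mulSnr /width; lia.
    have [t' [t'T e2]] : exists t', t' <= T /\ (i + 1) %% area = t' * width + 0.
      case: (ltngtP t T) => [lt||eT]; [|lia|].
        by exists t.+1; rewrite e1 modn_small // idx_lt ?width_gt0.
      by exists 0; rewrite e1 eT addn0 modnn.
    rewrite e2 tauE ?width_gt0 //; cbn [fst snd]; rewrite (R0 t p) // ?e ?eqxx ?orbT // -e.
    have -> : p.+1 = width by rewrite e prednK ?width_gt0.
    by rewrite Rw R0 ?width_gt0.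
  have lt : p.+1 < width by move: ne pw; rewrite /width; lia.
  have e1 : i + 1 = t * width + p.+1 by rewrite {1}ei; lia.
  by rewrite e1 modn_small ?idx_lt // tauE.
- rewrite /t_b /t_m; cbn [fst snd]; case: ltnP => [lt|ge].
    have e1 : i + width = t.+1 * width + p by rewrite {1}ei mulSn; lia.
    by rewrite e1 modn_small ?idx_lt // tauE.
  have e1 : i + width = area + (0 * width + p).
    have eT : t = T by apply/eqP; rewrite eqn_leq tT.
    by rewrite ei eT /area mulSn mul0n add0n addnAC [_ + width]addnC.
  by rewrite e1 modnDl modn_small ?idx_lt // tauE.
Qed.

Lemma tiling_sound tau : tiling tau -> exists2 y, size y <= Y & b (pair_enc w y).
Proof.
move=> H; pose u t p := tau (t * width + p).
have Ha t p : t <= T -> p < width -> allowed t p (u t p).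
  by move=> tT pw; have [] := H _ (idx_lt tT pw); rewrite idx_div // idx_mod.
have Hh t p : t <= T -> p.+1 < width -> t_r (u t p) = t_m (u t p.+1) /\ t_l (u t p.+1) = t_m (u t p).
  move=> tT pw; have [_ + _] := H _ (idx_lt tT (ltnW pw)).
  by rewrite -addnA addn1 modn_small ?idx_lt // => -[-> ->].
have Hv t p : t < T -> p < width -> t_b (u t p) = t_m (u t.+1 p).
  move=> tT pw; have [_ _] := H _ (idx_lt (ltnW tT) pw).
  have -> : t * width + p + width = t.+1 * width + p by rewrite mulSn; lia.
  by rewrite modn_small ?idx_lt.
have O_w : origin + (2 * n + 2) + Y < width by rewrite /origin /width; lia.
have [|y sy Hy] := @option_word (fun j => (t_m (u 0 (origin + (2 * n + 2) + j))).1) Y.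
  move=> j jY e; have pw : (origin + (2 * n + 2) + j).+1 < width by lia.
  have /and5P [_ /implyP /(_ isT) /andP [_]] := Ha 0 _ (leq0n T) (ltnW pw).
  rewrite /init_sym; have [-> _] := Hh 0 _ (leq0n T) pw.
  have -> : (origin + (2 * n + 2) + j < origin) = false by lia.
  have -> : (origin + (2 * n + 2) + j < origin + (2 * n + 2)) = false by lia.
  have -> : (origin + (2 * n + 2) + j < origin + (2 * n + 2) + Y) by lia.
  by move/implyP/(_ (introT eqP e))/eqP; rewrite [_ + j.+1]addnS.
exists y => //; set z := pair_enc w y; have sz : size z = 2 * n + 2 + size y := size_pair_enc w y.
(* The tiles are forced to show the run on [pair_enc w y]: row 0 by the initial conditions, later
   rows by the local rule. *)
have R t p : t <= T -> p < width -> t_m (u t p) = row M z origin t p.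
  elim: t p => [|t IH] p tT pw.
    rewrite row0; have /and5P [_ /implyP /(_ isT) /andP [/eqP e1]] := Ha 0 p tT pw.
    rewrite /init_sym; move: e1; case: (ltnP p origin) => [lt|ge] e1.
      by case: (t_m _) e1 => s q /= -> /eqP ->.
    case: ltnP => [lt|ge2].
      by rewrite nth_prefix; [case: (t_m _) e1 => s q /= -> /eqP -> | lia].
    have -> : p - origin = 2 * n + 2 + (p - origin - (2 * n + 2)) by lia.
    rewrite nth_suffix; case: ifP => [lt _|ge3].
      rewrite -Hy; last by lia.
      have -> : origin + (2 * n + 2) + (p - origin - (2 * n + 2)) = p by lia.
      by case: (t_m _) e1 => s q /= ->.
    rewrite nth_default; last by rewrite size_map; lia.
    by case: (t_m _) e1 => s q /= -> /eqP ->.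
  rewrite -Hv //; have /and5P [/implyP /(_ tT) /eqP -> _ _ /implyP H0 /implyP H1] := Ha t p (ltnW tT) pw.
  rewrite rowS; last by rewrite /origin; lia.
  rewrite (IH p (ltnW tT) pw).
  have -> : t_l (u t p) = left_of (row M z origin t) p.
    case: p pw H0 {H1} => [|p] pw H0; first exact/eqP/H0.
    by have [_ ->] := Hh t p (ltnW tT) pw; rewrite IH //; lia.
  have -> // : t_r (u t p) = row M z origin t p.+1.
  have [e|ne] := eqVneq p width.-1.
    rewrite row_right; [by apply/eqP/H1/eqP | by rewrite /origin; lia | |]; by rewrite e /origin /width; lia.
  have lt : p.+1 < width by move: ne pw; rewrite /width; lia.
  by have [-> _] := Hh t p (ltnW tT) lt; rewrite IH //; lia.
have hb := head_pos_bound M z origin T.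
have hw : (head_pos M z origin T).+1 < width by move: hb; rewrite /origin /width; lia.
have /and5P [_ _ /implyP /(_ (eqxx T))] := Ha T _ (leqnn T) (ltnW hw).
have [-> _] := Hh T _ (leqnn T) hw; rewrite !R ?(ltnW hw) // {1}/row /cell_at /= eqxx /=.
by rewrite -row_accept /z b_ok //; case: (b _).
Qed.

Theorem tiling_correct : (exists2 y, size y <= Y & b (pair_enc w y)) <-> exists tau, tiling tau.
Proof.
split; first by case=> y; apply: tiling_complete.
by case=> tau; apply: tiling_sound.
Qed.

End Tableau.

(** * Arithmetic and encodings as loop programs *)
Lemma bits_aux_fuel f f' m : m <= f -> m <= f' -> bits_aux f m = bits_aux f' m.
Proof.
elim: f f' m => [|f IH] [|f'] [|m] //= lf lf'; congr (_ :: _); apply: IH; lia.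
Qed.

Lemma bits0 : bits 0 = [::]. Proof. by []. Qed.

Lemma bitsS m : 0 < m -> bits m = odd m :: bits m./2.
Proof. by case: m => // m _; rewrite /bits /=; congr (_ :: _); apply: bits_aux_fuel; lia. Qed.

Lemma bits_inj : injective bits.
Proof.
pose dec s := foldr (fun (b : bool) x => b + x.*2) 0 s.
apply: (can_inj (g := dec)) => m; have [k] := ubnP m; elim: k m => // k IH m lt.
case: (posnP m) => [->//|m0]; rewrite bitsS //= IH; last by lia.
by rewrite odd_double_half.
Qed.

Lemma enc_nat_inj m m' s s' : enc_nat m ++ s = enc_nat m' ++ s' -> m = m' /\ s = s'.
Proof.
rewrite /enc_nat -!catA => H.
suff : bits m = bits m' /\ s = s' by case=> /bits_inj.
elim: (bits m) (bits m') H => [|b l IH] [|b' l'] //= [].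
  by move=> ->.
by move=> -> /IH [-> ->].
Qed.

Lemma enc_nats_inj : injective enc_nats.
Proof.
have nz m s : enc_nats (m :: s) <> [::] by rewrite /enc_nats /= /enc_nat; case: (bits m).
elim=> [|m s IH] [|m' s'] // H.
- by have := nz m' s'; rewrite -H.
- by have := nz m s; rewrite H.
by have [-> /IH ->] := enc_nat_inj H.
Qed.

(** Membership of a code in the language thus speaks of the encoded spider itself. *)
Lemma enc_instance_inj n k t E n' k' t' E' :
  enc_instance n k t E = enc_instance n' k' t' E' -> [/\ n = n', k = k', t = t' & E = E'].
Proof.
move=> /enc_nats_inj [-> -> -> H]; split=> //.
elim: E E' H => [|[x y] E IH] [|[x' y'] E'] //= [-> ->].
by move=> /IH ->.
Qed.

Lemma PE_const k c : @PE k (fun _ => c).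
Proof. by elim: c => [|c IH]; [exact: PE_zero | exact: PE_succ]. Qed.

Lemma PE_size k : @PE k (fun g => size (inp g)).
Proof. by elim: k => [|k IH]; [exact: PE_len | exact: (PE_wk IH)]. Qed.

Lemma PE_add k (F G : ctx k -> nat) : PE F -> PE G -> PE (fun g => F g + G g).
Proof.
move=> HF HG; apply: (PE_ext (F := fun g => \sum_(i < 2) (if (i : nat) == 0 then F g else G g))).
  by move=> g; rewrite !big_ord_recr big_ord0.
apply: (PE_sum (F2 := fun g i => if i == 0 then F g else G g)); first exact: PE_const.
by apply: PE_if (PE_var k) (PE_zero _) (PE_wk HF) (PE_wk HG).
Qed.

Lemma PE_mul k (F G : ctx k -> nat) : PE F -> PE G -> PE (fun g => F g * G g).
Proof.
move=> HF HG; apply: (PE_ext (F := fun g => \sum_(i < F g) G g)).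
  by move=> g; rewrite sum_nat_const card_ord.
exact: (PE_sum (F2 := fun g i => G g)) HF (PE_wk HG).
Qed.

Definition PB k (b : ctx k -> bool) := PE (fun g => nat_of_bool (b g)).

Lemma PB_ext k (b c : ctx k -> bool) : b =1 c -> PB b -> PB c.
Proof. by move=> e; apply: PE_ext => g; rewrite e. Qed.

Lemma PB_const k b : @PB k (fun _ => b).
Proof. exact: PE_const. Qed.

Lemma PB_eq k (F G : ctx k -> nat) : PE F -> PE G -> PB (fun g => F g == G g).
Proof.
move=> HF HG; apply: PE_ext (PE_if HF HG (PE_const k 1) (PE_const k 0)) => g.
by case: eqP.
Qed.

Lemma PE_ite k (b : ctx k -> bool) (F G : ctx k -> nat) :
  PB b -> PE F -> PE G -> PE (fun g => if b g then F g else G g).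
Proof.
move=> Hb HF HG; apply: PE_ext (PE_if Hb (PE_const k 1) HF HG) => g.
by case: (b g).
Qed.

Lemma PB_ite k (b c d : ctx k -> bool) :
  PB b -> PB c -> PB d -> PB (fun g => if b g then c g else d g).
Proof. by move=> Hb Hc Hd; apply: PE_ext (PE_ite Hb Hc Hd) => g; case: (b g). Qed.

Lemma PB_neg k (b : ctx k -> bool) : PB b -> PB (fun g => ~~ b g).
Proof. by move=> Hb; apply: PB_ext (PB_ite Hb (PB_const k false) (PB_const k true)) => g; case: (b g). Qed.

Lemma PB_and k (b c : ctx k -> bool) : PB b -> PB c -> PB (fun g => b g && c g).
Proof. by move=> Hb Hc; apply: (PB_ite Hb Hc (PB_const k false)). Qed.

Lemma PB_or k (b c : ctx k -> bool) : PB b -> PB c -> PB (fun g => b g || c g).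
Proof. by move=> Hb Hc; apply: (PB_ite Hb (PB_const k true) Hc). Qed.

Lemma PB_imply k (b c : ctx k -> bool) : PB b -> PB c -> PB (fun g => b g ==> c g).
Proof. by move=> Hb Hc; apply: (PB_ite Hb Hc (PB_const k true)). Qed.

Lemma sum_ltn N m : \sum_(u < N) (u < m) = minn m N.
Proof. by elim: N => [|N IH]; rewrite ?big_ord0 ?minn0 // big_ord_recr /= IH; case: ltnP; lia. Qed.

Lemma PB_ltn k (F G : ctx k -> nat) : PE F -> PE G -> PB (fun g => F g < G g).
Proof.
move=> HF HG; apply: (PE_ext (F := fun g => \sum_(i < G g) ((i : nat) == F g))).
  move=> g; elim: (G g) => [|m IH]; first by rewrite big_ord0.
  by rewrite big_ord_recr /= IH; lia.
exact: (PE_sum (F2 := fun g i => i == F g)) HG (PB_eq (PE_var k) (PE_wk HF)).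
Qed.

Lemma PB_leq k (F G : ctx k -> nat) : PE F -> PE G -> PB (fun g => F g <= G g).
Proof. by move=> HF HG; apply: PB_ltn HF (PE_succ HG). Qed.

Lemma PE_sub k (F G : ctx k -> nat) : PE F -> PE G -> PE (fun g => F g - G g).
Proof.
move=> HF HG; apply: (PE_ext (F := fun g => \sum_(i < F g) (G g <= i))).
  move=> g; elim: (F g) => [|m IH]; first by rewrite big_ord0.
  by rewrite big_ord_recr /= IH; case: leqP; lia.
exact: (PE_sum (F2 := fun g i => G g <= i)) HF (PB_leq (PE_wk HG) (PE_var k)).
Qed.

(** The quotient counts the positive multiples of the divisor up to the dividend. *)
Lemma PE_div k (F G : ctx k -> nat) : PE F -> PE G -> PE (fun g => F g %/ G g).
Proof.
move=> HF HG; apply: (PE_ext (F := fun g => if G g == 0 then 0 else \sum_(u < F g) (u.+1 * G g <= F g))).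
  move=> g; case: posnP => [->|G0]; first by rewrite divn0.
  rewrite (eq_bigr (fun u : 'I_(F g) => nat_of_bool (u < F g %/ G g))) => [|u _]; last by rewrite leq_divRL.
  by rewrite sum_ltn; apply/minn_idPl; apply: leq_div.
apply: (PE_if HG (PE_zero k) (PE_zero k)).
apply: (PE_sum (F2 := fun g i => i.+1 * G g <= F g) HF).
exact: PB_leq (PE_mul (PE_succ (PE_var k)) (PE_wk HG)) (PE_wk HF).
Qed.

Lemma PE_mod k (F G : ctx k -> nat) : PE F -> PE G -> PE (fun g => F g %% G g).
Proof.
move=> HF HG; apply: PE_ext (PE_sub HF (PE_mul (PE_div HF HG) HG)) => g.
by rewrite {1}(divn_eq (F g) (G g)) addKn.
Qed.

Lemma PE_half k (F : ctx k -> nat) : PE F -> PE (fun g => (F g)./2).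
Proof. by move=> HF; apply: PE_ext (PE_div HF (PE_const k 2)) => g; rewrite divn2. Qed.

Lemma PB_odd k (F : ctx k -> nat) : PE F -> PB (fun g => odd (F g)).
Proof. by move=> HF; apply: PE_ext (PE_mod HF (PE_const k 2)) => g; rewrite modn2. Qed.

Lemma PE_pred k (F : ctx k -> nat) : PE F -> PE (fun g => (F g).-1).
Proof. by move=> HF; apply: PE_ext (PE_sub HF (PE_const k 1)) => g; rewrite subn1. Qed.

Lemma PE_exp k (F : ctx k -> nat) c : PE F -> PE (fun g => F g ^ c).
Proof.
move=> HF; elim: c => [|c IH]; first exact: PE_const.
by apply: PE_ext (PE_mul HF IH) => g; rewrite expnS.
Qed.

Lemma PE_bigsum k (I : Type) (s : seq I) (F : I -> ctx k -> nat) :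
  (forall i, PE (F i)) -> PE (fun g => \sum_(i <- s) F i g).
Proof.
move=> H; elim: s => [|i s IH].
  by apply: PE_ext (PE_zero k) => g; rewrite big_nil.
by apply: PE_ext (PE_add (H i) IH) => g; rewrite big_cons.
Qed.

Lemma PC_ite k (b : ctx k -> bool) (F G : ctx k -> seq bool) :
  PB b -> PC F -> PC G -> PC (fun g => if b g then F g else G g).
Proof.
move=> Hb HF HG; apply: PC_ext (PC_if Hb (PE_const k 1) HF HG) => g.
by case: (b g).
Qed.

(** A positive number is a power of two if it has no odd divisor above 1, which a bounded sum can
    test. *)
Definition ispow2 (p : nat) : bool :=
  (0 < p) && (\sum_(d < p.+1) [&& 1 < d, odd d & p %% d == 0] == 0).

Lemma ispow2P p : reflect (exists e, p = 2 ^ e) (ispow2 p).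
Proof.
apply: (iffP andP) => [[p0]|[e ->]].
  rewrite sum_nat_eq0 => /forallP H; exists (logn 2 p).
  have [m cm em] := pfactor_coprime (isT : prime 2) p0.
  have m0 : 0 < m by rewrite lt0n; apply: contraTneq p0 => m0; rewrite em m0.
  have mp : m < p.+1 by rewrite ltnS em leq_pmulr // expn_gt0.
  have mdv : m %| p by apply/dvdnP; exists (2 ^ logn 2 p); rewrite mulnC.
  have := H (Ordinal mp); rewrite /= -coprime2n cm /= -/(dvdn m p) mdv andbT.
  by case: m m0 em {cm mp mdv} => [|[|m]] //; rewrite mul1n.
split; first by rewrite expn_gt0.
rewrite sum_nat_eq0; apply/forallP => d; apply/implyP => _; rewrite eqb0.
apply/negP => /and3P [d1 od]; rewrite -/(dvdn _ _) => /(dvdn_pfactor _ _ (isT : prime 2)) [f _ ed].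
by move: d1 od; rewrite ed; case: f {ed} => // f _; rewrite oddX.
Qed.

Lemma size_bits m e : (e < size (bits m)) = (2 ^ e <= m).
Proof.
elim: e m => [|e IH] m; case: (posnP m) => [->|m0].
- by [].
- by rewrite bitsS.
- by rewrite bits0 [RHS]leqNgt expn_gt0.
rewrite bitsS //= ltnS IH expnS mul2n; move: (2 ^ e) => x.
by apply/idP/idP; lia.
Qed.

(** Loops run through all numbers up to a bound, so the bits are listed along the powers of two
    among [0 .. m]. This is affordable because the encoded numbers are themselves polynomially
    bounded. *)
Lemma bitsE m : bits m = [seq odd (m %/ p) | p <- iota 0 m.+1 & ispow2 p].
Proof.
have -> : [seq p <- iota 0 m.+1 | ispow2 p] = [seq 2 ^ e | e <- iota 0 (size (bits m))].
  apply: (irr_sorted_eq ltn_trans ltnn).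
  - by apply: sorted_filter (iota_ltn_sorted _ _); apply: ltn_trans.
  - rewrite sorted_map; apply: sub_sorted (iota_ltn_sorted 0 _) => x y /= lt.
    by rewrite ltn_exp2l.
  move=> p; rewrite mem_filter mem_iota add0n ltnS /=; apply/andP/mapP.
    by case=> /ispow2P [e ->] le; exists e => //; rewrite mem_iota add0n size_bits.
  case=> e; rewrite mem_iota add0n size_bits => le ->; split=> //.
  by apply/ispow2P; exists e.
rewrite -map_comp; have [k] := ubnP m; elim: k m => // k IH m lt.
case: (posnP m) => [->//|m0]; rewrite bitsS //= divn1; congr (_ :: _).
rewrite {1}IH; last by lia.
rewrite -[1]/(1 + 0) iotaDl -map_comp; apply: eq_map => e /=.
by rewrite add1n expnS -divn2 divnMA.
Qed.

Lemma enc_natE m : enc_nat m =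
  flatten [seq (if ispow2 p then [:: true] ++ (if odd (m %/ p) then [:: true] else [:: false]) else [::])
          | p <- iota 0 m.+1] ++ [:: false; false].
Proof.
rewrite /enc_nat bitsE; congr (_ ++ _); elim: (iota 0 m.+1) => //= p s IH.
by case: ifP => _ //=; rewrite IH; case: odd.
Qed.

Lemma PB_ispow2 k (F : ctx k -> nat) : PE F -> PB (fun g => ispow2 (F g)).
Proof.
move=> HF; apply: PB_and; first exact: PB_ltn (PE_zero k) HF.
apply: PB_eq (PE_zero k).
apply: (PE_sum (F2 := fun g d => [&& 1 < d, odd d & F g %% d == 0])); first exact: PE_succ.
apply: PB_and; first exact: PB_ltn (PE_const _ 1) (PE_var k).
apply: PB_and; first exact: PB_odd (PE_var k).
exact: PB_eq (PE_mod (PE_wk HF) (PE_var k)) (PE_zero _).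
Qed.

Lemma PC_enc_nat k (F : ctx k -> nat) : PE F -> PC (fun g => enc_nat (F g)).
Proof.
move=> HF; apply: PC_ext => [g|]; first by rewrite enc_natE.
apply: PC_cat; last by apply: (PC_cat (PC_out k false) (PC_out k false)).
apply: (PC_for (G := fun g p => if ispow2 p then [:: true] ++ (if odd (F g %/ p) then [:: true] else [:: false]) else [::])).
  exact: PE_succ.
apply: PC_ite; [exact: PB_ispow2 (PE_var k) | | exact: PC_nil].
apply: PC_cat; first exact: PC_out.
by apply: PC_ite; [exact: PB_odd (PE_div (PE_wk HF) (PE_var k)) | exact: PC_out | exact: PC_out].
Qed.

(** * Emitting the encoded spider *)

Section SpiderCode.
Variables (a : seq bool -> nat -> nat) (Q B : seq bool -> nat).
Hypothesis a_PE : forall k (F : ctx k -> nat), PE F -> PE (fun g => a (inp g) (F g)).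
Hypothesis Q_PE : forall k, @PE k (fun g => Q (inp g)).
Hypothesis B_PE : forall k, @PE k (fun g => B (inp g)).

Definition spider_code (w : seq bool) : seq bool :=
  let N := pre (a w) (Q w) in
  enc_instance N.+1 (B w).+1 (N * (B w).-1)./2 (spider_edges (a w) (Q w)).

Lemma enc_natsD s s' : enc_nats (s ++ s') = enc_nats s ++ enc_nats s'.
Proof. by rewrite /enc_nats map_cat flatten_cat. Qed.

Lemma PE_pre k (F : ctx k -> nat) : PE F -> PE (fun g => pre (a (inp g)) (F g)).
Proof. by move=> HF; apply: (PE_sum (F2 := fun g i => a (inp g) i)) HF (a_PE (PE_var k)). Qed.

Lemma PC_spider_code : @PC 0 spider_code.
Proof.
pose edge w q s := enc_nat (if s == 0 then 0 else pre (a w) q + s) ++ enc_nat (pre (a w) q + s).+1.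
have HN := PE_pre (Q_PE 0).
have E w : spider_code w = enc_nat (pre (a w) (Q w)).+1 ++ enc_nat (B w).+1 ++
    enc_nat (pre (a w) (Q w) * (B w).-1)./2 ++
    flatten [seq flatten [seq edge w q s | s <- iota 0 (a w q)] | q <- iota 0 (Q w)].
  have C x l : enc_nats (x :: l) = enc_nat x ++ enc_nats l by [].
  rewrite /spider_code /enc_instance 3!C; do 3!congr (_ ++ _).
  rewrite /spider_edges; elim: (iota 0 (Q w)) => //= q s IH.
  rewrite map_cat flatten_cat enc_natsD IH; congr (_ ++ _).
  rewrite /leg_edges -map_comp; elim: (iota 0 (a w q)) => //= u l IHl.
  by rewrite 2!C IHl /edge catA.
apply: (@PC_ext 0 _ _ (fun w => esym (E w))).
apply: PC_cat; first exact: PC_enc_nat (PE_succ HN).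
apply: PC_cat; first exact: PC_enc_nat (PE_succ (B_PE 0)).
apply: PC_cat; first exact: PC_enc_nat (PE_half (PE_mul HN (PE_pred (B_PE 0)))).
apply: (@PC_for 0 Q (fun w q => flatten [seq edge w q s | s <- iota 0 (a w q)])); first exact: (Q_PE 0).
apply: (@PC_for 1 (fun g => a g.1 g.2) (fun g s => edge g.1 g.2 s)); first exact: (a_PE (PE_var 0)).
have HP : @PE 2 (fun g => pre (a (inp g)) g.1.2 + g.2).
  exact: PE_add (PE_pre (PE_wk (PE_var 0))) (PE_var 1).
apply: PC_cat; last exact: PC_enc_nat (PE_succ HP).
by apply: PC_enc_nat; apply: (PE_ite (k := 2)); [exact: PB_eq (PE_var 1) (PE_zero 2) | exact: PE_zero | exact: HP].
Qed.

End SpiderCode.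

(** * The reduction *)
Lemma packable_bij (I J : finType) (h : J -> I) (a : I -> nat) (a' : J -> nat) B :
  bijective h -> (forall q, a' q = a (h q)) -> packable a' B <-> packable a B.
Proof.
move=> bh e; have [h' hK h'K] := bh; split=> -[T [f H]].
  exists T, (f \o h') => q; rewrite -(H (h' q)) (reindex h) /=; last exact: onW_bij.
  by apply: eq_big => [x|x _]; rewrite ?hK ?e.
exists T, (f \o h) => q; rewrite -(H (h q)) [RHS](reindex h) /=; last exact: onW_bij.
by apply: eq_bigr => x _; rewrite e.
Qed.

Lemma PE_sif k (b : bool) (F G : ctx k -> nat) : PE F -> PE G -> PE (fun g => if b then F g else G g).
Proof. by case: b. Qed.

Lemma halted_run M T T' w : T <= T' -> halted (run M T w) -> run M T' w = run M T w.
Proof.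
move=> /subnK <- h; rewrite /run iterD -/(run M T w); elim: (T' - T) => //= m ->.
by move: h; rewrite /halted /step => ->.
Qed.

Section Reduction.
Variables (M : TM) (ay dy a2 d2 : nat).

Definition guess n := ay * n ^ dy + ay.
Definition enc_len n := 2 * n + 2 + guess n.
(** Bounds the time of the verifier on every pair with an admissible certificate; the last summand
    makes the pair itself fit into a row. *)
Definition horizon n := a2 * enc_len n ^ d2 + a2 + enc_len n.

Local Notation tl := (tile M).
Definition colour : finType := option ((cell M * cell M) + cell M)%type.
Definition tile0 : tl := (blank M, blank M, blank M, blank M).

Local Notation T w := (horizon (size w)).
Local Notation Y w := (guess (size w)).
Definition cells (w : seq bool) := area (T w).

Definition ok_tile (w : seq bool) (i : nat) (t : tl) : bool :=
  allowed w (T w) (Y w) (i %/ width (T w)) (i %% width (T w)) t.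

(** A horizontal edge carries two cells and a vertical edge one. A tile not allowed at [i] shows
    [None], which is never an incoming colour, so the conditions on its position become matching
    conditions. *)
Definition out_colour (w : seq bool) (d : bool) (i : nat) (t : tl) : colour :=
  if d then Some (inr (t_b t))
  else if ok_tile w i t then Some (inl (t_m t, t_r t)) else None.

Definition in_colour (d : bool) (t : tl) : colour :=
  if d then Some (inr (t_m t)) else Some (inl (t_l t, t_m t)).

Definition shift (w : seq bool) (d : bool) := if d then width (T w) else 1.

Lemma shift_le w d : shift w d <= cells w.
Proof. by rewrite /shift /cells /area /width; case: d; rewrite ?leq_pmull //; lia. Qed.

Lemma cells_gt0 w : 0 < cells w.
Proof. by rewrite /cells /area /width muln_gt0; lia. Qed.

Definition next (w : seq bool) (d : bool) (i : nat) := (i + shift w d) %% cells w.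

Definition onext w d (i : 'I_(cells w)) : 'I_(cells w) := Ordinal (ltn_pmod (i + shift w d) (cells_gt0 w)).
Definition oprev w d (i : 'I_(cells w)) : 'I_(cells w) :=
  Ordinal (ltn_pmod (i + (cells w - shift w d)) (cells_gt0 w)).

Lemma onextK w d : cancel (@onext w d) (@oprev w d).
Proof.
move=> i; apply: val_inj; rewrite /= modnDml -addnA subnKC ?shift_le // modnDr modn_small //.
Qed.

Lemma oprevK w d : cancel (@oprev w d) (@onext w d).
Proof.
move=> i; apply: val_inj; rewrite /= modnDml -addnA subnK ?shift_le // modnDr modn_small //.
Qed.

Lemma tiling_colours w : (exists tau : nat -> tl, tiling w (T w) (Y w) tau) <->
  exists tau : 'I_(cells w) -> tl, forall d (i : 'I_(cells w)), out_colour w d i (tau i) = in_colour d (tau (onext d i)).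
Proof.
split=> [[tau H]|[tau H]].
  exists (fun i => tau i) => d i; have [H1 H2 H3] := H i (ltn_ord i).
  case: d; rewrite /out_colour /in_colour.
    by rewrite H3.
  rewrite /ok_tile H1; have -> : tau (onext false i) = tau ((i + 1) %% area (T w)) by [].
  by rewrite -H2.
pose i0 : 'I_(cells w) := Ordinal (cells_gt0 w).
exists (fun i => tau (insubd i0 i)) => i lti.
have ei j (lt : j < cells w) : insubd i0 j = Ordinal lt.
  by apply: val_inj; rewrite /= insubdK.
rewrite ei; set oi := Ordinal lti.
have en d : insubd i0 ((i + shift w d) %% area (T w)) = onext d oi.
  by rewrite (ei _ (ltn_pmod _ (cells_gt0 w))); apply: val_inj.
have := H false oi; rewrite /out_colour /in_colour /=.
case: ifP => // ok [e1 e2]; split=> //.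
  by have := en false; rewrite /shift => ->; rewrite e1 e2.
by have := en true; rewrite /shift => ->; have := H true oi => -[].
Qed.

(** * Leg lengths as programs *)

Local Notation lgs := (tl + bool * colour)%type.
Local Notation egs := (tl * option (bool * bool) + bool * colour * option bool)%type.
(** An item without its cell. Kinds depend on the machine only, so sums over them unroll into
    expressions of fixed size, while the cell is a number computed by the program. *)
Definition kinds : finType := (lgs + egs)%type.

Definition mk_item w (i : 'I_(cells w)) (g : kinds) : item (cells w) tl colour :=
  match g with inl l => inl (i, l) | inr e => inr (i, e) end.

(** Restates [expects], and the next definitions its companions, for plain numbers in place of
    ordinals, whose type depends on the input. *)
Definition n_expects w (l : lgs) (k i : nat) : option nat :=
  match l with
  | inl t => Some (if k == 0 then i
      else eid i (if cls_side k then in_colour (cls_dir k) t else out_colour w (cls_dir k) i t))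
  | inr (d, c) => if k == 0 then Some (sid (cells w) d i)
      else if cls_dir k == d then Some (eid (if cls_side k then next w d i else i) c) else None
  end.

Definition n_class (e : egs) : nat :=
  match e with
  | inl (_, None) | inr (_, None) => 0
  | inl (_, Some (d, s)) => cls d s
  | inr ((d, _), Some s) => cls d s
  end.

Definition n_id w (e : egs) (i : nat) : nat :=
  match e with
  | inl (_, None) => i
  | inl (t, Some (d, s)) => eid i (if s then in_colour d t else out_colour w d i t)
  | inr ((d, _), None) => sid (cells w) d i
  | inr ((d, c), Some s) => eid i c
  end.

Definition n_mode (e : egs) : nat :=
  match e with
  | inl (t, None) => if t == tile0 then 4 else 0
  | inl (_, Some _) => 1
  | inr ((_, c), None) => if c == None then 0 else 2
  | inr (_, Some _) => 0
  end.

Definition n_digit w (g : kinds) (j i : nat) : nat :=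
  match g with
  | inl l => if j == 11 then 20 - (if l is inl _ then 5 else 3)
             else if j == 10 then 4 - (if l is inl _ then 4 else 2)
             else if odd j then id_max (cells w) colour - odflt 0 (n_expects w l j./2 i)
             else ~~ isSome (n_expects w l j./2 i)
  | inr e => if j == 11 then 1 else if j == 10 then n_mode e
             else if j./2 == n_class e then (if odd j then n_id w e i else 1) else 0
  end.

Definition n_weight w (g : kinds) (i : nat) : nat :=
  \sum_(j < 12) n_digit w g j i * base (cells w) colour ^ j.

Definition o_out w (d : bool) (i : 'I_(cells w)) t := out_colour w d i t.
Definition weights w := @weight_of (cells w) tl colour tile0 None (@o_out w) in_colour (@onext w).

Lemma n_weightE w (i : 'I_(cells w)) g : n_weight w g i = weights (mk_item i g).
Proof.
rewrite /n_weight /weights /weight_of /number; apply: eq_bigr => j _; congr (_ * _).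
case: g => [[t|[d c]]|[[t [[d s]|]]|[[d c] [s|]]]] //.
by rewrite /= /ld_digit /expects /=; do 3!(case: ifP => // _); case: cls_side.
Qed.

Definition nk := #|kinds|.

Lemma nk_gt0 : 0 < nk.
Proof. by apply/card_gt0P; exists (inl (inl tile0)). Qed.

(** Leg [q] stands for the item in cell [q %/ nk] whose kind has rank [q %% nk]; the sum over all
    kinds is a case distinction. *)
Definition legs (w : seq bool) (q : nat) : nat :=
  \sum_(g <- enum kinds) (if q %% nk == enum_rank g then n_weight w g (q %/ nk) else 0).
Definition num_legs (w : seq bool) := cells w * nk.
Definition bound (w : seq bool) := capacity (cells w) colour.

Lemma leg_cell w (q : 'I_(num_legs w)) : q %/ nk < cells w.
Proof. by rewrite ltn_divLR ?nk_gt0 // ltn_ord. Qed.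

Lemma leg_kind (q : nat) : q %% nk < nk.
Proof. by rewrite ltn_mod nk_gt0. Qed.

Definition leg_item w (q : 'I_(num_legs w)) : item (cells w) tl colour :=
  mk_item (Ordinal (leg_cell q)) (enum_val (Ordinal (leg_kind q))).

Lemma sum_kind (W : kinds -> nat) (q : nat) :
  \sum_(g <- enum kinds) (if q %% nk == enum_rank g then W g else 0) =
  W (enum_val (Ordinal (leg_kind q))).
Proof.
rewrite big_enum /=; set g0 := enum_val _; rewrite (bigD1 g0) //= big1 ?addn0 => [|g ne].
  by rewrite /g0 enum_valK eqxx.
case: eqP => // e; case/eqP: ne; rewrite /g0; apply: enum_rank_inj; rewrite enum_valK.
by apply: val_inj; rewrite /= -e.
Qed.

Lemma legsE w (q : 'I_(num_legs w)) : legs w q = weights (leg_item q).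
Proof. by rewrite /legs sum_kind /leg_item -n_weightE. Qed.

Lemma leg_item_bij w : bijective (@leg_item w).
Proof.
apply: inj_card_bij => [q q'|]; last first.
  by rewrite card_ord /item card_sum /ld /elem !card_prod !card_ord -mulnDr /num_legs /nk /kinds card_sum !card_sum !card_prod.
rewrite /leg_item => e.
have mk_inj (i i' : 'I_(cells w)) g g' : mk_item i g = mk_item i' g' -> i = i' /\ g = g'.
  by case: g => g; case: g' => g' // [-> ->].
have [e1 /enum_val_inj e2] := mk_inj _ _ _ _ e.
apply: val_inj; rewrite /= (divn_eq q nk) (divn_eq q' nk).
by have /(congr1 val) /= -> := e1; have /(congr1 val) /= -> := e2.
Qed.

Lemma PE_guess k : @PE k (fun g => guess (size (inp g))).
Proof. exact: PE_add (PE_mul (PE_const k ay) (PE_exp dy (PE_size k))) (PE_const k ay). Qed.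

Lemma PE_prefix_len k : @PE k (fun g => 2 * size (inp g) + 2).
Proof. exact: PE_add (PE_mul (PE_const k 2) (PE_size k)) (PE_const k 2). Qed.

Lemma PE_T k : @PE k (fun g => T (inp g)).
Proof.
have HL : @PE k (fun g => enc_len (size (inp g))) by exact: PE_add (PE_prefix_len k) (PE_guess k).
exact: PE_add (PE_add (PE_mul (PE_const k a2) (PE_exp d2 HL)) (PE_const k a2)) HL.
Qed.

Lemma PE_width k : @PE k (fun g => width (T (inp g))).
Proof. exact: PE_add (PE_mul (PE_const k 2) (PE_T k)) (PE_const k 3). Qed.

Lemma PE_cells k : @PE k (fun g => cells (inp g)).
Proof. exact: PE_mul (PE_succ (PE_T k)) (PE_width k). Qed.

Lemma PE_id_max k : @PE k (fun g => id_max (cells (inp g)) colour).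
Proof.
exact: PE_add (PE_mul (PE_const k 3) (PE_cells k)) (PE_mul (PE_cells k) (PE_const k #|colour|)).
Qed.

Lemma PE_base k : @PE k (fun g => base (cells (inp g)) colour).
Proof. exact: PE_mul (PE_const k 21) (PE_add (PE_id_max k) (PE_const k 20)). Qed.

Lemma PB_prefix_bit k (F : ctx k -> nat) : PE F -> PB (fun g => prefix_bit (inp g) (F g)).
Proof.
(* Programs address the input from its end, so index [i] becomes [size - i.+1]. *)
move=> HF; apply: (PB_ext (b := fun g => (F g < 2 * size (inp g)) &&
    (~~ odd (F g) || nth false (rev (inp g)) (size (inp g) - (F g)./2.+1)))).
  move=> g; rewrite /prefix_bit; case: ltnP => //= lt; congr (_ || _).
  by rewrite nth_rev; [congr nth; lia | lia].
apply: PB_and; first exact: PB_ltn HF (PE_mul (PE_const k 2) (PE_size k)).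
apply: PB_or; first exact: PB_neg (PB_odd HF).
exact: PE_inp (PE_sub (PE_size k) (PE_succ (PE_half HF))).
Qed.

Lemma PB_init_sym k (F : ctx k -> nat) a b : PE F ->
  PB (fun g => init_sym (inp g) (T (inp g)) (Y (inp g)) (F g) a b).
Proof.
move=> HF; have HO : @PE k (fun g => origin (T (inp g))) by exact: PE_succ (PE_T k).
have HP := PE_add HO (PE_prefix_len k).
apply: PB_ite; [exact: PB_ltn HF HO | exact: PB_const |].
apply: PB_ite; [exact: PB_ltn HF HP | |].
  apply: PB_ext (PB_ite (PB_prefix_bit (PE_sub HF HO)) (PB_const k (a == Some true)) (PB_const k (a == Some false))) => g.
  by case: prefix_bit.
apply: PB_ite; [exact: PB_ltn HF (PE_add HP (PE_guess k)) | exact: PB_const | exact: PB_const].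
Qed.

(** The tile is fixed, so conditions on its cells alone are boolean constants, and only its position
    is computed. *)
Lemma PB_ok_tile k (F : ctx k -> nat) t : PE F -> PB (fun g => ok_tile (inp g) (F g) t).
Proof.
move=> HF; have Ht := PE_div HF (PE_width k); have Hp := PE_mod HF (PE_width k).
have HO : @PE k (fun g => origin (T (inp g))) by exact: PE_succ (PE_T k).
apply: PB_and; first exact: PB_imply (PB_ltn Ht (PE_T k)) (PB_const k _).
apply: PB_and.
  apply: PB_imply; first exact: PB_eq Ht (PE_zero k).
  apply: PB_and; last exact: PB_init_sym.
  apply: PB_ext (PB_ite (PB_eq Hp HO) (PB_const k ((t_m t).2 == Some (tm_start M))) (PB_const k ((t_m t).2 == None))) => g.
  by case: ifP.
apply: PB_and; first exact: PB_imply (PB_eq Ht (PE_T k)) (PB_const k _).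
apply: PB_and; first exact: PB_imply (PB_eq Hp (PE_zero k)) (PB_const k _).
exact: PB_imply (PB_eq Hp (PE_pred (PE_width k))) (PB_const k _).
Qed.

Lemma PE_eid k (F : ctx k -> nat) (c : colour) : PE F -> PE (fun g => eid (F g) c).
Proof. by move=> HF; exact: PE_add (PE_mul HF (PE_const k #|colour|)) (PE_const k _). Qed.

Lemma PE_eid_out k (F : ctx k -> nat) d t : PE F ->
  PE (fun g => eid (F g) (out_colour (inp g) d (F g) t)).
Proof.
move=> HF; case: d; first exact: PE_eid.
pose c : colour := Some (inl (t_m t, t_r t)).
apply: PE_ext (PE_ite (PB_ok_tile t HF) (PE_eid c HF) (PE_eid None HF)) => g.
by rewrite /out_colour; case: ok_tile.
Qed.

Lemma PE_sid k (F : ctx k -> nat) d : PE F -> PE (fun g => sid (cells (inp g)) d (F g)).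
Proof. by move=> HF; exact: PE_add (PE_mul (PE_cells k) (PE_const k d.+1)) HF. Qed.

Lemma PE_next k (F : ctx k -> nat) d : PE F -> PE (fun g => next (inp g) d (F g)).
Proof.
move=> HF; apply: PE_mod (PE_cells k); apply: (PE_add HF).
by case: d; [exact: PE_width | exact: PE_const].
Qed.

Lemma PE_n_digit k (F : ctx k -> nat) x j : PE F -> PE (fun g => n_digit (inp g) x j (F g)).
Proof.
move=> HF; case: x => [l|e].
  apply: PE_sif; first exact: PE_const.
  apply: PE_sif; first exact: PE_const.
  apply: PE_sif.
    apply: PE_sub (PE_id_max k) _; case: l => [t|[d c]] /=.
      apply: PE_sif => //; case: cls_side; [exact: PE_eid | exact: PE_eid_out].
    case: (j./2 == 0); first exact: PE_sid.
    case: (cls_dir _ == d); last exact: PE_const.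
    by case: cls_side; [exact: PE_eid (PE_next d HF) | exact: PE_eid].
  case: l => [t|[d c]] /=; first exact: PE_const.
  case: (j./2 == 0); first exact: PE_const.
  by case: (cls_dir _ == d); exact: PE_const.
apply: PE_sif; first exact: PE_const.
apply: PE_sif; first exact: PE_const.
apply: PE_sif; last exact: PE_const.
apply: PE_sif; last exact: PE_const.
case: e => [[t [[d s]|]]|[[d c] [s|]]] //=.
- by case: s; [exact: PE_eid | exact: PE_eid_out].
- exact: PE_eid.
- exact: PE_sid.
Qed.

Lemma PE_legs k (F : ctx k -> nat) : PE F -> PE (fun g => legs (inp g) (F g)).
Proof.
move=> HF; apply: (@PE_bigsum k _ (enum kinds) (fun x g => if F g %% nk == enum_rank x then n_weight (inp g) x (F g %/ nk) else 0)).
move=> x; apply: PE_if (PE_mod HF (PE_const k _)) (PE_const k _) _ (PE_zero k).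
apply: (@PE_bigsum k _ (index_enum _) (fun (j : 'I_12) g => n_digit (inp g) x j (F g %/ nk) * base (cells (inp g)) colour ^ j)) => j.
exact: PE_mul (PE_n_digit _ _ (PE_div HF (PE_const k _))) (PE_exp _ (PE_base k)).
Qed.

Lemma PE_num_legs k : @PE k (fun g => num_legs (inp g)).
Proof. exact: PE_mul (PE_cells k) (PE_const k _). Qed.

Lemma PE_bound k : @PE k (fun g => bound (inp g)).
Proof.
apply: (@PE_bigsum k _ (index_enum _) (fun (j : 'I_12) g => bin_digit (cells (inp g)) colour j * base (cells (inp g)) colour ^ j)) => j.
apply: PE_mul (PE_exp _ (PE_base k)).
apply: PE_sif; first exact: PE_const.
apply: PE_sif; first exact: PE_const.
by apply: PE_sif; [exact: PE_id_max | exact: PE_const].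
Qed.

Definition reduction : seq bool -> seq bool := spider_code legs num_legs bound.

Lemma reduction_poly_time : poly_time_computable reduction.
Proof.
apply: PC_poly_time; apply: PC_spider_code; [exact: PE_legs | exact: PE_num_legs | exact: PE_bound].
Qed.

Lemma reduction_packable w :
  SPIDER_COMPLETION (reduction w) <-> packable (fun q : 'I_(num_legs w) => legs w q) (bound w).
Proof.
have gt0 q : q < num_legs w -> 0 < legs w q.
  by move=> lt; rewrite (legsE (Ordinal lt)); apply: weight_gt0.
have leB q : q < num_legs w -> legs w q <= bound w.
  by move=> lt; rewrite (legsE (Ordinal lt)); apply: weight_le.
have Q3 : 2 < num_legs w.
  rewrite /num_legs; apply: leq_trans (leq_pmulr _ nk_gt0).
  by rewrite /cells /area /width; move: (T w) => x; nia.
rewrite -(spider_completion_packable gt0 leB Q3); split=> [[n [k [t [E [e _ _ _ H]]]]]|H].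
  by move: e H => /enc_instance_inj [<- <- <- <-].
exists (pre (legs w) (num_legs w)).+1, (bound w).+1, (pre (legs w) (num_legs w) * (bound w).-1)./2,
  (spider_edges (legs w) (num_legs w)); split=> //.
- exact: spider_wf.
- exact: spider_is_spider.
- by rewrite ltnS; apply: packable_leq; first exact: Q3; apply/(spider_completion_packable gt0 leB Q3).
Qed.

Lemma reduction_tiling w :
  SPIDER_COMPLETION (reduction w) <-> exists tau : nat -> tl, tiling w (T w) (Y w) tau.
Proof.
rewrite reduction_packable tiling_colours (packable_bij _ (leg_item_bij w) (@legsE w)).
exact: (tiling_packable tile0 None (@o_out w) in_colour (@onextK w) (@oprevK w)).
Qed.

End Reduction.

Theorem theorem4 : NP_hard SPIDER_COMPLETION.
Proof.
move=> L' [V [[b [[M [a2 [d2 Mb]]] Vb]] [ay [dy LV]]]].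
exists (reduction M ay dy a2 d2); split; first exact: reduction_poly_time.
move=> w.
have fit : 2 * size w + 2 + guess ay dy (size w) <= horizon ay dy a2 d2 (size w).
  by rewrite /horizon; apply: leq_addl.
have bok y : size y <= guess ay dy (size w) ->
    output (run M (horizon ay dy a2 d2 (size w)) (pair_enc w y)) = [:: b (pair_enc w y)].
  (* The verifier halts within its own time bound, which [horizon] dominates, and a halted run no
     longer changes. *)
  move=> sy; have [h <-] := Mb (pair_enc w y); congr output; apply: halted_run h.
  have le : size (pair_enc w y) <= enc_len ay dy (size w).
    by rewrite size_pair_enc /enc_len leq_add2l.
  rewrite /horizon; apply: leq_trans (leq_addr _ _); rewrite leq_add2r leq_mul2l.
  by case: (d2) => [|d]; rewrite ?expn0 ?leqnn ?orbT // leq_exp2r // le orbT.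
rewrite reduction_tiling -(tiling_correct fit bok) LV.
split=> [[y [sy Vy]]|[y sy by_]]; exists y => //; first exact/Vb.
by split=> //; apply/Vb.
Qed.
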